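(* Let $M$ be an expansion $0\to A^*\xrightarrow{\iota}B\xrightarrow{\nu}C^*\to0$ of a pure short exact sequence of Abelian structures expanded by $\Phi$, with $\Phi$ a fundamental system for $B$ (see context). Let $\Gamma\subseteq\Delta\subseteq M^{eq}$ with $\Gamma=\mathrm{dcl}^{eq}(\Gamma)$, $\Delta=\mathrm{dcl}^{eq}(\Delta)$, where $M$ is $|\Delta|^+$-saturated and strongly $|\Delta|^+$-homogeneous, and let $u$ be a finite tuple of $M$. Assume: (H1) for every $\phi\in\Phi$, each coset in $C/\phi(C)$ belonging to $\mathrm{acl}^{eq}(\Gamma)$ belongs to $\Gamma$; (H2) $\Delta=\mathrm{dcl}^{eq}(A^*(\Delta)\cup B(\Delta)\cup C^*(\Delta))$. Let $p_0$ be the partial type over $\Gamma$ associated with $u$ defined in the context. Let $S_{\mathbf f}^\Delta$ be the Stone space of all complete types over $\Delta$ (in the variables of $u$) which extend $p_0$ and do not fork over $\Gamma$. Let $\mathcal{A}_{\mathbf f}^\Delta$ (resp. $\mathcal{C}_{\mathbf f}^\Delta$) be the space of $A$-types $\mathrm{tp}_A(v/\Delta)$ (resp. $C$-types $\mathrm{tp}_C(v/\Delta)$) of realizations $v$ of $p_0$ such that $\mathrm{tp}(v/\Delta)$ does not fork over $\Gamma$. Then $S_{\mathbf f}^\Delta$ is naturally homeomorphic, via $\mathrm{tp}(v/\Delta)\mapsto(\mathrm{tp}_A(v/\Delta),\mathrm{tp}_C(v/\Delta))$, to $\mathcal{A}_{\mathbf f}^\Delta\times\mathcal{C}_{\mathbf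 f}^\Delta$.
   Context: Fix a multi-sorted language $\mathcal{L}$. p.p.-formulas are the formulas in the closure of parameter-free atomic formulas under finite conjunction and existential quantification. An Abelian structure is an $\mathcal{L}$-structure such that each sort expands an Abelian group, each parameter-free term is a group homomorphism, and each p.p.-formula $\phi(x_{s_1},\dots,x_{s_n})$ defines a subgroup of the product of the corresponding sorts. For an Abelian structure $A$, $A/\phi(A)$ denotes the quotient of that product by $\phi(A)$. A fundamental system for $B$ is a set $\Phi$ of p.p.-formulas such that, modulo the theory of $B$, every p.p.-formula is equivalent to a finite conjunction of formulas $\phi(t(x))$ with $\phi\in\Phi$ and $t$ a tuple of parameter-free terms. An embedding $\iota:A\to B$ is pure if $\iota^{-1}(\phi(B))=\phi(A)$ for every p.p.-formula $\phi$. A pure short exact sequence expanded by $\Phi$ consists of Abelian structures $A,B,C$ on disjoint copies of $\mathcal{L}$, a pure embedding $\iota:A\to B$, a surjective morphism $\nu:B\to C$ with $\mathrm{Im}(\iota)=\mathrm{Ker}(\nu)$ on each sort and $\nu^{-1}(\phi(C))=\phi(B)+\iota(A)$ for all p.p. $\phi$, and for each $\phi\in\Phi$ the sort $A/\phi(A)$, the quotient map $\pi_\phi:A\to A/\phi(A)$, and the map $\rho_\phi:B\to A/\phi(A)$ which is $0$ outside $\phi(B)+\iota(A)$ and on $\phi(B)+\iota(A)$ is the homomorphism $\phi(B)+\iota(A)\to(\phi(B)+\iota(A))/\phi(B)\simeq A/\phi(A)$. $A^*$ is an arbitrary expansion of $A$ together with the sorts $A/\phi(A)$ and maps $\pi_\phi$,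 in a language $\mathcal{L}_A$; $C^*$ is an arbitrary expansion of $C$, in a language $\mathcal{L}_C$; $\mathcal{L}_B$ is the language of $B$. $M$ is the resulting expansion of the sequence. For $D\subseteq M^{eq}$, $A^*(D),B(D),C^*(D)$ are the sets of elements of $D$ in the sorts of $A^*,B,C^*$. A tuple $u$ is written $u_Au_Bu_C$ according to sorts, and similarly for variables. A $C$-formula over $D$ is a formula $\psi_C(\nu(x_B),x_C,\gamma)$ with $\psi_C\in\mathcal{L}_C$ parameter-free, $\gamma\in C^*(D)$; an $A$-formula over $D$ is a formula $\psi_A(\alpha,x_A,(\rho_{\phi_i}(t_i(x_B)-\beta_i))_i)$ with $\psi_A\in\mathcal{L}_A$ parameter-free, finitely many $\phi_i\in\Phi$, $t_i$ (tuples of) parameter-free $\mathcal{L}_B$-terms, $\alpha\in A^*(D)$, $\beta_i\in B(D)$. $\mathrm{tp}_A(u/D)$ (resp. $\mathrm{tp}_C(u/D)$) is the set of $A$-formulas (resp. $C$-formulas) over $D$ satisfied by $u$; spaces of such types carry the topology generated by $A$-formulas (resp. $C$-formulas). Let $\mathcal{T}$ be the set of (tuples of) parameter-free $\mathcal{L}_B$-terms, $E_0^+=\{(\phi,t)\in\Phi\times\mathcal{T}:\nu(t(u_B))+\phi(C)\in\Gamma\}$ (the coset viewed as an element of the sort $C/\phi(C)$ of $M^{eq}$), $E_0^-=(\Phi\times\mathcal{T})\smallsetminus E_0^+$, and $$p_0(x_A,x_B,x_C)=\{\nu(t(x_B-u_B))\in\phi(C):(\phi,t)\in E_0^+\}\cup\{\nu(t(x_B))+\phi(C)\ne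 X:(\phi,t)\in E_0^-,\ X\in (C/\phi(C))(\Gamma)\},$$ which is equivalent to a partial type over $\Gamma$, realized by $u$. Forking: a formula divides over $\Gamma$ if for some $\Gamma$-indiscernible sequence of conjugates of its parameters, starting with the original, the corresponding formulas are jointly inconsistent; it forks over $\Gamma$ if it implies a finite disjunction of formulas dividing over $\Gamma$; a type forks over $\Gamma$ if it implies a formula that does. *)

(* Defs.v *)
From HB Require Import structures.
From mathcomp Require Import all_boot all_order all_algebra.
From mathcomp Require Import boolp classical_sets functions cardinality topology.

Set Implicit Arguments.
Unset Strict Implicit.
Unset Printing Implicit Defensive.

Import GRing.Theory.

Local Open Scope classical_set_scope.
Local Open Scope card_scope.
Local Open Scope ring_scope.

(* A context is a family of variables, each with its sort.  Finite tuples of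
   sorts are kept apart as arities: languages store arities, whereas a context
   may be indexed by a large type such as a set of parameters. *)
Record ctx (S : Type) := Ctx { idx : Type; srt :> idx -> S }.

Record arity (S : Type) := Arity { alen : nat; asrt : 'I_alen -> S }.

Arguments asrt {S} a i.

Coercion actx S (a : arity S) : ctx S := Ctx (asrt a).

Definition amap S S' (h : S -> S') (a : arity S) : arity S' :=
  Arity (fun i => h (asrt a i)).

Definition cmap S S' (h : S -> S') (c : ctx S) : ctx S' :=
  Ctx (fun i => h (c i)).

Definition one S (s : S) : ctx S := Ctx (fun _ : unit => s).

Definition cadd S (c d : ctx S) : ctx S :=
  Ctx (fun i : idx c + idx d => match i with inl j => c j | inr k => d k end).

Definition cext S (c : ctx S) (s : S) : ctx S :=
  Ctx (fun i : option (idx c) => match i with Some j => c j | None => s end).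

Definition tup S (car : S -> Type) (c : ctx S) : Type := forall i : idx c, car (c i).

Definition tadd S (car : S -> Type) (c d : ctx S) (x : tup car c) (y : tup car d) :
    tup car (cadd c d) :=
  fun i => match i with inl j => x j | inr k => y k end.

Definition text S (car : S -> Type) (c : ctx S) (s : S) (x : tup car c) (e : car s) :
    tup car (cext c s) :=
  fun i => match i with Some j => x j | None => e end.

Record lang := Lang {
  lsort : Type;
  fsym : Type;
  fdom : fsym -> arity lsort;
  fcod : fsym -> lsort;
  rsym : Type;
  rdom : rsym -> arity lsort }.

Inductive term (L : lang) (c : ctx (lsort L)) : lsort L -> Type :=
| Var (i : idx c) : term c (c i)
| App (f : fsym L) (t : forall i : 'I_(alen (fdom f)), term c (asrt (fdom f) i)) :
    term c (fcod f).

Inductive fm (L : lang) (c : ctx (lsort L)) : Type :=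
| Top
| Eqn (s : lsort L) (t1 t2 : term c s)
| Rel (r : rsym L) (t : forall i : 'I_(alen (rdom r)), term c (asrt (rdom r) i))
| And (f g : fm c)
| Not (f : fm c)
| Ex (s : lsort L) (f : fm (cext c s)).

Record structure (L : lang) := Structure {
  car :> lsort L -> Type;
  fint : forall f : fsym L, tup car (fdom f) -> car (fcod f);
  rint : forall r : rsym L, tup car (rdom r) -> Prop }.

Fixpoint eval L (N : structure L) (c : ctx (lsort L)) (v : tup N c) (s : lsort L)
    (t : term c s) : N s :=
  match t with
  | Var i => v i
  | App f ts => @fint L N f (fun i => eval v (ts i))
  end.

Fixpoint sat L (N : structure L) (c : ctx (lsort L)) (f : fm c) : tup N c -> Prop :=
  match f with
  | Top => fun _ => True
  | Eqn s t1 t2 => fun v => eval v t1 = eval v t2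
  | Rel r ts => fun v => @rint L N r (fun i => eval v (ts i))
  | And g h => fun v => sat g v /\ sat h v
  | Not g => fun v => ~ sat g v
  | Ex s g => fun v => exists e : N s, sat g (text v e)
  end.

Fixpoint is_pp L (c : ctx (lsort L)) (f : fm c) : bool :=
  match f with
  | Not _ => false
  | And g h => is_pp g && is_pp h
  | Ex _ g => is_pp g
  | _ => true
  end.

Definition is_hom L (N N' : structure L) (h : forall s, N s -> N' s) : Prop :=
  (forall (f : fsym L) (x : tup N (fdom f)),
      h _ (fint x) = @fint L N' f (fun i => h _ (x i))) /\
  (forall (r : rsym L) (x : tup N (rdom r)),
      rint x -> @rint L N' r (fun i => h _ (x i))).

Definition is_embedding L (N N' : structure L) (h : forall s, N s -> N' s) : Prop :=
  [/\ is_hom h, forall s, injective (h s) &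
      forall (r : rsym L) (x : tup N (rdom r)),
        @rint L N' r (fun i => h _ (x i)) -> rint x].

Definition is_automorphism L (N : structure L) (h : forall s, N s -> N s) : Prop :=
  is_embedding h /\ forall s (y : N s), exists x, h s x = y.

Definition elt L (N : structure L) : Type := {s : lsort L & N s}.

Definition cpar L (N : structure L) (D : set (elt N)) : ctx (lsort L) :=
  Ctx (fun e : set_type D => projT1 (val e)).

Definition tpar L (N : structure L) (D : set (elt N)) : tup N (cpar D) :=
  fun e => projT2 (val e).

Definition formula_over L (N : structure L) (D : set (elt N)) (x : ctx (lsort L)) : Type :=
  fm (cadd x (cpar D)).

Definition holds L (N : structure L) (D : set (elt N)) (x : ctx (lsort L))
    (f : formula_over D x) (v : tup N x) : Prop :=
  sat f (tadd v (@tpar L N D)).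

Definition finitely_satisfiable L (N : structure L) (D : set (elt N))
    (x : ctx (lsort L)) (p : set (formula_over D x)) : Prop :=
  forall n (f : 'I_n -> formula_over D x), (forall i, p (f i)) ->
    exists v, forall i, holds (f i) v.

(* [|K|^+]-saturation: a parameter set has size [< |K|^+] iff it has size [<= |K|]. *)
Definition saturated_succ L (N : structure L) (T : Type) (K : set T) : Prop :=
  forall D : set (elt N), D #<= K ->
  forall (x : arity (lsort L)) (p : set (formula_over D x)),
    finitely_satisfiable p -> exists v : tup N x, forall f, p f -> holds f v.

(* Strong [|K|^+]-homogeneity: elementary maps between subsets of size [<= |K|]
   are given by two enumerations, with the same type, of these subsets. *)
Definition strongly_homogeneous_succ L (N : structure L) (T : Type) (K : set T) : Prop :=
  forall c : ctx (lsort L), [set: idx c] #<= K ->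
  forall x y : tup N c, (forall f : fm c, sat f x <-> sat f y) ->
    exists2 h : forall s, N s -> N s,
      is_automorphism h & forall i, h _ (x i) = y i.

Definition dcl L (N : structure L) (D : set (elt N)) : set (elt N) :=
  [set e | exists f : formula_over D (one (projT1 e)),
     forall y : N (projT1 e), holds f (fun _ => y) <-> y = projT2 e].

Definition acl L (N : structure L) (D : set (elt N)) : set (elt N) :=
  [set e | exists f : formula_over D (one (projT1 e)),
     finite_set [set y : N (projT1 e) | holds f (fun _ => y)] /\
     holds f (fun _ => projT2 e)].

Definition tp L (N : structure L) (D : set (elt N)) (x : ctx (lsort L)) (v : tup N x) :
    set (formula_over D x) :=
  [set f | holds f v].
Arguments tp {L N} D {x} v.

Definition complete_type L (N : structure L) (D : set (elt N)) (x : ctx (lsort L))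
    (p : set (formula_over D x)) : Prop :=
  finitely_satisfiable p /\ forall f, p f \/ p (Not f).

(* [Q] stands for a condition definable with parameters; by compactness, [p]
   implies it when finitely many formulas of [p] do. *)
Definition implies L (N : structure L) (D : set (elt N)) (x : ctx (lsort L))
    (p : set (formula_over D x)) (Q : tup N x -> Prop) : Prop :=
  exists n (f : 'I_n -> formula_over D x),
    (forall i, p (f i)) /\ forall v, (forall i, holds (f i) v) -> Q v.

Record pformula L (N : structure L) (x : ctx (lsort L)) := PFormula {
  pf_ar : arity (lsort L);
  pf_fm : fm (cadd x pf_ar);
  pf_par : tup N pf_ar }.
Arguments pf_par {L N x} p i.

Definition psat L (N : structure L) (x : ctx (lsort L)) (f : pformula N x)
    (v : tup N x) : Prop :=
  sat (pf_fm f) (tadd v (pf_par f)).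

Definition cpow S (n : nat) (c : ctx S) : ctx S := Ctx (fun i : 'I_n * idx c => c i.2).

Definition indiscernible L (N : structure L) (G : set (elt N)) (y : ctx (lsort L))
    (b : nat -> tup N y) : Prop :=
  forall (n : nat) (k l : 'I_n -> nat),
    {homo k : i j / (i < j)%N} -> {homo l : i j / (i < j)%N} ->
  forall f : formula_over G (cpow n y),
    @holds L N G (cpow n y) f (fun i => b (k i.1) i.2) <->
    @holds L N G (cpow n y) f (fun i => b (l i.1) i.2).

(* Joint inconsistency is a failure of finite satisfiability. *)
Definition divides L (N : structure L) (G : set (elt N)) (x : ctx (lsort L))
    (f : pformula N x) : Prop :=
  exists b : nat -> tup N (pf_ar f),
    [/\ b 0%N = pf_par f,
        forall k, tp G (b k) = tp G (pf_par f),
        indiscernible G b &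
        exists n : nat, ~ exists v : tup N x,
          forall k, (k < n)%N -> sat (pf_fm f) (tadd v (b k))].

Definition formula_forks L (N : structure L) (G : set (elt N)) (x : ctx (lsort L))
    (f : pformula N x) : Prop :=
  exists n (g : 'I_n -> pformula N x),
    (forall i, divides G (g i)) /\ forall v, psat f v -> exists i, psat (g i) v.

Definition type_forks L (N : structure L) (G D : set (elt N)) (x : ctx (lsort L))
    (p : set (formula_over D x)) : Prop :=
  exists f : pformula N x, implies p (psat f) /\ formula_forks G f.

Record lext (L : lang) := LExt {
  xsort : Type;
  xfsym : Type;
  xfdom : xfsym -> arity (lsort L + xsort);
  xfcod : xfsym -> lsort L + xsort;
  xrsym : Type;
  xrdom : xrsym -> arity (lsort L + xsort) }.

Definition expand (L : lang) (X : lext L) : lang := {|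
  lsort := lsort L + xsort X;
  fsym := fsym L + xfsym X;
  fdom := fun f => match f with
    | inl g => amap inl (fdom g)
    | inr g => xfdom g
    end;
  fcod := fun f => match f with inl g => inl (fcod g) | inr g => xfcod g end;
  rsym := rsym L + xrsym X;
  rdom := fun r => match r with
    | inl q => amap inl (rdom q)
    | inr q => xrdom q
    end |}.

Definition xcar S S' (N : S -> Type) (P : S' -> Type) (s : S + S') : Type :=
  match s with inl s => N s | inr s => P s end.

Record expansion (L : lang) (N : structure L) (X : lext L) := Expansion {
  ecar : xsort X -> Type;
  efint : forall f : xfsym X, tup (xcar N ecar) (xfdom f) -> xcar N ecar (xfcod f);
  erint : forall r : xrsym X, tup (xcar N ecar) (xrdom r) -> Prop }.

Definition expand_structure L (N : structure L) (X : lext L) (E : expansion N X) :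
    structure (expand X) := {|
  car := xcar N (@ecar L N X E) : lsort (expand X) -> Type;
  fint := fun f : fsym (expand X) => match f with
    | inl g => fun x => @fint L N g x
    | inr g => fun x => @efint L N X E g x
    end;
  rint := fun r : rsym (expand X) => match r with
    | inl q => fun x => @rint L N q x
    | inr q => fun x => @erint L N X E q x
    end |}.

Definition quotient (T : Type) (E : T -> T -> Prop) : Type :=
  {X : T -> Prop | exists a, X = E a}.

Definition cls (T : Type) (E : T -> T -> Prop) (a : T) : quotient E :=
  exist _ (E a) (ex_intro _ a erefl).

Definition is_equivalence (T : Type) (E : T -> T -> Prop) : Prop :=
  [/\ forall x, E x x, forall x y, E x y -> E y x &
      forall x y z, E x y -> E y z -> E x z].

(* [M^eq] has one sort for each parameter-free definable equivalence relation on
   a finite product of sorts, taken as a relation rather than as a formula. *)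
Record eqsort L (N : structure L) := EqSort {
  eq_ar : arity (lsort L);
  eq_rel : tup N eq_ar -> tup N eq_ar -> Prop;
  eq_equiv : is_equivalence eq_rel;
  eq_def : exists f : fm (cadd eq_ar eq_ar),
    forall x y, sat f (tadd x y) <-> eq_rel x y }.

Definition eq_lext L (N : structure L) : lext L := {|
  xsort := eqsort N;
  xfsym := eqsort N;
  xfdom := fun e => amap inl (eq_ar e);
  xfcod := fun e => inr e;
  xrsym := Empty_set;
  xrdom := fun r => match r with end |}.

Definition eq_expansion L (N : structure L) : expansion N (eq_lext N) :=
  @Expansion L N (eq_lext N)
    (fun e => quotient (@eq_rel L N e))
    (fun e x => cls (@eq_rel L N e) x)
    (fun r => match r with end).

Definition meq L (N : structure L) : structure (expand (eq_lext N)) :=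
  expand_structure (eq_expansion N).

Inductive gsym (S : Type) := Gzero of S | Gopp of S | Gadd of S.

(* The language [L] together with symbols [0], [-], [+] on each sort.  A language
   in which every sort carries group operations has this form, [L] consisting of
   the remaining symbols. *)
Definition group_lang (L : lang) : lang := {|
  lsort := lsort L;
  fsym := gsym (lsort L) + fsym L;
  fdom := fun f => match f with
    | inl (Gzero s) => Arity (fun _ : 'I_0 => s)
    | inl (Gopp s) => Arity (fun _ : 'I_1 => s)
    | inl (Gadd s) => Arity (fun _ : 'I_2 => s)
    | inr g => fdom g
    end;
  fcod := fun f => match f with
    | inl (Gzero s) | inl (Gopp s) | inl (Gadd s) => s
    | inr g => fcod g
    end;
  rsym := rsym L;
  rdom := @rdom L |}.

Definition group_structure (L : lang) (G : lsort L -> zmodType)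
    (fi : forall f : fsym L, tup G (fdom f) -> G (fcod f))
    (ri : forall r : rsym L, tup G (rdom r) -> Prop) : structure (group_lang L) := {|
  car := (fun s : lsort L => G s : Type) : lsort (group_lang L) -> Type;
  fint := fun f : fsym (group_lang L) => match f with
    | inl (Gzero s) => fun _ => 0
    | inl (Gopp s) => fun x => - x ord0
    | inl (Gadd s) => fun x => x ord0 + x ord_max
    | inr g => fun x => fi g x
    end;
  rint := ri : forall r : rsym (group_lang L), _ |}.

Section TupleOperations.
Variables (S : Type) (G : S -> zmodType) (c : ctx S).
Implicit Types x y : tup G c.
Definition t0 : tup G c := fun i => 0.
Definition tplus x y : tup G c := fun i => x i + y i.
Definition tminus x y : tup G c := fun i => x i - y i.
End TupleOperations.
Arguments t0 {S G c}.

Record abelian (L : lang) := Abelian {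
  grp : lsort L -> zmodType;
  ab_fint : forall f : fsym L, tup grp (fdom f) -> grp (fcod f);
  ab_rint : forall r : rsym L, tup grp (rdom r) -> Prop;
  ab_str := group_structure ab_fint ab_rint;
  ab_term : forall (x : arity (lsort L)) s (t : @term (group_lang L) x s) (a b : tup grp x),
    @eval _ ab_str x (tplus a b) s t = @eval _ ab_str x a s t + @eval _ ab_str x b s t :> grp s;
  ab_pp0 : forall (x : arity (lsort L)) (f : @fm (group_lang L) x),
    is_pp f -> @sat _ ab_str x f t0;
  ab_ppB : forall (x : arity (lsort L)) (f : @fm (group_lang L) x) (a b : tup grp x),
    is_pp f -> @sat _ ab_str x f a -> @sat _ ab_str x f b ->
    @sat _ ab_str x f (tminus a b) }.

Definition astr L (A : abelian L) : structure (group_lang L) :=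
  group_structure (@ab_fint L A) (@ab_rint L A).

Record ppformula (L : lang) := PP {
  pp_ar : arity (lsort L);
  pp_fm : @fm (group_lang L) pp_ar;
  pp_pp : is_pp pp_fm }.

Definition ppsat L (A : abelian L) (f : ppformula L) (x : tup (grp A) (pp_ar f)) : Prop :=
  @sat _ (astr A) (pp_ar f) (pp_fm f) x.

Definition pp_terms L (f : ppformula L) (b : arity (lsort L)) : Type :=
  forall k : 'I_(alen (pp_ar f)), @term (group_lang L) b (asrt (pp_ar f) k).

Definition evals L (A : abelian L) (f : ppformula L) (b : arity (lsort L))
    (t : pp_terms f b) (x : tup (grp A) b) : tup (grp A) (pp_ar f) :=
  fun k => @eval _ (astr A) b x _ (t k).

Definition fundamental_system L (B : abelian L) (Phi : set (ppformula L)) : Prop :=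
  forall g : ppformula L,
  exists n (f : 'I_n -> ppformula L) (t : forall i, pp_terms (f i) (pp_ar g)),
    (forall i, Phi (f i)) /\
    forall x : tup (grp B) (pp_ar g), ppsat x <-> forall i, ppsat (evals (t i) x).

Definition tmap S (G H : S -> Type) (h : forall s, G s -> H s) (c : ctx S)
    (x : tup G c) : tup H c :=
  fun i => h _ (x i).

Definition coset_rel L (A : abelian L) (f : ppformula L) (x y : tup (grp A) (pp_ar f)) : Prop :=
  ppsat (tminus x y).
Arguments coset_rel {L} A f x y.

Record pure_ses (L : lang) := PureSES {
  sA : abelian L;
  sB : abelian L;
  sC : abelian L;
  iota : forall s : lsort L, grp sA s -> grp sB s;
  nu : forall s : lsort L, grp sB s -> grp sC s;
  iota_embedding : @is_embedding _ (astr sA) (astr sB) iota;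
  iota_pure : forall (f : ppformula L) (a : tup (grp sA) (pp_ar f)),
    ppsat (tmap iota a) <-> ppsat a;
  nu_hom : @is_hom _ (astr sB) (astr sC) nu;
  nu_surj : forall s (z : grp sC s), exists y, nu y = z;
  exact_at_B : forall s (y : grp sB s), nu y = 0 <-> exists x, iota x = y;
  nu_pp : forall (f : ppformula L) (b : tup (grp sB) (pp_ar f)),
    ppsat (tmap nu b) <->
    exists2 b' : tup (grp sB) (pp_ar f), ppsat b' &
      exists a : tup (grp sA) (pp_ar f), b = tplus b' (tmap iota a) }.

(* The expansion of [A] by the sorts [A/phi(A)], encoded as sets of cosets, and the
   maps [pi_phi], for [phi] in [Phi]. *)
Section QuotientSorts.
Variables (L : lang) (Phi : set (ppformula L)).

Definition quo_lext : lext (group_lang L) :=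
  @LExt (group_lang L) (set_type Phi) (set_type Phi)
    (fun f => amap inl (pp_ar (val f))) (fun f => inr f)
    Empty_set (fun r => match r with end).

Definition quo_expansion (A : abelian L) : expansion (astr A) quo_lext :=
  @Expansion _ (astr A) quo_lext
    (fun f => quotient (coset_rel A (val f)))
    (fun f x => cls (coset_rel A (val f)) x)
    (fun r => match r with end).

Definition quo_lang : lang := expand quo_lext.
Definition quo_structure (A : abelian L) : structure quo_lang :=
  expand_structure (quo_expansion A).

End QuotientSorts.

(* On [phi(B) + iota(A)], [rho_phi] sends [b] to the class of any [a] such that
   [b - iota(a)] is in [phi(B)]; the class is unique by purity. *)
Definition rho L (E : pure_ses L) (f : ppformula L) (b : tup (grp (sB E)) (pp_ar f)) :
    quotient (coset_rel (sA E) f) :=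
  match pselect (exists a, ppsat (tminus b (tmap (@iota L E) a))) with
  | left h => cls _ (projT1 (cid h))
  | right _ => cls _ t0
  end.

(* [A^*] and [C^*] may have new sorts as well as new symbols. *)
Record expanded_ses (L : lang) (Phi : set (ppformula L)) := ExpandedSES {
  ses :> pure_ses L;
  extA : lext (quo_lang Phi);
  starA : expansion (quo_structure Phi (sA ses)) extA;
  extC : lext (group_lang L);
  starC : expansion (astr (sC ses)) extC }.

Section ExpandedSequence.
Variables (L : lang) (Phi : set (ppformula L)) (E : expanded_ses Phi).

Definition langA : lang := expand (extA E).
Definition langB : lang := group_lang L.
Definition langC : lang := expand (extC E).
Definition strA : structure langA := expand_structure (starA E).
Definition strB : structure langB := astr (sB E).
Definition strC : structure langC := expand_structure (starC E).

Definition homeA (s : lsort L) : lsort langA := inl (inl s).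
Definition quoA (f : set_type Phi) : lsort langA := inl (inr f).
Definition homeC (s : lsort L) : lsort langC := inl s.

Inductive sortM := SA of lsort langA | SB of lsort langB | SC of lsort langC.

Inductive fsymM :=
| FA of fsym langA
| FB of fsym langB
| FC of fsym langC
| Fiota of lsort L
| Fnu of lsort L
| Frho of set_type Phi.

Inductive rsymM := RA of rsym langA | RB of rsym langB | RC of rsym langC.

Definition langM : lang := {|
  lsort := sortM;
  fsym := fsymM;
  fdom := fun f => match f with
    | FA g => amap SA (fdom g)
    | FB g => amap SB (fdom g)
    | FC g => amap SC (fdom g)
    | Fiota s => Arity (fun _ : 'I_1 => SA (homeA s))
    | Fnu s => Arity (fun _ : 'I_1 => SB s)
    | Frho g => amap SB (pp_ar (val g))
    end;
  fcod := fun f => match f with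
    | FA g => SA (fcod g)
    | FB g => SB (fcod g)
    | FC g => SC (fcod g)
    | Fiota s => SB s
    | Fnu s => SC (homeC s)
    | Frho g => SA (quoA g)
    end;
  rsym := rsymM;
  rdom := fun r => match r with
    | RA q => amap SA (rdom q)
    | RB q => amap SB (rdom q)
    | RC q => amap SC (rdom q)
    end |}.

Definition carM (s : sortM) : Type :=
  match s with SA s => strA s | SB s => strB s | SC s => strC s end.

Definition strM : structure langM := {|
  car := carM : lsort langM -> Type;
  fint := fun f : fsym langM => match f with
    | FA g => fun x => @fint _ strA g x
    | FB g => fun x => @fint _ strB g x
    | FC g => fun x => @fint _ strC g x
    | Fiota s => fun x => @iota L E s (x ord0)
    | Fnu s => fun x => @nu L E s (x ord0)
    | Frho g => fun x => rho (E := E) (f := val g) x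
    end;
  rint := fun r : rsym langM => match r with
    | RA q => fun x => @rint _ strA q x
    | RB q => fun x => @rint _ strB q x
    | RC q => fun x => @rint _ strC q x
    end |}.

(* The following three lemmas produce the formula of [langM] which defines
   congruence modulo [phi(C)], needed to see [C/phi(C)] as a sort of [M^eq]. *)
Lemma weaken_term (K : lang) (N : structure K) (d : ctx (lsort K)) s0 s (t : term d s) :
  exists t' : term (cext d s0) s,
    forall (v : tup N d) (e : N s0), eval (text v e) t' = eval v t.
Proof.
elim: t => [i|f ts IH]; first by exists (@Var K (cext d s0) (Some i)).
pose ts' i := projT1 (cid (IH i)).
exists (App ts') => v e; apply: (f_equal (@fint _ N f)); apply: functional_extensionality_dep => i.
exact: (projT2 (cid (IH i))).
Qed.

Lemma translate_term (c : ctx (lsort L)) (d : ctx (lsort langM))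
    (r : forall i : idx c, term d (SC (homeC (c i)) : lsort langM)) s
    (t : @term (group_lang L) c s) :
  exists t' : term d (SC (homeC s) : lsort langM),
    forall v : tup strM d,
      eval v t' = @eval _ (astr (sC E)) c (fun i => eval v (r i)) s t :> grp (sC E) s.
Proof.
elim: t => [i|f ts IH]; first by exists (r i).
pose ts' i := projT1 (cid (IH i)).
exists (@App langM d (FC (inl f)) ts') => v.
apply: (f_equal (@fint _ (astr (sC E)) f)).
by apply: functional_extensionality_dep => i; exact: (projT2 (cid (IH i))).
Qed.

Lemma translate_formula (c : ctx (lsort L)) (f : @fm (group_lang L) c)
    (d : ctx (lsort langM)) (r : forall i : idx c, term d (SC (homeC (c i)) : lsort langM)) :
  exists f' : @fm langM d,
    forall v : tup strM d,
      sat f' v <-> @sat _ (astr (sC E)) c f (fun i => eval v (r i)).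
Proof.
elim: f d r => {c} [c|c s t1 t2|c q ts|c f IHf g IHg|c f IHf|c s f IHf] d r.
- by exists (Top d).
- have [u1 h1] := translate_term r t1; have [u2 h2] := translate_term r t2.
  by exists (Eqn u1 u2) => v /=; rewrite h1 h2.
- pose ts' i := projT1 (cid (translate_term r (ts i))).
  exists (@Rel langM d (RC (inl q)) ts') => v /=.
  suff -> : (fun i => eval v (ts' i)) =
    (fun i => @eval _ (astr (sC E)) c (fun j => eval v (r j)) _ (ts i)) by [].
  by apply: functional_extensionality_dep => i; exact: (projT2 (cid (translate_term r (ts i)))).
- have [f' hf] := IHf d r; have [g' hg] := IHg d r.
  by exists (And f' g') => v /=; rewrite hf hg.
- have [f' hf] := IHf d r.
  by exists (Not f') => v /=; rewrite hf.
- pose d' := cext d (SC (homeC s) : lsort langM).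
  pose w i := cid (weaken_term strM (SC (homeC s) : lsort langM) (r i)).
  pose r' (i : option (idx c)) : term d' (SC (homeC (cext c s i)) : lsort langM) :=
    match i with
    | Some j => projT1 (w j)
    | None => @Var langM d' None
    end.
  have [f' hf] := IHf d' r'.
  exists (Ex f') => v /=.
  have key (e : strM (SC (homeC s) : lsort langM)) :
      (fun i => @eval _ strM d' (text v e) _ (r' i)) =
      @text _ (astr (sC E)) c s (fun i => eval v (r i)) e.
    apply: functional_extensionality_dep => -[j|//].
    exact: (projT2 (w j) v e).
  have hf' (e : strM (SC (homeC s) : lsort langM)) : sat f' (text v e) <->
      @sat _ (astr (sC E)) _ f (@text _ (astr (sC E)) c s (fun i => eval v (r i)) e).
    by rewrite -key; exact: hf.
  by split=> -[e he]; exists e; apply/(hf' e).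
Qed.

Definition homeM_C (s : lsort L) : lsort langM := SC (homeC s).

Lemma coset_rel_equiv (A : abelian L) f : is_equivalence (coset_rel A f).
Proof.
have h0 := ab_pp0 A (pp_pp f); have hB := @ab_ppB L A _ _ _ _ (pp_pp f).
have ext (x y : tup (grp A) (pp_ar f)) : (forall i, x i = y i) -> x = y.
  exact: functional_extensionality_dep.
rewrite /coset_rel /ppsat; split=> [x|x y hxy|x y z hxy hyz].
- by rewrite (_ : tminus x x = t0) //; apply: ext => i; rewrite /tminus subrr.
- have := hB _ _ h0 hxy; rewrite (_ : tminus _ _ = tminus y x) //.
  by apply: ext => i; rewrite /tminus /t0 sub0r opprB.
have := hB _ _ hxy (hB _ _ h0 hyz); rewrite (_ : tminus _ _ = tminus x z) //.
by apply: ext => i; rewrite /tminus /t0 sub0r opprK addrA subrK.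
Qed.

Lemma coset_rel_def f :
  exists g : fm (cadd (amap homeM_C (pp_ar f)) (amap homeM_C (pp_ar f))),
    forall x y : tup strM (amap homeM_C (pp_ar f)),
      sat g (tadd x y) <-> coset_rel (sC E) f x y.
Proof.
pose d := cadd (amap homeM_C (pp_ar f)) (amap homeM_C (pp_ar f)).
have sub i : exists t : term d (SC (homeC (actx (pp_ar f) i)) : lsort langM),
    forall x y : tup strM (amap homeM_C (pp_ar f)),
      eval (tadd x y) t = (x i : grp (sC E) _) - (y i : grp (sC E) _) :> grp (sC E) _.
  pose s := actx (pp_ar f) i.
  pose o : fsym langM := FC (inl (inl (Gopp s))).
  pose p : fsym langM := FC (inl (inl (Gadd s))).
  pose n : term d (SC (homeC s) : lsort langM) :=
    @App langM d o (fun _ => @Var langM d (inr i)).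
  pose q (k : 'I_2) : term d (SC (homeC s) : lsort langM) :=
    if k == ord0 then @Var langM d (inl i) else n.
  by exists (@App langM d p q) => x y.
have [g hg] := translate_formula (pp_fm f) (fun i => projT1 (cid (sub i))).
exists g => x y; rewrite hg /coset_rel /ppsat.
suff -> : (fun i => @eval _ strM d (tadd x y) _ (projT1 (cid (sub i)))) =
  tminus (G := grp (sC E)) (c := pp_ar f) x y by [].
by apply: functional_extensionality_dep => i; exact: (projT2 (cid (sub i)) x y).
Qed.

Definition coset_sort (f : ppformula L) : eqsort strM :=
  @EqSort _ strM (amap homeM_C (pp_ar f)) (coset_rel (sC E) f)
    (coset_rel_equiv (sC E) f) (coset_rel_def f).

Definition Meq : structure (expand (eq_lext strM)) := meq strM.

Definition eltA (s : lsort langA) (x : strA s) : elt Meq := existT Meq (inl (SA s)) x.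
Definition eltB (s : lsort langB) (x : strB s) : elt Meq := existT Meq (inl (SB s)) x.
Definition eltC (s : lsort langC) (x : strC s) : elt Meq := existT Meq (inl (SC s)) x.
Definition elt_coset (f : ppformula L) (X : quotient (coset_rel (sC E) f)) : elt Meq :=
  existT Meq (inr (coset_sort f)) X.

Definition partA (D : set (elt Meq)) : set (elt Meq) :=
  D `&` [set e | exists s (x : strA s), e = eltA x].
Definition partB (D : set (elt Meq)) : set (elt Meq) :=
  D `&` [set e | exists s (x : strB s), e = eltB x].
Definition partC (D : set (elt Meq)) : set (elt Meq) :=
  D `&` [set e | exists s (x : strC s), e = eltC x].

End ExpandedSequence.

Section Types.
Variables (L : lang) (Phi : set (ppformula L)) (E : expanded_ses Phi).
Variables (a : arity (lsort (langA E))) (b : arity (lsort (langB L)))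
  (c : arity (lsort (langC E))).

(* Variables are sorted by blocks [x_A], [x_B], [x_C]. *)
Definition varM : ctx (lsort (langM E)) :=
  cadd (cadd (amap (@SA L Phi E) a) (amap (@SB L Phi E) b)) (amap (@SC L Phi E) c).

Definition varMeq : ctx (lsort (expand (eq_lext (strM E)))) := cmap inl varM.

Section Parts.
Variable v : tup (strM E) varM.
Definition tupA : tup (strA E) a := fun i => v (inl (inl i)).
Definition tupB : tup (grp (sB E)) b := fun i => v (inl (inr i)).
Definition tupC : tup (strC E) c := fun i => v (inr i).
Definition nu_tupB : tup (strC E) (amap (@homeC L Phi E) b) := tmap (@nu L E) tupB.
End Parts.

Definition tpM (D : set (elt (Meq E))) (v : tup (strM E) varM) :
    set (formula_over D varMeq) :=
  @tp _ (Meq E) D varMeq v.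
Arguments tpM : clear implicits.

Definition quo_ar n (f : 'I_n -> set_type Phi) : arity (lsort (langA E)) :=
  Arity (fun i => quoA E (f i)).

(* The constituents of psi_A(alpha, x_A, (rho_phi_i(t_i(x_B) - beta_i))_i); its
   interpretation is [holdsA]. *)
Record Aformula (D : set (elt (Meq E))) := AFormula {
  af_ar : arity (lsort (langA E));
  af_par : tup (strA E) af_ar;
  af_parP : forall i, D (eltA (af_par i));
  af_n : nat;
  af_phi : 'I_af_n -> set_type Phi;
  af_t : forall i, pp_terms (val (af_phi i)) b;
  af_beta : forall i, tup (grp (sB E)) (pp_ar (val (af_phi i)));
  af_betaP : forall i k, D (@eltB _ _ E _ (@af_beta i k));
  af_fm : fm (cadd (cadd af_ar a) (quo_ar af_phi)) }.
Arguments af_par {D} _ _.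
Arguments af_phi {D} _ _.
Arguments af_t {D} _ _ _.
Arguments af_beta {D} _ _ _.

Definition rho_args D (f : Aformula D) (v : tup (strM E) varM) :
    tup (strA E) (quo_ar (af_phi f)) :=
  fun i : 'I_(af_n f) =>
    rho (E := E) (tminus (evals (af_t f i) (tupB v)) (af_beta f i)).
Arguments rho_args {D} _ _ _.

Definition holdsA D (f : Aformula D) (v : tup (strM E) varM) : Prop :=
  sat (N := strA E) (af_fm f)
    (tadd (tadd (af_par f) (tupA v)) (rho_args f v)).

(* The constituents of psi_C(nu(x_B), x_C, gamma); its interpretation is [holdsC]. *)
Record Cformula (D : set (elt (Meq E))) := CFormula {
  cf_ar : arity (lsort (langC E));
  cf_par : tup (strC E) cf_ar;
  cf_parP : forall i, D (eltC (cf_par i));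
  cf_fm : fm (cadd (cadd (amap (@homeC L Phi E) b) c) cf_ar) }.
Arguments cf_par {D} _ _.

Definition holdsC D (f : Cformula D) (v : tup (strM E) varM) : Prop :=
  sat (N := strC E) (cf_fm f)
    (tadd (tadd (nu_tupB v) (tupC v)) (cf_par f)).

Definition tpA (D : set (elt (Meq E))) (v : tup (strM E) varM) : set (Aformula D) :=
  [set f | holdsA f v].

Definition tpC (D : set (elt (Meq E))) (v : tup (strM E) varM) : set (Cformula D) :=
  [set f | holdsC f v].
Arguments tpA : clear implicits.
Arguments tpC : clear implicits.

Section Spaces.
Variables (G D : set (elt (Meq E))) (u : tup (strM E) varM).

Definition coset_of_terms (f : ppformula L) (t : pp_terms f b) (v : tup (strM E) varM) :
    quotient (coset_rel (sC E) f) :=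
  cls _ (tmap (@nu L E) (evals t (tupB v))).

Definition E0plus (f : set_type Phi) (t : pp_terms (val f) b) : Prop :=
  G (elt_coset (coset_of_terms t u)).

(* Each condition is equivalent to a formula over [G], with a coset as parameter. *)
Definition p0 : set (tup (strM E) varM -> Prop) :=
  [set P | exists (f : set_type Phi) (t : pp_terms (val f) b),
     E0plus t /\
     P = fun v => ppsat (tmap (@nu L E) (evals t (tminus (tupB v) (tupB u))))] `|`
  [set P | exists (f : set_type Phi) (t : pp_terms (val f) b)
     (X : quotient (coset_rel (sC E) (val f))),
     [/\ ~ E0plus t, G (elt_coset X) & P = fun v => coset_of_terms t v <> X]].

Definition realizes_p0 (v : tup (strM E) varM) : Prop := forall P, p0 P -> P v.

Definition extends_p0 (p : set (formula_over D varMeq)) : Prop :=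
  forall P, p0 P -> implies p P.

Definition nonforking_realization (v : tup (strM E) varM) : Prop :=
  realizes_p0 v /\ ~ type_forks G (tpM D v).

Definition Sf : Type :=
  {p : set (formula_over D varMeq) |
    [/\ complete_type p, extends_p0 p & ~ type_forks G p]}.

Definition Af : Type :=
  {q : set (Aformula D) | exists2 v, nonforking_realization v & q = tpA D v}.

Definition Cf : Type :=
  {q : set (Cformula D) | exists2 v, nonforking_realization v & q = tpC D v}.

Definition basicSf : set (set Sf) :=
  [set U | exists f : formula_over D varMeq, U = [set p | sval p f]].
Definition basicAf : set (set Af) :=
  [set U | exists f : Aformula D, U = [set q | sval q f]].
Definition basicCf : set (set Cf) :=
  [set U | exists f : Cformula D, U = [set q | sval q f]].

HB.instance Definition _ := gen_eqMixin Sf.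
HB.instance Definition _ := gen_choiceMixin Sf.
HB.instance Definition _ := isSubBaseTopological.Build Sf basicSf id.

HB.instance Definition _ := gen_eqMixin Af.
HB.instance Definition _ := gen_choiceMixin Af.
HB.instance Definition _ := isSubBaseTopological.Build Af basicAf id.

HB.instance Definition _ := gen_eqMixin Cf.
HB.instance Definition _ := gen_choiceMixin Cf.
HB.instance Definition _ := isSubBaseTopological.Build Cf basicCf id.

End Spaces.
End Types.
Arguments tpM {L Phi E a b c} D v _.
Arguments tpA {L Phi E a b c} D v _.
Arguments tpC {L Phi E a b c} D v _.
Arguments Sf {L Phi E a b c} G D u.
Arguments Af {L Phi E a b c} G D u.
Arguments Cf {L Phi E a b c} G D u.

Definition homeomorphism (X Y : topologicalType) (f : X -> Y) : Prop :=
  continuous f /\ exists g : Y -> X, [/\ continuous g, cancel f g & cancel g f].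

(* Main.v *)
(* Quantifier elimination for the sequence shows that tp(v/Delta) is determined by
   tp_A(v/Delta) and tp_C(v/Delta), so only surjectivity is at stake.  A coset
   outside Gamma is not algebraic over Gamma by (H1); it therefore has infinitely
   many conjugates, and the formula saying that nu(t(x_B)) lies in it divides over
   Gamma.  Hence a nonforking realization v of p_0 satisfies nu(t(v_B) - beta) in
   phi(C), with beta in B(Delta), only for (phi, t) in E_0^+.  Given two such
   realizations v and v', purity and saturation yield w with w_A = v_A,
   nu(w_B) = nu(v'_B), w_C = v'_C and t(w_B - v_B) in phi(B) for (phi, t) in E_0^+.
   For these pairs rho_phi(t(w_B) - beta) = rho_phi(t(v_B) - beta), and for the
   others both sides are 0, so w has the A-type of v and the C-type of v'.  The type
   of w does not fork: a dividing formula true at w splits into an A-part and a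
   C-part, which are consistent along the indiscernible sequence for v and v', and
   the solutions are glued in the same way.  Indiscernible sequences are obtained
   by realizing the types of iterated powers of an ultrafilter. *)

From mathcomp Require Import all_boot ssralg.
From mathcomp Require Import boolp classical_sets functions cardinality filter topology.

Set Implicit Arguments.
Unset Strict Implicit.
Unset Printing Implicit Defensive.

Import GRing.Theory.
Require Import Defs.
Local Open Scope classical_set_scope.
Local Notation fext := functional_extensionality_dep.

(** Two obstacles shape the nonforking step. The parameters of a dividing formula may be imaginary,
    whereas elimination speaks of real tuples; dividing is therefore lifted to representatives, at
    the price of extracting a new indiscernible sequence. Moreover these parameters may lie outside
    [Delta], where the types of v and v' over [Delta] give no direct control. So v and v' are first
    replaced by realizations of the same types over [Delta] that satisfy no formula over [Gamma]
    dividing at those parameters. Gluing the replacements gives a tuple with the type of w over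
    [Delta], which must still satisfy one of the dividing formulas. Along the indiscernible sequence
    a single correction in iota(A) has to serve all terms; it exists because the congruences to be
    restored involve t(x_B) only, not the parameters. In the quantifier elimination, the delicate
    case is an existential quantifier over B. A finite set F guesses for which pairs (phi, t) the
    value under nu lies in phi(C); the quantifier then splits into one over A and one over C, which
    share only F besides the given variables. *)

Lemma dep_choice I (T : I -> Type) (P : forall i, T i -> Prop) :
  (forall i, exists x, P i x) -> exists f, forall i, P i (f i).
Proof. by move=> h; exists (fun i => projT1 (cid (h i))) => i; exact: projT2 (cid (h i)). Qed.

Lemma dep_choice2 I (T : I -> Type) (P Q : forall i, T i -> Prop) :
  (forall i, exists2 x, P i x & Q i x) ->
  exists2 f, forall i, P i (f i) & forall i, Q i (f i).
Proof.
move=> h; have [|f hf] := @dep_choice _ _ (fun i x => P i x /\ Q i x).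
  by move=> i; have [x] := h i; exists x.
by exists f => i; have [] := hf i.
Qed.

(** Indexing by the sort makes a renaming [forall i, var d (c i)] preserve sorts by construction;
    matching on a [var] then replaces rewriting along equalities of sorts. *)
Inductive var S (c : ctx S) : S -> Type := V (i : idx c) : var c (c i).

Definition look S (car : S -> Type) (c : ctx S) (v : tup car c) s (x : var c s) : car s :=
  match x in var _ s return car s with V i => v i end.

Definition tvar (L : lang) (c : ctx (lsort L)) s (x : var c s) : term c s :=
  match x in var _ s return term c s with V i => Var i end.

Lemma eval_tvar (L : lang) (N : structure L) (c : ctx (lsort L)) (v : tup N c) s (x : var c s) :
  eval v (tvar x) = look v x.
Proof. by case: x. Qed.

(** * Substitution, and an induction principle for definable sets *)

Section Substitution.
Variable L : lang.
Implicit Types (c d : ctx (lsort L)).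

Fixpoint tsubst c d (r : forall i : idx c, term d (c i)) s (t : term c s) : term d s :=
  match t with
  | Var i => r i
  | App f ts => App (fun i => tsubst r (ts i))
  end.

Definition tlift c d (r : forall i : idx c, term d (c i)) s0
    (i : idx (cext c s0)) : term (cext d s0) (cext c s0 i) :=
  match i with
  | Some j => tsubst (fun k => @Var L (cext d s0) (Some k)) (r j)
  | None => @Var L (cext d s0) None
  end.

Fixpoint fsubst c (f : fm c) : forall d, (forall i : idx c, term d (c i)) -> fm d :=
  match f with
  | Top => fun d _ => Top d
  | Eqn s t1 t2 => fun d r => Eqn (tsubst r t1) (tsubst r t2)
  | Rel q ts => fun d r => Rel (fun i => tsubst r (ts i))
  | And g h => fun d r => And (fsubst g r) (fsubst h r)
  | Not g => fun d r => Not (fsubst g r)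
  | Ex s g => fun d r => Ex (fsubst g (tlift r (s0 := s)))
  end.

Lemma eval_tsubst (N : structure L) c d (r : forall i : idx c, term d (c i)) s (t : term c s)
    (v : tup N d) :
  eval v (tsubst r t) = eval (fun i => eval v (r i)) t.
Proof.
elim: t => [//|f ts IH] /=; apply: (f_equal (@fint _ N f)); apply: fext => i; exact: IH.
Qed.

Lemma sat_fsubst (N : structure L) c (f : fm c) d (r : forall i : idx c, term d (c i))
    (v : tup N d) :
  sat (fsubst f r) v <-> sat f (fun i => eval v (r i)).
Proof.
elim: f d r v => {c} [c|c s t1 t2|c q ts|c f IHf g IHg|c f IHf|c s f IHf] d r v //=.
- by rewrite !eval_tsubst.
- suff -> : (fun i => eval v (tsubst r (ts i))) =
    (fun i => eval (fun j => eval v (r j)) (ts i)) by [].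
  by apply: fext => i; rewrite eval_tsubst.
- by rewrite IHf IHg.
- by rewrite IHf.
have key e : (fun i => eval (text v e) (tlift r (s0 := s) i)) =
    text (fun i => eval v (r i)) e.
  by apply: fext => -[j|//] /=; rewrite eval_tsubst.
by split=> -[e he]; exists e; move: he; rewrite IHf key.
Qed.

Lemma is_pp_fsubst c (f : fm c) d (r : forall i : idx c, term d (c i)) :
  is_pp (fsubst f r) = is_pp f.
Proof. by elim: f d r => {c} //= c f IHf g IHg d r; rewrite IHf IHg. Qed.

End Substitution.

(* An induction principle for definable sets: a class of predicates with these
   closure properties contains all of them.  Terms are unnested by introducing
   existential quantifiers, so only graphs of single symbols matter. *)
Section Unnesting.
Variables (L : lang) (N : structure L) (K : forall c : ctx (lsort L), (tup N c -> Prop) -> Prop).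
Arguments K : clear implicits.

Record closed_class : Prop := ClosedClass {
  K_ext : forall c P Q, K c P -> (forall v, P v <-> Q v) -> K c Q;
  K_top : forall c, K c (fun _ => True);
  K_and : forall c P Q, K c P -> K c Q -> K c (fun v => P v /\ Q v);
  K_not : forall c P, K c P -> K c (fun v => ~ P v);
  K_ren : forall c d (r : forall i : idx c, var d (c i)) P,
    K c P -> K d (fun v => P (fun i => look v (r i)));
  K_ex : forall c s P, K (cext c s) P -> K c (fun v => exists e, P (text v e)) }.

Record basic_class : Prop := BasicClass {
  K_eq : forall s, K (cadd (one s) (one s)) (fun v => v (inl tt) = v (inr tt));
  K_fun : forall f : fsym L, K (cadd (fdom f) (one (fcod f)))
    (fun v => fint (s := N) (f := f) (fun i => v (inl i)) = v (inr tt));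
  K_rel : forall r : rsym L, K (rdom r) (fun v => rint (s := N) (r := r) v) }.

Hypothesis Kc : closed_class.

Lemma K_or c P Q : K c P -> K c Q -> K c (fun v => P v \/ Q v).
Proof.
move=> hP hQ; apply: (K_ext Kc) (K_not Kc (K_and Kc (K_not Kc hP) (K_not Kc hQ))) _ => v.
split=> [/not_andP[]/contrapT h|[hp [//]|hq [_ //]]]; [by left|by right].
Qed.

Lemma K_imp c P Q : K c P -> K c Q -> K c (fun v => P v -> Q v).
Proof.
move=> hP hQ; apply: (K_ext Kc) (K_or (K_not Kc hP) hQ) _ => v.
split=> [[//|//]|h]; by case: (pselect (P v)) => [/h|]; [right|left].
Qed.

Lemma K_prop c (P : Prop) : K c (fun _ => P).
Proof.
case: (pselect P) => hP; first by apply: (K_ext Kc) (K_top Kc c) _.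
by apply: (K_ext Kc) (K_not Kc (K_top Kc c)) _ => v; split=> // -[].
Qed.

Lemma K_forall c n (P : 'I_n -> tup N c -> Prop) :
  (forall i, K c (P i)) -> K c (fun v => forall i, P i v).
Proof.
elim: n P => [|n IHn] P hP.
  by apply: (K_ext Kc) (K_top Kc c) _ => v; split=> // _ [].
have h := K_and Kc (hP ord0) (IHn (fun i => P (lift ord0 i)) (fun i => hP _)).
apply: (K_ext Kc) h _ => v; split=> [[h0 hS] i|//].
by case: (unliftP ord0 i) => [j ->|->].
Qed.

Lemma K_finforall c (T : finType) (P : T -> tup N c -> Prop) :
  (forall i, K c (P i)) -> K c (fun v => forall i, P i v).
Proof.
move=> hP; apply: (K_ext Kc) (K_forall (fun i : 'I_#|T| => hP (enum_val i))) _ => v.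
by split=> h i //; rewrite -(enum_rankK i).
Qed.

Lemma K_exists_arity n (s : 'I_n -> lsort L) c P : K (cadd c (Arity s)) P ->
  K c (fun v => exists z : tup N (Arity s), P (tadd v z)).
Proof.
elim: n s c P => [|n IHn] s c P hP.
  pose z0 : tup N (Arity s) := fun i : 'I_0 => match notF (ltn_ord i) with end.
  pose r (i : idx (cadd c (Arity s))) : var c (cadd c (Arity s) i) :=
    match i with
    | inl j => V j
    | inr k => match notF (ltn_ord (k : 'I_0)) with end
    end.
  apply: (K_ext Kc) (K_ren Kc r hP) _ => v.
  have -> : (fun i => look v (r i)) = tadd v z0 by apply: fext => -[//|[]].
  split=> [h|[z h]]; first by exists z0.
  by have -> : z0 = z by apply: fext => -[].
pose s' := fun i => s (lift ord0 i).
pose d := cadd (cext c (s ord0)) (Arity s').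
(* [unliftP] changes the sort of the variable along with its index, so the value of the variable is
   recorded together with it. *)
have r0 (k : 'I_n.+1) : {x : var d (s k) |
    forall (v : tup N c) (e : N (s ord0)) (z' : tup N (Arity s')) (z : tup N (Arity s)),
    z ord0 = e -> (forall i, z (lift ord0 i) = z' i) ->
    look (tadd (text v e) z') x = z k}.
  case: (unliftP ord0 k) => [j ->|->].
    exists (V (inr j : idx d)) => v e z' z h0 hS /=; by rewrite hS.
  exists (V (inl None : idx d)) => v e z' z h0 hS /=; by rewrite h0.
pose r (i : idx (cadd c (Arity s))) : var d (cadd c (Arity s) i) :=
  match i with inl j => V (inl (Some j) : idx d) | inr k => projT1 (r0 k) end.
have rE (v : tup N c) e (z' : tup N (Arity s')) (z : tup N (Arity s)) :
    z ord0 = e -> (forall i, z (lift ord0 i) = z' i) ->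
    (fun i => look (tadd (text v e) z') (r i)) = tadd v z.
  move=> h0 hS; apply: fext => -[j//|k] /=.
  exact: (projT2 (r0 k) v e z' z h0 hS).
apply: (K_ext Kc) (K_ex Kc (IHn _ _ _ (K_ren Kc r hP))) _ => v.
split=> [[e [z' h]]|[z h]]; last first.
  exists (z ord0), (fun i => z (lift ord0 i)).
  by rewrite (rE _ _ _ z).
(* Head and tail are reassembled with explicit casts, which vanish because equality proofs between
   ordinals are unique. *)
have hz (k : 'I_n.+1) : {x : N (s k) |
    (forall E : k = ord0, x = ecast i (N (s i)) (esym E) e) /\
    (forall j (E : k = lift ord0 j), x = ecast i (N (s i)) (esym E) (z' j))}.
  case: (unliftP ord0 k) => [j ->|->].
    exists (z' j); split=> [E|j' E]; first by case/eqP: (neq_lift ord0 j).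
    have E' := lift_inj E; subst j'; by rewrite (eq_irrelevance E erefl).
  exists e; split=> [E|j' E]; first by rewrite (eq_irrelevance E erefl).
  by case/eqP: (neq_lift ord0 j').
pose z : tup N (Arity s) := fun k => projT1 (hz k).
exists z; rewrite -(rE v e z' z) //.
  by rewrite /z; case: (hz ord0) => x [/= h1 _]; rewrite (h1 erefl).
by move=> i; rewrite /z; case: (hz _) => x [/= _ h1]; rewrite (h1 i erefl).
Qed.

Hypothesis Kb : basic_class.

Lemma K_term c s (t : term c s) :
  K (cadd c (one s)) (fun v => eval (fun i => v (inl i)) t = v (inr tt)).
Proof.
elim: t => [i|f ts IH].
  pose r (j : idx (cadd (one (c i)) (one (c i)))) :
      var (cadd c (one (c i))) (cadd (one (c i)) (one (c i)) j) :=
    match j with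
    | inl _ => V (inl i : idx (cadd c (one (c i))))
    | inr _ => V (inr tt : idx (cadd c (one (c i))))
    end.
  exact: (K_ren Kc r (K_eq Kb (c i))).
pose c1 := cadd c (one (fcod f)); pose d := cadd c1 (fdom f).
pose r1 i (j : idx (cadd c (one (asrt (fdom f) i)))) :
    var d (cadd c (one (asrt (fdom f) i)) j) :=
  match j with
  | inl j => V (inl (inl j) : idx d)
  | inr _ => V (inr i : idx d)
  end.
have h1 : K d (fun v => forall i : 'I_(alen (fdom f)),
    eval (fun j => v (inl (inl j))) (ts i) = v (inr i)).
  by apply: K_forall => i; apply: (K_ext Kc) (K_ren Kc (r1 i) (IH i)) _.
pose r2 (j : idx (cadd (fdom f) (one (fcod f)))) : var d (cadd (fdom f) (one (fcod f)) j) :=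
  match j with
  | inl j => V (inr j : idx d)
  | inr _ => V (inl (inr tt) : idx d)
  end.
have h2 : K d (fun v => fint (s := N) (f := f) (fun i => v (inr i)) = v (inl (inr tt))).
  exact: (K_ren Kc r2 (K_fun Kb f)).
have := K_exists_arity (s := asrt (fdom f)) (c := c1) (K_and Kc h1 h2).
move=> h; apply: (K_ext Kc) h _ => v /=; split=> [[z [hz <-]]|h].
  by apply: (f_equal (@fint _ N f)); apply: fext => i; exact: hz.
by exists (fun i => eval (fun j => v (inl j)) (ts i)); split.
Qed.

Theorem K_sat c (f : fm c) : K c (sat f).
Proof.
elim: f => {c} [c|c s t1 t2|c q ts|c f IHf g IHg|c f IHf|c s f IHf] /=.
- exact: (K_top Kc).
- pose d := cext c s.
  pose r (j : idx (cadd c (one s))) : var d (cadd c (one s) j) :=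
    match j with inl j => V (Some j : idx d) | inr _ => V (None : idx d) end.
  have := K_ex Kc (K_and Kc (K_ren Kc r (K_term t1)) (K_ren Kc r (K_term t2))).
  move=> h; apply: (K_ext Kc) h _ => v /=; split=> [[e [-> ->//]]|h].
  by exists (eval v t1); split.
- pose d := cadd c (rdom q).
  pose r1 i (j : idx (cadd c (one (asrt (rdom q) i)))) :
      var d (cadd c (one (asrt (rdom q) i)) j) :=
    match j with
    | inl j => V (inl j : idx d)
    | inr _ => V (inr i : idx d)
    end.
  have h1 : K d (fun v => forall i : 'I_(alen (rdom q)),
      eval (fun j => v (inl j)) (ts i) = v (inr i)).
    by apply: K_forall => i; apply: (K_ext Kc) (K_ren Kc (r1 i) (K_term (ts i))) _.
  pose r2 (j : idx (rdom q)) : var d (rdom q j) := V (inr j : idx d).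
  have h2 := K_ren Kc r2 (K_rel Kb q).
  have := K_exists_arity (s := asrt (rdom q)) (c := c) (K_and Kc h1 h2).
  move=> h; apply: (K_ext Kc) h _ => v /=; split=> [[z [hz hq]]|h].
    suff -> : (fun i => eval v (ts i)) = z by [].
    by apply: fext => i; exact: hz.
  by exists (fun i => eval v (ts i)); split.
- exact: (K_and Kc).
- exact: (K_not Kc).
- exact: (K_ex Kc).
Qed.

End Unnesting.

(** * Finite contexts, definable sets, interpretations and finite supports *)

Lemma eval_ext (L : lang) (N : structure L) (c : ctx (lsort L)) (v v' : tup N c) s
    (t : term c s) : (forall i, v i = v' i) -> eval v t = eval v' t.
Proof. by move=> h; rewrite (fext h : v = v'). Qed.

(** Quantifying over a tuple requires finitely many variables, but contexts such as [cpow] or [csig]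
    are not indexed by an ordinal; bijection with a finite type is stable under these
    constructions. *)
Definition finctx S (c : ctx S) : Prop :=
  exists (T : finType) (e : T -> idx c) (e' : idx c -> T), cancel e e' /\ cancel e' e.

Lemma finctx_arity S (a : arity S) : finctx a.
Proof. by exists 'I_(alen a), id, id. Qed.

Lemma finctx_one S (s : S) : finctx (one s).
Proof. by exists unit, id, id. Qed.

Lemma finctx_cadd S (c d : ctx S) : finctx c -> finctx d -> finctx (cadd c d).
Proof.
move=> [T [e [e' [h h']]]] [U [f [f' [k k']]]]; exists (T + U)%type.
exists (fun i => match i with inl j => inl (e j) | inr j => inr (f j) end).
exists (fun i => match i with inl j => inl (e' j) | inr j => inr (f' j) end).
by split; case=> i; rewrite ?h ?k ?h' ?k'.
Qed.

Lemma finctx_cmap S S' (g : S -> S') (c : ctx S) : finctx c -> finctx (cmap g c).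
Proof. by move=> [T [e [e' h]]]; exists T, e, e'. Qed.

Lemma finctx_cpow S n (c : ctx S) : finctx c -> finctx (cpow n c).
Proof.
move=> [T [e [e' [h h']]]].
exists ('I_n * T)%type, (fun p => (p.1, e p.2)), (fun p => (p.1, e' p.2)).
by split; case=> i j /=; rewrite ?h ?h'.
Qed.

Definition csig S (I : Type) (c : I -> ctx S) : ctx S :=
  Ctx (fun p : {i : I & idx (c i)} => c (projT1 p) (projT2 p)).

Lemma finctx_csig S (I : finType) (c : I -> ctx S) :
  (forall i, finctx (c i)) -> finctx (csig c).
Proof.
move=> h; have [U hU] := dep_choice h.
have [f hf] := dep_choice hU; have [g hg] := dep_choice hf.
exists {i : I & U i}, (fun p => existT _ (projT1 p) (f _ (projT2 p))).
exists (fun p => existT _ (projT1 p) (g _ (projT2 p))).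
by split; case=> i x /=; have [E1 E2] := hg i; rewrite ?E1 ?E2.
Qed.

Definition csub S (y : ctx S) (T : Type) (k : T -> idx y) : ctx S := Ctx (fun i => y (k i)).

Lemma look_ecast S (N : S -> Type) (d y : ctx S) (v : tup N d) i i' (E : i = i')
    (x : var d (y i)) :
  look v (ecast k (var d (y k)) E x) = ecast k (N (y k)) E (look v x).
Proof. by case: _ / E. Qed.

Lemma tup_ecast S (N : S -> Type) (y : ctx S) (z : tup N y) i i' (E : i = i') :
  ecast k (N (y k)) E (z i) = z i'.
Proof. by case: _ / E. Qed.

Section FiniteContexts.
Variables (L : lang) (N : structure L) (K : forall c : ctx (lsort L), (tup N c -> Prop) -> Prop).
Hypothesis Kc : closed_class K.

Lemma K_exists_fin c (y : ctx (lsort L)) P : finctx y -> K (c := cadd c y) P ->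
  K (c := c) (fun v => exists z : tup N y, P (tadd v z)).
Proof.
move=> [T [e [e' [_ he]]]] hP.
pose s (k : 'I_#|T|) := y (e (enum_val k)); pose d := cadd c (Arity s).
have E (i : idx y) : e (enum_val (enum_rank (e' i))) = i by rewrite enum_rankK he.
(* Going through the enumeration and back returns the index only up to [E], hence the casts. *)
pose r (i : idx (cadd c y)) : var d (cadd c y i) :=
  match i with
  | inl j => V (inl j : idx d)
  | inr j => ecast i (var d (y i)) (E j) (V (inr (enum_rank (e' j)) : idx d))
  end.
have rE (v : tup N c) (z : tup N (Arity s)) :
    (fun i => look (tadd v z) (r i)) =
    tadd v (fun i => ecast i (N (y i)) (E i) (z (enum_rank (e' i)))).
  by apply: fext => -[//|j] /=; rewrite look_ecast.
apply: (K_ext Kc) (K_exists_arity Kc (s := s) (K_ren Kc r hP)) _ => v.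
split=> [[z h]|[z h]].
  by exists (fun i => ecast i (N (y i)) (E i) (z (enum_rank (e' i)))); rewrite -rE.
exists (fun k => z (e (enum_val k))); rewrite rE.
suff -> : (fun i => ecast i (N (y i)) (E i) (z (e (enum_val (enum_rank (e' i)))))) = z by [].
by apply: fext => i; exact: tup_ecast.
Qed.

End FiniteContexts.

Section Definable.
Variables (L : lang) (N : structure L).
Implicit Types (c d : ctx (lsort L)).

(** Definable sets are handled as predicates, so that closure properties replace the manipulation of
    formulas. *)
Definition definable c (P : tup N c -> Prop) : Prop :=
  exists f : fm c, forall v, sat f v <-> P v.

Lemma definable_closed : closed_class definable.
Proof.
split.
- by move=> c P Q [f h] hPQ; exists f => v; rewrite h.
- by move=> c; exists (Top c).
- by move=> c P Q [f h] [g k]; exists (And f g) => v /=; rewrite h k.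
- by move=> c P [f h]; exists (Not f) => v /=; rewrite h.
- move=> c d r P [f h]; exists (fsubst f (fun i => tvar (r i))) => v.
  rewrite sat_fsubst -h.
  suff -> : (fun i => eval v (tvar (r i))) = (fun i => look v (r i)) by [].
  by apply: fext => i; rewrite eval_tvar.
- move=> c s P [f h]; exists (Ex f) => v /=.
  by split=> -[e he]; exists e; apply/h.
Qed.

Lemma definable_subst c d (r : forall i : idx c, term d (c i)) P :
  definable (c := c) P -> definable (c := d) (fun v => P (fun i => eval v (r i))).
Proof. by move=> [f h]; exists (fsubst f r) => v; rewrite sat_fsubst h. Qed.

Lemma definable_sat c (f : fm c) : definable (sat f).
Proof. by exists f. Qed.

Lemma definable_eqn c s (t1 t2 : term c s) : definable (c := c) (fun v => eval v t1 = eval v t2).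
Proof. by exists (Eqn t1 t2). Qed.

End Definable.

Section Interpretation.
Variables (L1 L2 : lang) (N1 : structure L1) (N2 : structure L2).
Variables (h : lsort L1 -> lsort L2) (j : forall s, N2 (h s) -> N1 s).
Hypotheses (j_inj : forall s, injective (@j s)) (j_surj : forall s y, exists x, @j s x = y).
Hypothesis j_fun : forall f : fsym L1,
  definable (N := N2) (c := cadd (cmap h (fdom f)) (one (h (fcod f))))
    (fun v => fint (s := N1) (f := f) (fun i => j (v (inl i))) = j (v (inr tt))).
Hypothesis j_rel : forall q : rsym L1,
  definable (N := N2) (c := cmap h (rdom q))
    (fun v => rint (s := N1) (r := q) (fun i => j (v i))).

(** Applied with [j] the identity, to move definable sets of A, B and C into M, and those of M into
    M^eq. The class [K] ranges over all substitutions [r], because passing under a quantifier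
    changes the target context. *)
Lemma definable_interp c (P : tup N1 c -> Prop) : definable P ->
  forall d (r : forall i : idx c, term d (h (c i))),
  definable (N := N2) (c := d) (fun v => P (fun i => j (eval v (r i)))).
Proof.
have D2 := definable_closed N2.
move=> [f hf].
pose K (c : ctx (lsort L1)) (P : tup N1 c -> Prop) :=
  forall d (r : forall i : idx c, term d (h (c i))),
  definable (N := N2) (c := d) (fun v => P (fun i => j (eval v (r i)))).
suff : K c (sat f).
  by move=> h0 d r; apply: (K_ext D2) (h0 d r) _ => v; exact: hf.
apply: K_sat.
- split.
  + move=> b Q R hQ hQR d r; apply: (K_ext D2) (hQ d r) _ => v; exact: hQR.
  + by move=> b d r; exact: (K_top D2).
  + by move=> b Q R hQ hR d r; apply: (K_and D2).
  + by move=> b Q hQ d r; apply: (K_not D2).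
  + move=> b b' m Q hQ d r.
    have m' (i : idx b) : {t : term d (h (b i)) | forall v : tup N2 d,
        j (eval v t) = look (fun k => j (eval v (r k))) (m i)}.
      by case: _ / (m i) => k; exists (r k).
    apply: (K_ext D2) (hQ d (fun i => projT1 (m' i))) _ => v.
    suff -> : (fun i => j (eval v (projT1 (m' i)))) =
      (fun i => look (fun k => j (eval v (r k))) (m i)) by [].
    by apply: fext => i; exact: (projT2 (m' i)).
  + move=> b s Q hQ d r.
    pose r' (i : idx (cext b s)) : term (cext d (h s)) (h (cext b s i)) :=
      match i with
      | Some k => tsubst (fun l => @Var L2 (cext d (h s)) (Some l)) (r k)
      | None => @Var L2 (cext d (h s)) None
      end.
    have rE v (e : N2 (h s)) : (fun i => j (eval (text v e) (r' i))) =
        text (fun i => j (eval v (r i))) (j e).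
      by apply: fext => -[k|//] /=; rewrite eval_tsubst.
    apply: (K_ext D2) (K_ex D2 (hQ _ r')) _ => v.
    split=> [[e]|[e]]; first by rewrite rE; exists (j e).
    by have [x <-] := j_surj e; exists x; rewrite rE.
- split.
  + move=> s d r; apply: (K_ext D2) (definable_eqn N2 (r (inl tt)) (r (inr tt))) _ => v.
    by split=> [->//|/j_inj].
  + move=> g d r.
    have := definable_subst (d := d) (c := cadd (cmap h (fdom g)) (one (h (fcod g))))
      (fun i => match i as i return term d (cadd (cmap h (fdom g)) (one (h (fcod g))) i) with
       | inl k => r (inl k) | inr k => r (inr k) end) (j_fun g).
    by move=> hd; apply: (K_ext D2) hd _ => v; case: (tt).
  + move=> q d r; exact: (definable_subst (c := cmap h (rdom q)) r (j_rel q)).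
Qed.

End Interpretation.

Section FiniteSupport.
Variable L : lang.
Implicit Types (c d y : ctx (lsort L)).

Definition zsub (N : structure L) y T (k : T -> idx y) (z : tup N y) : tup N (csub k) :=
  fun i => z (k i).
Arguments zsub {N y T} k z _.

Definition csub_var c y T U (m : U -> idx y) (j : T -> U)
    (x : idx (cadd c (csub (fun i => m (j i))))) :
    term (cadd c (csub m)) (cadd c (csub (fun i => m (j i))) x) :=
  match x with
  | inl x => @Var L (cadd c (csub m)) (inl x)
  | inr x => @Var L (cadd c (csub m)) (inr (j x))
  end.

Arguments csub_var {c y T U} m j x.

Lemma eval_csub_var (N : structure L) c y T U (m : U -> idx y) (j : T -> U) (v : tup N c)
    (z : tup N y) :
  (fun i => eval (tadd v (zsub m z)) (csub_var (c := c) m j i)) =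
  tadd v (zsub (fun i => m (j i)) z).
Proof. by apply: fext => -[]. Qed.

Lemma term_support c y s (t : term (cadd c y) s) :
  exists (T : finType) (k : T -> idx y) (t' : term (cadd c (csub k)) s),
  forall (N : structure L) (v : tup N c) (z : tup N y),
    eval (tadd v z) t = eval (tadd v (zsub k z)) t'.
Proof.
elim: t => [[i|i]|f ts IH].
- by exists void, (fun x : void => match x with end), (@Var L (cadd c (csub _)) (inl i)).
- by exists unit, (fun=> i), (@Var L (cadd c (csub (fun=> i))) (inr tt)).
have [T h1] := dep_choice IH; have [k h2] := dep_choice h1; have [t ht] := dep_choice h2.
pose U := {i : 'I_(alen (fdom f)) & T i}; pose m (p : U) := k (projT1 p) (projT2 p).
exists (U : finType), m, (App (fun i => tsubst (csub_var (c := c) m (existT T i)) (t i))) => N v z /=.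
apply: (f_equal (@fint _ N f)); apply: fext => i.
by rewrite ht eval_tsubst eval_csub_var.
Qed.

(** A formula mentions finitely many variables, even in a context indexed by all parameters. Only
    [y] is trimmed: under a quantifier the bound variable is stored in [c], which is kept whole, and
    the induction goes through. *)
Lemma fm_support d (f : fm d) c y (r : forall i : idx d, term (cadd c y) (d i)) :
  exists (T : finType) (k : T -> idx y) (f' : fm (cadd c (csub k))),
  forall (N : structure L) (v : tup N c) (z : tup N y),
    sat f (fun i => eval (tadd v z) (r i)) <-> sat f' (tadd v (zsub k z)).
Proof.
elim: f c r => {d} [d|d s t1 t2|d q ts|d f IHf g IHg|d f IHf|d s f IHf] c r.
- by exists void, (fun x : void => match x with end), (Top _).
- have [T1 [k1 [t1' h1]]] := term_support (tsubst r t1).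
  have [T2 [k2 [t2' h2]]] := term_support (tsubst r t2).
  pose m (p : T1 + T2) := match p with inl x => k1 x | inr x => k2 x end.
  exists (T1 + T2)%type, m, (Eqn (tsubst (csub_var (c := c) m inl) t1')
    (tsubst (csub_var (c := c) m inr) t2')) => N v z /=.
  by rewrite -!eval_tsubst h1 h2 !eval_tsubst !eval_csub_var.
- have [T h1] := dep_choice (fun i => term_support (tsubst r (ts i))).
  have [k h2] := dep_choice h1; have [t ht] := dep_choice h2.
  pose U := {i : 'I_(alen (rdom q)) & T i}; pose m (p : U) := k (projT1 p) (projT2 p).
  exists (U : finType), m, (Rel (fun i => tsubst (csub_var (c := c) m (existT T i)) (t i))).
  move=> N v z /=.
  suff -> : (fun i => eval (fun j => eval (tadd v z) (r j)) (ts i)) = (fun i =>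
      eval (tadd v (zsub m z)) (tsubst (csub_var (c := c) m (existT T i)) (t i))) by [].
  by apply: fext => i; rewrite -eval_tsubst ht eval_tsubst eval_csub_var.
- have [T1 [k1 [f1 h1]]] := IHf c r; have [T2 [k2 [f2 h2]]] := IHg c r.
  pose m (p : T1 + T2) := match p with inl x => k1 x | inr x => k2 x end.
  exists (T1 + T2)%type, m, (And (fsubst f1 (csub_var (c := c) m inl))
    (fsubst f2 (csub_var (c := c) m inr))) => N v z /=.
  by rewrite h1 h2 !sat_fsubst !eval_csub_var.
- have [T [k [f' h]]] := IHf c r.
  by exists T, k, (Not f') => N v z /=; rewrite h.
pose c' := cext c s.
pose sh (i : idx (cadd c y)) : term (cadd c' y) (cadd c y i) :=
  match i with
  | inl i => @Var L (cadd c' y) (inl (Some i))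
  | inr i => @Var L (cadd c' y) (inr i)
  end.
pose r' (i : idx (cext d s)) : term (cadd c' y) (cext d s i) :=
  match i with
  | Some i => tsubst sh (r i)
  | None => @Var L (cadd c' y) (inl None)
  end.
have [T [k [f' h]]] := IHf c' r'.
pose sh' (i : idx (cadd c' (csub k))) :
    term (cext (cadd c (csub k)) s) (cadd c' (csub k) i) :=
  match i with
  | inl (Some i) => @Var L (cext (cadd c (csub k)) s) (Some (inl i))
  | inl None => @Var L (cext (cadd c (csub k)) s) None
  | inr i => @Var L (cext (cadd c (csub k)) s) (Some (inr i))
  end.
exists T, k, (Ex (fsubst f' sh')) => N v z /=.
have E1 e : (fun i => eval (tadd (text v e) z) (r' i)) =
    text (fun i => eval (tadd v z) (r i)) e.
  by apply: fext => -[i|//] /=; rewrite eval_tsubst; apply: eval_ext => -[].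
have E2 e : (fun i => eval (text (tadd v (zsub k z)) e) (sh' i)) = tadd (text v e) (zsub k z).
  by apply: fext => -[[]|].
by split=> -[e he]; exists e; move: he; rewrite sat_fsubst E2 -h E1.
Qed.

Lemma definable_support (N : structure L) c y (P : tup N (cadd c y) -> Prop) : definable P ->
  exists (T : finType) (k : T -> idx y) (P' : tup N (cadd c (csub k)) -> Prop),
  definable P' /\ forall v z, P (tadd v z) <-> P' (tadd v ((fun i => z (k i)) : tup N (csub k))).
Proof.
move=> [f hf]; have [T [k [f' h]]] := fm_support f (fun i => @Var L (cadd c y) i).
exists T, k, (sat f'); split; first exact: definable_sat.
by move=> v z; rewrite -h -hf.
Qed.

End FiniteSupport.

(** * Abelian structures and pure exact sequences *)

Lemma quotient_eq (T : Type) (R : T -> T -> Prop) (x y : T) : is_equivalence R ->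
  cls R x = cls R y <-> R x y.
Proof.
move=> [Er Es Et]; split=> [[]/(congr1 (fun P => P y)) E|h]; first by rewrite E; exact: Er.
apply: eq_exist; apply: funext => z; apply: propext; split; last exact: Et.
by apply: Et; apply: Es.
Qed.

Section AbelianStructures.
Local Open Scope ring_scope.
Variable L : lang.
Implicit Types (A : abelian L) (b x : ctx (lsort L)) (f : ppformula L).

Local Notation GL := (group_lang L).

Definition ev A b (v : tup (grp A) b) s (t : @term GL b s) : grp A s := @eval GL (astr A) b v s t.
Definition gsat A x (f : @fm GL x) (v : tup (grp A) x) : Prop := @sat GL (astr A) x f v.

Definition bterms f b := forall k : idx (pp_ar f), @term GL b (pp_ar f k).
Definition evb A f b (t : bterms f b) (v : tup (grp A) b) : tup (grp A) (pp_ar f) :=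
  fun k => ev v (t k).

(** [ab_term] concerns arities only. Applied to the terms f(x) it makes every symbol additive, and
    induction extends this to terms in arbitrary contexts. *)
Lemma ev_add A b (v w : tup (grp A) b) s (t : @term GL b s) :
  ev (tplus v w) t = ev v t + ev w t.
Proof.
rewrite /ev; elim: t => [//|f ts IH].
have := ab_term (App (fun i => @Var GL (fdom f) i))
  (fun i => @eval GL (astr A) b v _ (ts i)) (fun i => @eval GL (astr A) b w _ (ts i)).
rewrite /= => <-; apply: (f_equal (@fint GL (astr A) f)); apply: fext => i.
by rewrite IH.
Qed.

Lemma ev_sub A b (v w : tup (grp A) b) s (t : @term GL b s) :
  ev (tminus v w) t = ev v t - ev w t.
Proof.
apply/eqP; rewrite eq_sym subr_eq -ev_add; apply/eqP.
suff -> : tplus (tminus v w) w = v by [].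
by apply: fext => i; rewrite /tplus /tminus subrK.
Qed.

Lemma ppsat_ext A f (v w : tup (grp A) (pp_ar f)) : (forall i, v i = w i) -> ppsat v -> ppsat w.
Proof. by move=> h; rewrite (fext h : v = w). Qed.

Lemma ppsat0 A f : ppsat (A := A) (f := f) t0.
Proof. exact: ab_pp0 (pp_pp f). Qed.

Lemma ppsatB A f (v w : tup (grp A) (pp_ar f)) : ppsat v -> ppsat w -> ppsat (tminus v w).
Proof. exact: ab_ppB (pp_pp f). Qed.

Lemma ppsatD A f (v w : tup (grp A) (pp_ar f)) : ppsat v -> ppsat w -> ppsat (tplus v w).
Proof.
move=> hv hw; have := ppsatB hv (ppsatB (ppsat0 A f) hw).
suff -> : tminus v (tminus t0 w) = tplus v w by [].
by apply: fext => i; rewrite /tminus /tplus /t0 sub0r opprK.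
Qed.

Lemma cls_eq A f (v w : tup (grp A) (pp_ar f)) :
  cls (coset_rel A f) v = cls (coset_rel A f) w <-> ppsat (tminus v w).
Proof. exact: quotient_eq (coset_rel_equiv A f). Qed.

Lemma hom_ev A A' (h : forall s, grp A s -> grp A' s) : @is_hom GL (astr A) (astr A') h ->
  forall b (v : tup (grp A) b) s (t : @term GL b s), h s (ev v t) = ev (tmap h v) t.
Proof.
move=> [hf _] b v s t; rewrite /ev; elim: t => [//|f ts IH] /=.
rewrite -[LHS]/(h _ (@fint GL (astr A) f (fun i => eval (N := astr A) v (ts i)))) hf.
apply: (f_equal (@fint GL (astr A') f)); apply: fext => i; exact: IH.
Qed.

Lemma hom_add A A' (h : forall s, grp A s -> grp A' s) : @is_hom GL (astr A) (astr A') h ->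
  forall s (x y : grp A s), h s (x + y) = h s x + h s y.
Proof.
by move=> [hf _] s x y; exact: (hf (inl (Gadd s)) (fun i : 'I_2 => if i == ord0 then x else y)).
Qed.

Lemma hom_sub A A' (h : forall s, grp A s -> grp A' s) : @is_hom GL (astr A) (astr A') h ->
  forall s (x y : grp A s), h s (x - y) = h s x - h s y.
Proof.
by move=> hh s x y; apply/eqP; rewrite eq_sym subr_eq -(hom_add hh) subrK.
Qed.

Lemma hom_tminus A A' (h : forall s, grp A s -> grp A' s) : @is_hom GL (astr A) (astr A') h ->
  forall b (v w : tup (grp A) b), tmap h (tminus v w) = tminus (tmap h v) (tmap h w).
Proof. by move=> hh b v w; apply: fext => i; rewrite /tmap /tminus (hom_sub hh). Qed.

Lemma hom_evb A A' (h : forall s, grp A s -> grp A' s) : @is_hom GL (astr A) (astr A') h ->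
  forall f b (t : bterms f b) (v : tup (grp A) b), tmap h (evb t v) = evb t (tmap h v).
Proof. by move=> hh f b t v; apply: fext => i; exact: (hom_ev hh). Qed.

Lemma evb_sub A f b (t : bterms f b) (v w : tup (grp A) b) :
  evb t (tminus v w) = tminus (evb t v) (evb t w).
Proof. by apply: fext => i; exact: ev_sub. Qed.

(** Purity, [nu_pp] and the fundamental system are stated for a [ppformula], whose variables form an
    arity. The mutually inverse renamings [q] and [q'] make them available in every finite
    context. *)
Lemma pp_arity x (f : @fm GL x) : finctx x -> is_pp f ->
  exists (g : ppformula L) (q : forall k : idx (pp_ar g), var x (pp_ar g k))
    (q' : forall i : idx x, var (pp_ar g) (x i)),
  [/\ forall A (v : tup (grp A) x), gsat f v <-> ppsat (fun k => look v (q k)),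
      forall A (v : tup (grp A) x) i, look (fun k => look v (q k)) (q' i) = v i &
      forall A (v : tup (grp A) (pp_ar g)) k, look (fun i => look v (q' i)) (q k) = v k].
Proof.
move=> [T [e [e' [he' he]]]] hf.
pose s (k : 'I_#|T|) := x (e (enum_val k)).
have E (i : idx x) : e (enum_val (enum_rank (e' i))) = i by rewrite enum_rankK he.
pose q' (i : idx x) : var (Arity s) (x i) :=
  ecast k (var (Arity s) (x k)) (E i) (V (enum_rank (e' i) : idx (Arity s))).
pose q (k : idx (Arity s)) : var x (s k) := V (e (enum_val k)).
have qK A (v : tup (grp A) x) i : look (fun k => look v (q k)) (q' i) = v i.
  by rewrite /q' look_ecast; exact: tup_ecast.
exists (@PP L (Arity s) (@fsubst GL x f (Arity s) (fun i => @tvar GL _ _ (q' i))) (eq_trans (is_pp_fsubst _ _) hf)), q, q'.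
split=> // A v.
  rewrite /gsat /ppsat /= sat_fsubst.
  suff -> : (fun i => @eval GL (astr A) (Arity s) (fun k => look v (q k)) _ (@tvar GL _ _ (q' i))) = v by [].
  by apply: fext => i; rewrite eval_tvar; exact: qK.
move=> k; rewrite /q /= /q' look_ecast /=.
have Ek : enum_rank (e' (e (enum_val k))) = k by rewrite he' enum_valK.
move: (E _); rewrite Ek => E'; by rewrite (Prop_irrelevance E' erefl).
Qed.

End AbelianStructures.

Section Sequences.
Local Open Scope ring_scope.
Variables (L : lang) (E : pure_ses L).
Local Notation GL := (group_lang L).
Local Notation io := (@iota L E).
Local Notation nu := (@nu L E).
Implicit Types (b x : ctx (lsort L)) (f : ppformula L).

Lemma iota_hom : @is_hom GL (astr (sA E)) (astr (sB E)) io.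
Proof. by case: (iota_embedding E). Qed.

Lemma nu_iota s (a : grp (sA E) s) : nu (io a) = 0.
Proof. by apply/exact_at_B; exists a. Qed.

Lemma nu_tmap_iota b (v : tup (grp (sB E)) b) (a : tup (grp (sA E)) b) :
  tmap nu (tminus v (tmap io a)) = tmap nu v.
Proof. by apply: fext => i; rewrite /tmap /tminus (hom_sub (nu_hom E)) nu_iota subr0. Qed.

(** The right-hand side is what [rho] tests: its domain phi(B) + iota(A) is the preimage of phi(C)
    under nu. *)
Lemma nu_ppE f (v : tup (grp (sB E)) (pp_ar f)) :
  ppsat (tmap nu v) <-> exists a, ppsat (tminus v (tmap io a)).
Proof.
rewrite nu_pp; split=> [[v' h [a ->]]|[a h]].
  exists a; suff -> : tminus (tplus v' (tmap io a)) (tmap io a) = v' by [].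
  by apply: fext => i; rewrite /tminus /tplus addrK.
exists (tminus v (tmap io a)) => //; exists a.
by apply: fext => i; rewrite /tminus /tplus subrK.
Qed.

Lemma nu_pp_ctx x (f : @fm GL x) (v : tup (grp (sB E)) x) : finctx x -> is_pp f ->
  gsat f (tmap nu v) <-> exists a, gsat f (tminus v (tmap io a)).
Proof.
move=> hx hf; have [g [q [q' [hg hq hq']]]] := pp_arity hx hf.
have hmap A A' (h : forall s, grp A s -> grp A' s) (w : tup (grp A) x) :
    (fun k => look (tmap h w) (q k)) = tmap h (fun k => look w (q k)).
  by apply: fext => k; rewrite /tmap; case: _ / (q k).
rewrite hg hmap nu_ppE; split=> -[a h].
  exists (fun i => look a (q' i)); rewrite hg.
  suff -> : (fun k => look (tminus v (tmap io (fun i => look a (q' i)))) (q k)) =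
    tminus (fun k => look v (q k)) (tmap io a) by [].
  apply: fext => k; rewrite /tminus /tmap -(hq' (sA E) a k).
  by case: _ / (q k).
exists (fun k => look a (q k)); move: h; rewrite hg.
suff -> : (fun k => look (tminus v (tmap io a)) (q k)) =
    tminus (fun k => look v (q k)) (tmap io (fun k => look a (q k))) by [].
by apply: fext => k; rewrite /tminus /tmap; case: _ / (q k).
Qed.

Lemma fundamental_ctx Phi : fundamental_system (sB E) Phi ->
  forall x (f : @fm GL x), finctx x -> is_pp f ->
  exists n (g : 'I_n -> ppformula L) (t : forall i, bterms (g i) x), (forall i, Phi (g i)) /\
    forall v : tup (grp (sB E)) x, gsat f v <-> forall i, ppsat (evb (t i) v).
Proof.
move=> hPhi x f hx hf; have [g [q [q' [hg hq hq']]]] := pp_arity hx hf.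
have [n [h [t [hh ht]]]] := hPhi g.
exists n, h, (fun i k => @tsubst GL _ _ (fun l => @tvar GL _ _ (q l)) _ (t i k)); split=> // v.
have key i k : evals (t i) (fun k => look v (q k)) k =
    ev v (@tsubst GL _ _ (fun l => @tvar GL _ _ (q l)) _ (t i k)).
  rewrite /evals /ev eval_tsubst; apply: (@eval_ext GL (astr (sB E)) (pp_ar g)) => l; symmetry.
  exact: (@eval_tvar GL (astr (sB E))).
by rewrite hg ht; split=> H i; apply: ppsat_ext (H i) => k; rewrite key.
Qed.

Lemma rho_cls f (v : tup (grp (sB E)) (pp_ar f)) a :
  ppsat (tminus v (tmap io a)) -> rho v = cls _ a.
Proof.
move=> ha; rewrite /rho; case: pselect => [h|[]]; last by exists a.
apply/cls_eq; apply/iota_pure; rewrite (hom_tminus iota_hom).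
apply: ppsat_ext (ppsatB ha (projT2 (cid h))) => i.
by rewrite /tminus opprB addrC addrA subrK.
Qed.

Lemma rho_out f (v : tup (grp (sB E)) (pp_ar f)) :
  ~ ppsat (tmap nu v) -> rho v = cls _ t0.
Proof. by move=> h; rewrite /rho; case: pselect => // h'; case: h; apply/nu_ppE. Qed.

(** The condition on [tmap nu v] excludes the default value of [rho], which is also a class, namely
    that of 0. *)
Lemma rho_inv f (v : tup (grp (sB E)) (pp_ar f)) a :
  ppsat (tmap nu v) -> rho v = cls _ a -> ppsat (tminus v (tmap io a)).
Proof.
move=> /nu_ppE[a' ha']; rewrite (rho_cls ha') => /cls_eq/iota_pure.
rewrite (hom_tminus iota_hom) => h; apply: ppsat_ext (ppsatD ha' h) => i.
by rewrite /tminus /tplus addrA subrK.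
Qed.

Lemma nu_ppsat f (v : tup (grp (sB E)) (pp_ar f)) : ppsat v -> ppsat (tmap nu v).
Proof.
move=> h; apply/nu_ppE; exists t0; apply: ppsat_ext h => i.
by rewrite /tminus /tmap /t0 -[0](subrr (0 : grp (sA E) _)) (hom_sub iota_hom) subrr subr0.
Qed.

(** A difference in phi(B) puts both arguments in the domain of [rho], or neither; in the first case
    the same element of A represents both. *)
Lemma rho_congr f (v w : tup (grp (sB E)) (pp_ar f)) : ppsat (tminus v w) -> rho v = rho w.
Proof.
move=> h.
have hn := nu_ppsat h.
rewrite (hom_tminus (nu_hom E)) in hn.
case: (pselect (ppsat (tmap nu w))) => hw.
  have [a ha] := (nu_ppE w).1 hw.
  rewrite (rho_cls ha); apply: rho_cls; apply: ppsat_ext (ppsatD h ha) => i.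
  by rewrite /tminus /tplus addrA subrK.
rewrite !rho_out // => hv; apply: hw; apply: ppsat_ext (ppsatB hv hn) => i.
by rewrite /tminus /tmap subKr.
Qed.

End Sequences.

(** * Terms in one family of sorts, and p.p.-formulas for systems of congruences *)

Section SortedTerms.
Variables (L : lang) (Phi : set (ppformula L)) (E : expanded_ses Phi).
Local Notation GL := (group_lang L).

Definition zero_term (d : ctx (lsort L)) s : @term GL d s :=
  @App GL d (inl (Gzero s)) (fun i : 'I_0 => match notF (ltn_ord i) with end).

Fixpoint trA (d : ctx (lsort (langA E))) (b : ctx (lsort L))
    (r : forall i : idx b, term d (homeA E (b i))) s (t : @term GL b s) : term d (homeA E s) :=
  match t with
  | Var i => r i
  | App f ts => @App (langA E) d (inl (inl f)) (fun i => trA r (ts i))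
  end.

Lemma eval_trA d b r s t (v : tup (strA E) d) :
  eval v (@trA d b r s t) = ev (A := sA E) (fun i => eval v (r i)) t.
Proof.
rewrite /ev; elim: t => [//|f ts IH].
by apply: (f_equal (@fint _ (astr (sA E)) f)); apply: fext.
Qed.

Fixpoint trC (d : ctx (lsort (langC E))) (b : ctx (lsort L))
    (r : forall i : idx b, term d (homeC E (b i))) s (t : @term GL b s) : term d (homeC E s) :=
  match t with
  | Var i => r i
  | App f ts => @App (langC E) d (inl f) (fun i => trC r (ts i))
  end.

Lemma eval_trC d b r s t (v : tup (strC E) d) :
  eval v (@trC d b r s t) = ev (A := sC E) (fun i => eval v (r i)) t.
Proof.
rewrite /ev; elim: t => [//|f ts IH].
by apply: (f_equal (@fint _ (astr (sC E)) f)); apply: fext.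
Qed.

Lemma definable_homeC b (P : tup (grp (sC E)) b -> Prop) : definable (N := astr (sC E)) P ->
  forall d (r : forall i : idx b, term d (homeC E (b i))),
  definable (N := strC E) (c := d) (fun v => P (fun i => eval v (r i))).
Proof.
move=> hP; apply: (@definable_interp _ _ (astr (sC E)) (strC E) (@homeC L Phi E) (fun s x => x)).
- by move=> s x y.
- by move=> s y; exists y.
- move=> f; pose d := cadd (cmap (homeC E) (fdom f)) (one (homeC E (fcod f))).
  exact: (definable_eqn (strC E) (@App (langC E) d (inl f) (fun i => @Var (langC E) d (inl i)))
    (@Var (langC E) d (inr tt))).
- move=> q; pose d := cmap (homeC E) (rdom q).
  by exists (@Rel (langC E) d (inl q) (fun i => @Var (langC E) d i)).
exact: hP.
Qed.

End SortedTerms.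

Section TermLemmas.
Local Open Scope ring_scope.
Variable L : lang.
Local Notation GL := (group_lang L).
Implicit Types (A : abelian L) (b d x : ctx (lsort L)).

Lemma ev_ext A b (v w : tup (grp A) b) s (t : @term GL b s) :
  (forall i, v i = w i) -> ev v t = ev w t.
Proof. by move=> h; rewrite (fext h : v = w). Qed.

Lemma ev_tsubst A b d (r : forall i : idx b, @term GL d (b i)) (v : tup (grp A) d) s
    (t : @term GL b s) :
  ev v (@tsubst GL b d r s t) = ev (fun i => ev v (r i)) t.
Proof. exact: (@eval_tsubst GL (astr A)). Qed.

Lemma gsat_fsubst A b d (r : forall i : idx b, @term GL d (b i)) (v : tup (grp A) d)
    (f : @fm GL b) :
  gsat (@fsubst GL b f d r) v <-> gsat f (fun i => ev v (r i)).
Proof. exact: (@sat_fsubst GL (astr A)). Qed.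

Definition sub_term d s (t1 t2 : @term GL d s) : @term GL d s :=
  @App GL d (inl (Gadd s)) (fun k : 'I_2 => if k == ord0 then t1
    else @App GL d (inl (Gopp s)) (fun _ : 'I_1 => t2)).

Lemma ev_sub_term A d s (t1 t2 : @term GL d s) (v : tup (grp A) d) :
  ev v (sub_term t1 t2) = ev v t1 - ev v t2.
Proof. by []. Qed.

Lemma bigand_pp x (T : finType) (F : {set T}) (g : T -> @fm GL x) : (forall t, is_pp (g t)) ->
  exists f : @fm GL x, is_pp f /\
    forall A (v : tup (grp A) x), gsat f v <-> forall t, t \in F -> gsat (g t) v.
Proof.
move=> hg; exists (foldr (fun t f => And (g t) f) (@Top GL x) (enum F)); split.
  by elim: (enum F) => [//|t l IH] /=; rewrite hg IH.
move=> A v; have -> : (forall t, t \in F -> gsat (g t) v) <->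
    (forall t, t \in enum F -> gsat (g t) v).
  by split=> h t ht; apply: h; move: ht; rewrite mem_enum.
elim: (enum F) => [//|t l IH]; split=> [[h1 /IH h2] t'|h].
  by rewrite in_cons => /orP[/eqP->|/h2].
split; first by apply: h; rewrite mem_head.
by apply/IH => t' ht'; apply: h; rewrite in_cons ht' orbT.
Qed.

Section SplitVariable.
Variables (b : ctx (lsort L)) (s : lsort L) (f : ppformula L) (tt' : bterms f (cext b s)).

Definition bterms_base : bterms f b := fun k =>
  @tsubst GL (cext b s) b (fun i => match i return @term GL b (cext b s i) with
    | Some j => @Var GL b j | None => zero_term b s end) _ (tt' k).
Definition bterms_last : bterms f (one s) := fun k =>
  @tsubst GL (cext b s) (one s) (fun i => match i return @term GL (one s) (cext b s i) with
    | Some j => zero_term (one s) (b j) | None => @Var GL (one s) tt end) _ (tt' k).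

(** Additivity gives t(v, e) = t(v, 0) + t(0, e), which separates a quantified variable from the
    others. *)
Lemma evb_split A (v : tup (grp A) b) (e : grp A s) :
  evb tt' (text v e : tup (grp A) (cext b s)) =
  tplus (evb bterms_base v) (evb bterms_last (fun _ : unit => e)).
Proof.
apply: fext => k; rewrite /evb /tplus /bterms_base /bterms_last !ev_tsubst -ev_add.
by apply: ev_ext => -[j|]; rewrite /tplus /= ?addr0 // add0r.
Qed.

End SplitVariable.

Section Theta.
Variables (s : lsort L) (T : finType) (f : T -> ppformula L).
Variable t2 : forall t, bterms (f t) (one s).

Definition famctx : ctx (lsort L) := csig (fun t => pp_ar (f t)).
Definition fam A (v : tup (grp A) famctx) t : tup (grp A) (pp_ar (f t)) :=
  fun k => v (existT _ t k).
Arguments fam {A} v t _.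

Lemma theta_pp (F : {set T}) : exists g : @fm GL famctx, is_pp g /\
  forall A (v : tup (grp A) famctx), gsat g v <->
    exists y : grp A s, forall t, t \in F ->
      ppsat (tminus (fam v t) (evb (@t2 t) (fun _ : unit => y))).
Proof.
pose d := cext famctx s.
pose r t (k : idx (pp_ar (f t))) : @term GL d (pp_ar (f t) k) :=
  sub_term (@Var GL d (Some (existT _ t k)))
    (@tsubst GL (one s) d (fun _ => @Var GL d None) _ (t2 k)).
have [g [hg hg']] := @bigand_pp d T F (fun t => @fsubst GL _ (pp_fm (f t)) d (r t))
  (fun t => eq_trans (is_pp_fsubst _ _) (pp_pp (f t))).
exists (Ex g); split=> // A v.
have key (y : grp A s) : gsat g (text v y : tup (grp A) d) <->
    forall t, t \in F -> ppsat (tminus (fam v t) (evb (@t2 t) (fun _ : unit => y))).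
  rewrite hg'; split=> h t tF; move: (h t tF); rewrite gsat_fsubst; apply: ppsat_ext => k;
    by rewrite /tminus ev_sub_term ev_tsubst.
by split=> -[y hy]; exists y; apply/key.
Qed.

(** This is the homogeneous system attached to [theta_pp]: it measures the difference of two
    solutions, and serves to correct one of them by an element of iota(A). *)
Lemma xi_pp (F : {set T}) : exists g : @fm GL (one s), is_pp g /\
  forall A (v : tup (grp A) (one s)), gsat g v <->
    forall t, t \in F -> ppsat (evb (@t2 t) v).
Proof.
have [g [hg hg']] := @bigand_pp (one s) T F (fun t => @fsubst GL _ (pp_fm (f t)) (one s) (@t2 t))
  (fun t => eq_trans (is_pp_fsubst _ _) (pp_pp (f t))).
exists g; split=> // A v; rewrite hg'.
by split=> h t tF; move: (h t tF); rewrite gsat_fsubst.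
Qed.

End Theta.
End TermLemmas.
Arguments fam {L T f A} v t _.

(** * Quantifier elimination for the sequence *)

Section Elimination.
Local Open Scope ring_scope.
Variables (L : lang) (Phi : set (ppformula L)) (E : expanded_ses Phi).
Hypothesis hPhi : fundamental_system (sB E) Phi.
Local Notation GL := (group_lang L).
Local Notation LA := (langA E).
Local Notation LC := (langC E).
Local Notation tA a := (tup (strA E) a).
Local Notation tB b := (tup (grp (sB E)) b).
Local Notation tC c := (tup (strC E) c).
Local Notation io := (@iota L E).
Local Notation nu := (@nu L E).
Implicit Types (a : ctx (lsort LA)) (b : ctx (lsort L)) (c : ctx (lsort LC)).

(* All elements [rho_phi(t(x_B))] at once: a formula uses only finitely many of them. *)
Definition allq b : ctx (lsort LA) :=
  Ctx (fun i : {f : set_type Phi & bterms (val f) b} => quoA E (projT1 i)).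
Definition allrho b (vb : tB b) : tA (allq b) :=
  fun i => rho (E := E) (evb (projT2 i) vb).
Definition nuv b (vb : tB b) : tC (cmap (@homeC L Phi E) b) := tmap nu vb.

Definition Aset a b (P : tA a -> tB b -> Prop) : Prop :=
  exists Q, definable (N := strA E) (c := cadd a (allq b)) Q /\
    forall va vb, P va vb <-> Q (tadd va (allrho vb)).
Definition Cset b c (P : tB b -> tC c -> Prop) : Prop :=
  exists Q, definable (N := strC E) (c := cadd (cmap (@homeC L Phi E) b) c) Q /\
    forall vb vc, P vb vc <-> Q (tadd (nuv vb) vc).
(** A finite union of rectangles: this form is closed under Boolean operations, and an existential
    quantifier reduces to the case of one rectangle. *)
Definition AC a b c (P : tA a -> tB b -> tC c -> Prop) : Prop :=
  exists (I : finType) PA PC, [/\ forall i : I, Aset (PA i), forall i : I, Cset (PC i) &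
    forall va vb vc, P va vb vc <-> exists i, PA i va vb /\ PC i vb vc].

Let DA := definable_closed (strA E).
Let DC := definable_closed (strC E).

Lemma AC_ext a b c (P Q : tA a -> tB b -> tC c -> Prop) :
  AC P -> (forall va vb vc, P va vb vc <-> Q va vb vc) -> AC Q.
Proof.
by move=> [I [PA [PC [h1 h2 h3]]]] h; exists I, PA, PC; split=> // va vb vc; rewrite -h.
Qed.

Lemma Aset_and a b (P Q : tA a -> tB b -> Prop) :
  Aset P -> Aset Q -> Aset (fun va vb => P va vb /\ Q va vb).
Proof.
move=> [P' [hP hP']] [Q' [hQ hQ']]; exists (fun v => P' v /\ Q' v).
by split=> [|va vb]; [exact: (K_and DA)|rewrite hP' hQ'].
Qed.

Lemma Cset_and b c (P Q : tB b -> tC c -> Prop) :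
  Cset P -> Cset Q -> Cset (fun vb vc => P vb vc /\ Q vb vc).
Proof.
move=> [P' [hP hP']] [Q' [hQ hQ']]; exists (fun v => P' v /\ Q' v).
by split=> [|va vb]; [exact: (K_and DC)|rewrite hP' hQ'].
Qed.

Lemma Aset_forall a b (I : finType) (D : {set I}) (P : I -> tA a -> tB b -> Prop) :
  (forall i, Aset (P i)) -> Aset (fun va vb => forall i, i \in D -> ~ P i va vb).
Proof.
move=> /dep_choice[Q hQ].
exists (fun v => forall i, i \in D -> ~ Q i v); split=> [|va vb].
  apply: (K_finforall DA) => i; apply: (K_imp DA) (K_prop DA _ _) (K_not DA _).
  exact: (hQ i).1.
by split=> H i iD; have := H i iD; rewrite (hQ i).2.
Qed.

Lemma Cset_forall b c (I : finType) (D : {set I}) (P : I -> tB b -> tC c -> Prop) :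
  (forall i, Cset (P i)) -> Cset (fun vb vc => forall i, i \notin D -> ~ P i vb vc).
Proof.
move=> /dep_choice[Q hQ].
exists (fun v => forall i, i \notin D -> ~ Q i v); split=> [|va vb].
  apply: (K_finforall DC) => i; apply: (K_imp DC) (K_prop DC _ _) (K_not DC _).
  exact: (hQ i).1.
by split=> H i iD; have := H i iD; rewrite (hQ i).2.
Qed.

Lemma AC_rect a b c (PA : tA a -> tB b -> Prop) (PC : tB b -> tC c -> Prop) :
  Aset PA -> Cset PC -> AC (fun va vb vc => PA va vb /\ PC vb vc).
Proof.
move=> hA hC; exists unit, (fun=> PA), (fun=> PC); split=> // va vb vc.
by split=> [h|[_ //]]; exists tt.
Qed.

Lemma Aset_true a b : @Aset a b (fun _ _ => True).
Proof. by exists (fun=> True); split=> //; exact: (K_top DA). Qed.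

Lemma Cset_true b c : @Cset b c (fun _ _ => True).
Proof. by exists (fun=> True); split=> //; exact: (K_top DC). Qed.

Lemma AC_A a b c Q : definable (N := strA E) (c := cadd a (allq b)) Q ->
  @AC a b c (fun va vb _ => Q (tadd va (allrho vb))).
Proof.
move=> hQ; have h : @Aset a b (fun va vb => Q (tadd va (allrho vb))) by exists Q.
by apply: AC_ext (AC_rect h (Cset_true b c)) _ => va vb vc; split=> // -[].
Qed.

Lemma AC_C a b c Q : definable (N := strC E) (c := cadd (cmap (@homeC L Phi E) b) c) Q ->
  @AC a b c (fun _ vb vc => Q (tadd (nuv vb) vc)).
Proof.
move=> hQ; have h : @Cset b c (fun vb vc => Q (tadd (nuv vb) vc)) by exists Q.
by apply: AC_ext (AC_rect (Aset_true a b) h) _ => va vb vc; split=> // -[].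
Qed.

Lemma AC_top a b c : @AC a b c (fun _ _ _ => True).
Proof. exact: AC_ext (AC_rect (Aset_true a b) (Cset_true b c)) _. Qed.

Lemma AC_and a b c (P Q : tA a -> tB b -> tC c -> Prop) :
  AC P -> AC Q -> AC (fun va vb vc => P va vb vc /\ Q va vb vc).
Proof.
move=> [I [PA [PC [h1 h2 h3]]]] [J [QA [QC [k1 k2 k3]]]].
exists (I * J)%type, (fun p va vb => PA p.1 va vb /\ QA p.2 va vb),
  (fun p vb vc => PC p.1 vb vc /\ QC p.2 vb vc); split=> [p|p|va vb vc].
- exact: Aset_and.
- exact: Cset_and.
rewrite h3 k3; split=> [[[i [? ?]] [j [? ?]]]|[[i j] /= [[? ?] [? ?]]]].
  by exists (i, j).
by split; [exists i|exists j].
Qed.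

Lemma AC_exists a b c (J : finType) (P : J -> tA a -> tB b -> tC c -> Prop) :
  (forall j, AC (P j)) -> AC (fun va vb vc => exists j, P j va vb vc).
Proof.
move=> /dep_choice[I /dep_choice[PA /dep_choice[PC h]]].
exists {j : J & I j}, (fun p => PA _ (projT2 p)), (fun p => PC _ (projT2 p)).
split=> [[j i]|[j i]|va vb vc]; try by have [] := h j.
split=> [[j]|[[j i] /= H]]; have [_ _ hj] := h j.
  by rewrite hj => -[i hi]; exists (existT _ j i).
by exists j; rewrite hj; exists i.
Qed.

(** Each index must fail on its A-side or on its C-side. Guessing the set D of those that fail on
    the A-side shows that the complement is again a finite union of rectangles. *)
Lemma AC_not a b c (P : tA a -> tB b -> tC c -> Prop) :
  AC P -> AC (fun va vb vc => ~ P va vb vc).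
Proof.
move=> [I [PA [PC [h1 h2 h3]]]].
apply: AC_ext (AC_exists (fun D : {set I} => AC_rect (Aset_forall D h1) (Cset_forall D h2))) _.
move=> va vb vc; rewrite h3; split=> [[D [hA hC]] [i [hi1 hi2]]|h].
  by case: (boolP (i \in D)) => [/hA|/hC].
exists [set i | ~~ `[< PA i va vb >]]%SET; split=> i; rewrite inE.
  by move/asboolPn.
by rewrite negbK => /asboolP hi hi'; apply: h; exists i.
Qed.

Lemma AC_forall a b c (J : finType) (P : J -> tA a -> tB b -> tC c -> Prop) :
  (forall j, AC (P j)) -> AC (fun va vb vc => forall j, P j va vb vc).
Proof.
move=> h; apply: AC_ext (AC_not (AC_exists (fun j => AC_not (h j)))) _ => va vb vc.
split=> [/forallNP H j|H [j]]; [exact: contrapT (H j)|by apply].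
Qed.

Lemma AC_exA a b c s (P : tA (cext a s) -> tB b -> tC c -> Prop) :
  AC P -> AC (fun va vb vc => exists e : strA E s, P (text va e) vb vc).
Proof.
move=> [I [PA [PC [h1 h2 h3]]]].
have hA i : @Aset a b (fun va vb => exists e : strA E s, PA i (text va e) vb).
  have [Q [hQ hQ']] := h1 i.
  pose r (i : idx (cadd (cext a s) (allq b))) :
      var (cext (cadd a (allq b)) s) (cadd (cext a s) (allq b) i) :=
    match i with
    | inl None => V (None : idx (cext (cadd a (allq b)) s))
    | inl (Some i) => V (Some (inl i) : idx (cext (cadd a (allq b)) s))
    | inr i => V (Some (inr i) : idx (cext (cadd a (allq b)) s))
    end.
  exists (fun v => exists e, Q (fun i => look (text v e) (r i))).
  split=> [|va vb]; first exact: (K_ex DA) (K_ren DA r hQ).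
  have rE e : (fun i => look (text (tadd va (allrho vb)) e) (r i)) =
     tadd (text va e) (allrho vb) by apply: fext => -[[]|].
  by split=> -[e he]; exists e; move: he; rewrite hQ' rE.
apply: AC_ext (AC_exists (fun i => AC_rect (hA i) (h2 i))) _ => va vb vc.
split=> [[i [[e ?] ?]]|[e]]; first by exists e; rewrite h3; exists i.
by rewrite h3 => -[i [? ?]]; exists i; split=> //; exists e.
Qed.

Lemma AC_exC a b c s (P : tA a -> tB b -> tC (cext c s) -> Prop) :
  AC P -> AC (fun va vb vc => exists e : strC E s, P va vb (text vc e)).
Proof.
move=> [I [PA [PC [h1 h2 h3]]]].
have hC i : @Cset b c (fun vb vc => exists e : strC E s, PC i vb (text vc e)).
  have [Q [hQ hQ']] := h2 i.
  pose nb := cmap (@homeC L Phi E) b.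
  pose r (i : idx (cadd nb (cext c s))) :
      var (cext (cadd nb c) s) (cadd nb (cext c s) i) :=
    match i with
    | inl i => V (Some (inl i) : idx (cext (cadd nb c) s))
    | inr None => V (None : idx (cext (cadd nb c) s))
    | inr (Some i) => V (Some (inr i) : idx (cext (cadd nb c) s))
    end.
  exists (fun v => exists e, Q (fun i => look (text v e) (r i))).
  split=> [|vb vc]; first exact: (K_ex DC) (K_ren DC r hQ).
  have rE e : (fun i => look (text (tadd (nuv vb) vc) e) (r i)) =
     tadd (nuv vb) (text vc e) by apply: fext => -[|[]].
  by split=> -[e he]; exists e; move: he; rewrite hQ' rE.
apply: AC_ext (AC_exists (fun i => AC_rect (h1 i) (hC i))) _ => va vb vc.
split=> [[i [? [e ?]]]|[e]]; first by exists e; rewrite h3; exists i.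
by rewrite h3 => -[i [? ?]]; exists i; split=> //; exists e.
Qed.

(** A witness e meets the A-side only through the values rho(tau_t(vb, e)), and the C-side only
    through nu(e). The set F guesses the t for which tau_t(vb, e) lies in the domain of rho. The
    A-side then asks that prescribed values be attained on F, the C-side that some z be compatible
    with F, and the two solutions are merged by a correction in iota(A). *)
Lemma AC_exB_rect a b c s (PA : tA a -> tB (cext b s) -> Prop)
    (PC : tB (cext b s) -> tC c -> Prop) : Aset PA -> Cset PC ->
  AC (fun va vb vc => exists e : grp (sB E) s,
    PA va (text vb e) /\ PC (text vb e : tB (cext b s)) vc).
Proof.
move=> [Q0 [hQ0 hPA]] [QC [hQC hPC]].
have [T [k [Q [hQ hQ0Q]]]] := definable_support hQ0.
pose f t := projT1 (k t).
pose tau t : bterms (val (f t)) (cext b s) := projT2 (k t).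
pose t1 t := bterms_base (tau t); pose t2 t := bterms_last (tau t).
pose X := famctx (fun t => val (f t)).
have hX : finctx X by apply: finctx_csig => t; exact: finctx_arity.
pose x1 A (v : tup (grp A) b) : tup (grp A) X := fun p => ev v (t1 (projT1 p) (projT2 p)).
have fam1 A (v : tup (grp A) b) t : fam (x1 A v) t = evb (t1 t) v by [].
have tauE A (v : tup (grp A) b) (y : grp A s) t :
    evb (tau t) (text v y : tup (grp A) (cext b s)) =
    tplus (evb (t1 t) v) (evb (t2 t) (fun _ : unit => y)).
  exact: evb_split.
have t2B A (y y' : grp A s) t j : evb (t2 t) (fun _ : unit => y - y') j =
    evb (t2 t) (fun _ : unit => y) j - evb (t2 t) (fun _ : unit => y') j.
  exact: (@ev_sub L A (one s) (fun _ => y) (fun _ => y')).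
have t2D A (y y' : grp A s) t j : evb (t2 t) (fun _ : unit => y + y') j =
    evb (t2 t) (fun _ : unit => y) j + evb (t2 t) (fun _ : unit => y') j.
  exact: (@ev_add L A (one s) (fun _ => y) (fun _ => y')).
have t2N A (y : grp A s) t j : evb (t2 t) (fun _ : unit => - y) j =
    - evb (t2 t) (fun _ : unit => y) j.
  have -> : - y = y - (y + y) by rewrite opprD addrA subrr sub0r.
  by rewrite t2B t2D opprD addrA subrr sub0r.
(* Let [x_t = t1_t(vb)].  There is [e] in [B] with [tau_t(vb, e) - iota(al_t)] in
   [phi_t(B)] for [t] in [F] iff [x - iota(al)] satisfies [Th F]; decomposed along
   the fundamental system, this only involves [rho] of terms in [vb]. *)
have [Th hTh] := dep_choice (theta_pp t2).
have ThP F : is_pp (Th F) := (hTh F).1.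
have ThE F A (v : tup (grp A) X) : gsat (Th F) v <-> exists y : grp A s, forall t, t \in F ->
    ppsat (tminus (fam v t) (evb (@t2 t) (fun _ : unit => y))) := (hTh F).2 A v.
have [n hn] := dep_choice (fun F => fundamental_ctx hPhi hX (ThP F)).
have [g hg] := dep_choice hn; have [sg hsg] := dep_choice hg.
have gPhi F i : Phi (g F i) := (hsg F).1 i.
have sgE F (v : tB X) : gsat (Th F) v <-> forall i, ppsat (evb (sg F i) v) := (hsg F).2 v.
(* The values prescribed to rho: the classes of [al] on F, and off F the default class of 0. *)
pose w (F : {set T}) (al : tup (grp (sA E)) X) : tA (csub k) := fun t =>
  if t \in F then cls (coset_rel (sA E) (val (f t))) (fam al t) else cls _ t0.
pose AF (F : {set T}) (va : tA a) (vb : tB b) := exists al : tup (grp (sA E)) X, Q (tadd va (w F al)) /\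
  forall i, cls _ (evb (sg F i) al) = rho (evb (sg F i) (x1 _ vb)).
pose CF (F : {set T}) (vb : tB b) (vc : tC c) := exists z : grp (sC E) s,
  QC (tadd (fun i : idx (cmap (@homeC L Phi E) (cext b s)) =>
     text (tmap nu vb) z i : strC E (cmap (@homeC L Phi E) (cext b s) i)) vc) /\
  forall t, t \in F <-> ppsat (evb (tau t) (text (tmap nu vb) z : tup (grp (sC E)) (cext b s))).
have nu_text (vb : tB b) (e : grp (sB E) s) :
    tmap nu (text vb e : tB (cext b s)) = text (tmap nu vb) (nu e).
  by apply: fext => -[].
suff [hA hC] : (forall F, Aset (AF F)) /\ (forall F, Cset (CF F)).
  apply: AC_ext (AC_exists (fun F => AC_rect (hA F) (hC F))) _ => va vb vc.
  split=> [[F [[al [hal hrho]] [z [hz hF]]]]|[e [he1 he2]]]; last first.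
    pose F := [set t | `[< ppsat (tmap nu (evb (tau t) (text vb e : tB (cext b s)))) >]]%SET.
    have hal t : exists al, t \in F ->
        ppsat (tminus (evb (tau t) (text vb e : tB (cext b s))) (tmap io al)).
      rewrite inE; case: asboolP => [/nu_ppE[al]|_]; first by exists al.
      by exists t0.
    have [al0 hal0] := dep_choice hal.
    pose al : tup (grp (sA E)) X := fun p => al0 (projT1 p) (projT2 p).
    have alP t : t \in F -> ppsat (tminus (evb (tau t) (text vb e : tB (cext b s)))
        (tmap io (fam al t))) by exact: hal0.
    exists F; split.
      exists al; split.
        move: he1; rewrite hPA hQ0Q; congr (Q (tadd va _)); apply: fext => t.
        rewrite /w; case: ifPn => tF; first exact: rho_cls (alP t tF).
        by apply: rho_out; move: tF; rewrite inE => /asboolPn.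
      move=> i; symmetry; apply: rho_cls.
      rewrite (hom_evb (iota_hom E)) -evb_sub; move: i; apply/sgE/ThE.
      (* The sign arises because [Th] subtracts t2(y) whereas tau_t adds t2(e). *)
      exists (- e) => t tF; apply: ppsat_ext (alP t tF) => j.
      by rewrite tauE /tminus /tplus t2N opprK addrAC.
    exists (nu e); split; first by move: he2; rewrite hPC; congr (QC (tadd _ vc)); exact: nu_text.
    by move=> t; rewrite inE -nu_text -(hom_evb (nu_hom E)); split=> /asboolP.
  have [e0 he0] := nu_surj (p := E) z.
  pose vz : tup (grp (sC E)) (cext b s) := text (tmap nu vb) z.
  (* Since -z solves the congruences in C, nu(x) satisfies [Th F]; so x does after a shift by
     iota(A), which places its terms in the domain of rho. *)
  have hdom i : ppsat (tmap nu (evb (sg F i) (x1 _ vb))).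
    have : gsat (Th F) (tmap nu (x1 _ vb)).
      apply/ThE; exists (- z) => t tF; apply: ppsat_ext ((hF t).1 tF) => j.
      rewrite tauE /tminus /tplus t2N opprK; congr (_ + _).
      by rewrite /fam /tmap /x1 /evb /= (hom_ev (nu_hom E)).
    move=> /(nu_pp_ctx _ hX (ThP F))[a0 /sgE/(_ i)].
    rewrite evb_sub -(hom_evb (iota_hom E)) => h; apply/nu_ppE; by exists (evb (sg F i) a0).
  have : gsat (Th F) (tminus (x1 _ vb) (tmap io al)).
    apply/sgE => i; rewrite evb_sub -(hom_evb (iota_hom E)); apply: rho_inv => //.
  move=> /ThE[y hy].
  (* In B, -y solves the congruences prescribed by [al], while e0 only lifts z. In C both z and
     -nu(y) solve the system, so e0 + y solves the homogeneous system up to an element of iota(A).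
     Subtracting that element from e0 keeps its image z and restores the congruences. *)
  have [xi [xi_p xiE]] := xi_pp t2 F.
  have : gsat xi (tmap nu (fun _ : idx (one s) => e0 + y)).
    apply/xiE => t tF.
    have h1 := (hF t).1 tF; have h2 := nu_ppsat (hy t tF).
    apply: ppsat_ext (ppsatB h1 h2) => j.
    have -> : tmap nu (fun _ : idx (one s) => e0 + y) = (fun _ : unit => z + nu y).
      by apply: fext => u; rewrite /tmap (hom_add (nu_hom E)) he0.
    rewrite tauE t2D /tminus /tmap /tplus /fam /x1 /=.
    rewrite !(hom_sub (nu_hom E)) nu_iota subr0 /evb !(hom_ev (nu_hom E)).
    by rewrite opprB addrCA addrA [X in X - _]addrCA [X in X - _]addrC addrK addrC.
  move=> /(nu_pp_ctx _ (finctx_one s) xi_p)[a0 /xiE ha0].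
  exists (e0 - io (a0 tt)).
  have nue : nu (e0 - io (a0 tt)) = z by rewrite (hom_sub (nu_hom E)) nu_iota subr0.
  have key t : t \in F -> ppsat (tminus (evb (tau t) (text vb (e0 - io (a0 tt)) : tB (cext b s)))
      (tmap io (fam al t))).
    move=> tF; apply: ppsat_ext (ppsatD (hy t tF) (ha0 t tF)) => j.
    rewrite tauE /tminus /tmap /tplus /fam /x1 /=.
    have -> : (fun i : unit => e0 + y - io (a0 i)) = (fun _ => e0 - io (a0 tt) + y).
      by apply: fext => -[]; rewrite addrAC.
    by rewrite t2D addrACA addNr addr0 addrAC.
  split; last by rewrite hPC; move: hz; congr (QC (tadd _ vc)); rewrite -nue -nu_text.
  rewrite hPA hQ0Q; move: hal; congr (Q (tadd va _)); apply: fext => t.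
  rewrite /w; case: ifPn => tF; symmetry; first exact: rho_cls (key t tF).
  apply: rho_out; rewrite (hom_evb (nu_hom E)) nu_text nue => h.
  by move: tF; rewrite (hF t).2.
split=> F.
  pose d := cadd (cadd a (allq b)) (cmap (homeA E) X).
  pose rX (p : idx X) : term d (homeA E (X p)) := @Var LA d (inr p).
  pose gs i : set_type Phi := exist _ (g F i) (mem_set (gPhi F i)).
  pose pi h (ts : forall j : idx (pp_ar (val h)), term d (homeA E (pp_ar (val h) j))) :
    term d (quoA E h) := @App LA d (inl (inr h)) ts.
  pose rq (i : idx (cadd a (csub k))) : term d (cadd a (csub k) i) :=
    match i with
    | inl j => @Var LA d (inl (inl j))
    | inr t => if t \in F then pi (f t) (fun j => @Var LA d (inr (existT _ t j)))
        else pi (f t) (fun j => trA rX (zero_term X (pp_ar (val (f t)) j)))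
    end.
  pose lhs i := pi (gs i) (fun j => trA rX (sg F i j)).
  (* Terms of the fundamental system composed with t1 are again indices of [allq b], so the
     condition obtained is of the required form. *)
  pose rhs i : term d (quoA E (gs i)) := @Var LA d (inl (inr (existT _ (gs i)
    (fun j => @tsubst GL X b (fun p : idx X => t1 (projT1 p) (projT2 p)) _ (sg F i j))))).
  pose QA v := exists al : tup (strA E) (cmap (homeA E) X),
    Q (fun i => eval (tadd v al) (rq i)) /\
    forall i, eval (tadd v al) (lhs i) = eval (tadd v al) (rhs i).
  exists QA; split=> [|va vb].
    apply: (K_exists_fin DA (finctx_cmap _ hX)
      (P := fun x => Q (fun i => eval x (rq i)) /\ forall i, eval x (lhs i) = eval x (rhs i))).
    apply: (K_and DA); first exact: definable_subst hQ.
    by apply: (K_forall DA) => i; exact: definable_eqn.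
  have key al : Q (fun i => eval (tadd (tadd va (allrho vb)) al) (rq i)) /\
      (forall i, eval (tadd (tadd va (allrho vb)) al) (lhs i) =
        eval (tadd (tadd va (allrho vb)) al) (rhs i)) <->
      Q (tadd va (w F al)) /\
      forall i, cls _ (evb (sg F i) al) = rho (evb (sg F i) (x1 _ vb)).
    have -> : (fun i => eval (tadd (tadd va (allrho vb)) al) (rq i)) = tadd va (w F al).
      by apply: fext => -[//|t] /=; rewrite /w; case: ifP.
    have lE i : eval (tadd (tadd va (allrho vb)) al) (lhs i) =
        cls (coset_rel (sA E) (g F i)) (evb (sg F i) al).
      rewrite /lhs /pi /=; apply: (f_equal (cls (coset_rel (sA E) (g F i)))).
      by apply: fext => j; rewrite eval_trA.
    have rE i : eval (tadd (tadd va (allrho vb)) al) (rhs i) =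
        rho (E := E) (evb (sg F i) (x1 _ vb)).
      rewrite /rhs /= /allrho /=; apply: (f_equal (@rho _ E (g F i))).
      by apply: fext => j; rewrite /evb ev_tsubst.
    by split=> -[h1 h2]; split=> // i; have := h2 i; rewrite lE rE.
  by split=> -[al /key h]; exists al.
pose nb := cmap (@homeC L Phi E) b.
pose d := cext (cadd nb c) (homeC E s).
pose rc (i : idx (cadd (cmap (@homeC L Phi E) (cext b s)) c)) :
    term d (cadd (cmap (@homeC L Phi E) (cext b s)) c i) :=
  match i with
  | inl (Some j) => @Var LC d (Some (inl j))
  | inl None => @Var LC d None
  | inr j => @Var LC d (Some (inr j))
  end.
pose rx (i : idx (cext b s)) : term d (homeC E (cext b s i)) :=
  match i with Some j => @Var LC d (Some (inl j)) | None => @Var LC d None end.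
pose QC' v := exists z : strC E (homeC E s), QC (fun i => eval (text v z) (rc i)) /\
  forall t, t \in F <-> @ppsat _ (sC E) (val (f t)) (fun j => eval (text v z) (trC rx (tau t j))).
exists QC'; split=> [|vb vc].
  apply: (K_ex DC (P := fun x => QC (fun i => eval x (rc i)) /\
    forall t, t \in F <-> @ppsat _ (sC E) (val (f t)) (fun j => eval x (trC rx (tau t j))))).
  apply: (K_and DC); first exact: definable_subst hQC.
  apply: (K_finforall DC) => t.
  have hp : definable (N := strC E) (c := d)
      (fun x => @ppsat _ (sC E) (val (f t)) (fun j => eval x (trC rx (tau t j)))).
    apply: (definable_homeC (P := @ppsat _ (sC E) (val (f t)))).
    by exists (pp_fm (val (f t))).
  case: (t \in F); [apply: (K_ext DC) hp _|apply: (K_ext DC) (K_not DC hp) _] => v;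
    by split=> [|[]]; auto.
have E1 z : (fun i => eval (text (tadd (@nuv b vb) vc) z) (rc i)) =
    tadd (fun i : idx (cmap (@homeC L Phi E) (cext b s)) =>
      text (tmap nu vb) z i : strC E (cmap (@homeC L Phi E) (cext b s) i)) vc.
  by apply: fext => -[[]|].
have E2 z t : (fun j => eval (text (tadd (@nuv b vb) vc) z) (trC rx (tau t j))) =
    evb (tau t) (text (tmap nu vb) z : tup (grp (sC E)) (cext b s)).
  by apply: fext => j; rewrite eval_trC; apply: ev_ext => -[].
split=> -[z [h1 h2]]; exists z; move: h1; rewrite E1; split=> // t; rewrite h2 ?E2 //.
Qed.

Lemma AC_exB a b c s (P : tA a -> tB (cext b s) -> tC c -> Prop) :
  AC P -> AC (fun va vb vc => exists e : grp (sB E) s, P va (text vb e) vc).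
Proof.
move=> [I [PA [PC [h1 h2 h3]]]].
apply: AC_ext (AC_exists (fun i => AC_exB_rect (h1 i) (h2 i))) _ => va vb vc.
split=> [[i [e he]]|[e /h3[i hi]]]; last by exists i, e.
by exists e; apply/h3; exists i.
Qed.

(** A formula of M mixes three kinds of sorts, whereas [AC] keeps three tuples apart; each variable
    is interpreted by a term of the matching language. *)
Definition sterm a b c (s : sortM E) : Type :=
  match s with SA s => term a s | SB s => @term GL b s | SC s => term c s end.

Definition lookup a b c (va : tA a) (vb : tB b) (vc : tC c) s : sterm a b c s -> strM E s :=
  match s return sterm a b c s -> carM s with
  | SA s => fun t => eval va t
  | SB s => fun t => ev vb t
  | SC s => fun t => eval vc t
  end.

Definition ssubst a b c a' b' c' (rA : forall i : idx a, term a' (a i))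
    (rB : forall i : idx b, @term GL b' (b i)) (rC : forall i : idx c, term c' (c i))
    s : sterm a b c s -> sterm a' b' c' s :=
  match s return sterm a b c s -> sterm a' b' c' s with
  | SA s => fun t => tsubst rA t
  | SB s => fun t => @tsubst GL b b' rB _ t
  | SC s => fun t => tsubst rC t
  end.

Lemma lookup_ssubst a b c a' b' c' rA rB rC (va : tA a') (vb : tB b') (vc : tC c') s
    (t : sterm a b c s) :
  lookup va vb vc (ssubst rA rB rC t) =
  lookup (fun i => eval va (rA i)) (fun i => ev vb (rB i)) (fun i => eval vc (rC i)) t.
Proof.
by case: s t => s t; [exact: (@eval_tsubst LA (strA E))|exact: ev_tsubst|exact: (@eval_tsubst LC (strC E))].
Qed.

Definition wkA a b s (t : term a s) : term (cadd a (allq b)) s :=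
  tsubst (fun i => @Var LA (cadd a (allq b)) (inl i)) t.
Lemma eval_wkA a b s (t : term a s) (va : tA a) (z : tA (allq b)) :
  eval (tadd va z) (wkA b t) = eval va t.
Proof. by rewrite /wkA eval_tsubst; apply: eval_ext. Qed.

Definition wkC b c s (t : term c s) : term (cadd (cmap (homeC E) b) c) s :=
  tsubst (fun i => @Var LC (cadd (cmap (homeC E) b) c) (inr i)) t.
Lemma eval_wkC b c s (t : term c s) (vc : tC c) z :
  eval (tadd z vc) (wkC b t) = eval vc t.
Proof. by rewrite /wkC eval_tsubst; apply: eval_ext. Qed.

(** This covers equality, functions and relations of B as well as the graph of iota. After reduction
    to Phi, the condition that t(r) - iota(t(ra)) lies in phi(B) says that nu(t(r)) is in phi(C), a
    C-condition, and that rho(t(r)) is the class of t(ra), an A-condition. *)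
Lemma AC_pp a b c x (f : @fm GL x) (r : forall i : idx x, @term GL b (x i))
    (ra : forall i : idx x, term a (homeA E (x i))) : finctx x -> is_pp f ->
  AC (fun (va : tA a) (vb : tB b) (_ : tC c) =>
    gsat (A := sB E) f (fun i => ev vb (r i) - io (eval va (ra i) : grp (sA E) _))).
Proof.
move=> hx hf; have [n [g [t [hg ht]]]] := fundamental_ctx hPhi hx hf.
pose gs i : set_type Phi := exist _ (g i) (mem_set (hg i)).
pose tr i : bterms (g i) b := fun k => @tsubst GL x b r _ (t i k).
have key i : AC (fun (va : tA a) (vb : tB b) (_ : tC c) =>
    ppsat (tmap nu (evb (tr i) vb)) /\
    rho (evb (tr i) vb) = cls _ (evb (t i) (fun k => eval va (ra k) : grp (sA E) _))).
  apply: AC_and.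
    pose d := cadd (cmap (homeC E) b) c.
    pose rC j : term d (homeC E (b j)) := @Var LC d (inl j).
    have hp : definable (N := strC E) (c := d)
        (fun v => @ppsat _ (sC E) (g i) (fun j => eval v (trC rC (tr i j)))).
      apply: (definable_homeC (P := @ppsat _ (sC E) (g i))).
      by exists (pp_fm (g i)).
    apply: AC_ext (AC_C a hp) _ => va vb vc.
    suff -> : (fun j => eval (tadd (nuv vb) vc) (trC rC (tr i j))) = tmap nu (evb (tr i) vb).
      by [].
    by apply: fext => j; rewrite eval_trC /tmap /evb (hom_ev (nu_hom E)).
  pose d := cadd a (allq b).
  pose t1 : term d (quoA E (gs i)) := @Var LA d (inr (existT _ (gs i) (tr i))).
  pose t2 : term d (quoA E (gs i)) := @App LA d (inl (inr (gs i)))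
    (fun j => @trA L Phi E d x (fun k => wkA b (ra k)) _ (t i j)).
  apply: AC_ext (AC_A c (definable_eqn _ t1 t2)) _ => va vb vc.
  suff -> : eval (tadd va (allrho vb)) t2 =
    cls (coset_rel (sA E) (g i)) (evb (t i) (fun k => eval va (ra k) : grp (sA E) _)) by [].
  apply: (f_equal (cls (coset_rel (sA E) (g i)))); apply: fext => j.
  transitivity (@ev L (sA E) x (fun k => eval (tadd va (allrho vb)) (wkA b (ra k))) _ (t i j)).
    exact: eval_trA.
  by apply: ev_ext => k; rewrite eval_wkA.
apply: AC_ext (AC_forall key) _ => va vb vc; rewrite ht.
have shift i : evb (t i) (fun i => ev vb (r i) - io (eval va (ra i) : grp (sA E) _)) =
    tminus (evb (tr i) vb) (tmap io (evb (t i) (fun k => eval va (ra k) : grp (sA E) _))).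
  have -> : evb (tr i) vb = evb (t i) (fun k => ev vb (r k)).
    by apply: fext => k; rewrite /evb ev_tsubst.
  by rewrite (hom_evb (iota_hom E)) -evb_sub.
split=> h i; have := h i; rewrite shift.
  by case=> h1 h2; exact: rho_inv.
move=> h1; split; last exact: rho_cls.
by apply/nu_ppE; eexists; exact: h1.
Qed.

Lemma AC_ppB a b c x (f : @fm GL x) (r : forall i : idx x, @term GL b (x i)) :
  finctx x -> is_pp f ->
  AC (fun (_ : tA a) (vb : tB b) (_ : tC c) => gsat (A := sB E) f (fun i => ev vb (r i))).
Proof.
move=> hx hf; pose ra (i : idx x) : term a (homeA E (x i)) :=
  @App LA a (inl (inl (inl (Gzero (x i))))) (fun i : 'I_0 => match notF (ltn_ord i) with end).
apply: AC_ext (AC_pp c r ra hx hf) _ => va vb vc.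
suff -> : (fun i => ev vb (r i) - io (eval va (ra i) : grp (sA E) _)) = (fun i => ev vb (r i)).
  by [].
apply: fext => i; rewrite /ra /=.
by rewrite -[X in io X](subrr (0 : grp (sA E) (x i))) (hom_sub (iota_hom E)) subrr subr0.
Qed.

Theorem AC_sat (d : ctx (lsort (langM E))) (f : fm d) a b c (m : forall i : idx d, sterm a b c (d i)) :
  AC (fun va vb vc => sat (N := strM E) f (fun i => lookup va vb vc (m i))).
Proof.
pose K d (P : tup (strM E) d -> Prop) := forall a b c (m : forall i : idx d, sterm a b c (d i)),
  AC (fun va vb vc => P (fun i => lookup va vb vc (m i))).
suff : K d (sat f) by apply.
apply: K_sat => {a b c m d f}; split.
- by move=> d P Q hP hPQ a b c m; apply: AC_ext (hP _ _ _ m) _ => va vb vc; exact: hPQ.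
- by move=> d a b c m; exact: AC_top.
- by move=> d P Q hP hQ a b c m; apply: AC_and.
- by move=> d P hP a b c m; apply: AC_not.
- move=> d d' r P hP a b c m.
  pose rv s (x : var d' s) : sterm a b c s := match x in var _ s return sterm a b c s with V i => m i end.
  apply: AC_ext (hP _ _ _ (fun i => rv _ (r i))) _ => va vb vc.
  suff -> : (fun i => lookup va vb vc (rv _ (r i))) =
    (fun i => look (fun k => lookup va vb vc (m k)) (r i)) by [].
  by apply: fext => i; case: _ / (r i).
- move=> d s P hP a b c m; case: s P hP => s P hP.
  + pose a' := cext a s.
    pose m' (i : idx (cext d (SA s : lsort (langM E)))) : sterm a' b c (cext d (SA s) i) :=
      match i with
      | Some j => ssubst (fun k => @Var LA a' (Some k)) (@Var GL b) (@Var LC c) (m j)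
      | None => @Var LA a' None
      end.
    apply: AC_ext (AC_exA (hP _ _ _ m')) _ => va vb vc.
    suff key e : (fun i => lookup (text va e) vb vc (m' i)) =
        text (fun i => lookup va vb vc (m i)) (e : strM E (SA s)).
      by split=> -[e he]; exists e; move: he; rewrite key.
    by apply: fext => -[j|//]; exact: lookup_ssubst.
  + pose b' := cext b s.
    pose m' (i : idx (cext d (SB E s : lsort (langM E)))) : sterm a b' c (cext d (SB E s) i) :=
      match i with
      | Some j => ssubst (@Var LA a) (fun k => @Var GL b' (Some k)) (@Var LC c) (m j)
      | None => @Var GL b' None
      end.
    apply: AC_ext (AC_exB (hP _ _ _ m')) _ => va vb vc.
    suff key e : (fun i => lookup va (text vb e) vc (m' i)) =
        text (fun i => lookup va vb vc (m i)) (e : strM E (SB E s)).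
      by split=> -[e he]; exists e; move: he; rewrite key.
    by apply: fext => -[j|//]; exact: lookup_ssubst.
  + pose c' := cext c s.
    pose m' (i : idx (cext d (SC s : lsort (langM E)))) : sterm a b c' (cext d (SC s) i) :=
      match i with
      | Some j => ssubst (@Var LA a) (@Var GL b) (fun k => @Var LC c' (Some k)) (m j)
      | None => @Var LC c' None
      end.
    apply: AC_ext (AC_exC (hP _ _ _ m')) _ => va vb vc.
    suff key e : (fun i => lookup va vb (text vc e) (m' i)) =
        text (fun i => lookup va vb vc (m i)) (e : strM E (SC s)).
      by split=> -[e he]; exists e; move: he; rewrite key.
    by apply: fext => -[j|//]; exact: lookup_ssubst.
- move=> s a b c m; case: s m => s m.
  + apply: AC_ext (AC_A c (definable_eqn _ (wkA b (m (inl tt))) (wkA b (m (inr tt))))) _.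
    by move=> va vb vc; rewrite !eval_wkA.
  + pose x := cadd (one s) (one s).
    have hx : finctx x by apply: finctx_cadd; exact: finctx_one.
    pose r (i : idx x) : @term GL b (x i) :=
      match i with inl _ => m (inl tt) | inr _ => m (inr tt) end.
    have := @AC_ppB a b c x (@Eqn GL x s (@Var GL x (inl tt)) (@Var GL x (inr tt))) r hx erefl.
    by move=> h; apply: AC_ext h _.
  + apply: AC_ext (AC_C a (definable_eqn _ (wkC b (m (inl tt))) (wkC b (m (inr tt))))) _.
    by move=> va vb vc; rewrite !eval_wkC.
- move=> f a b c m; case: f m => [g|g|g|s|s|g] m.
  + pose t1 := @App LA (cadd a (allq b)) g (fun i => wkA b (m (inl i))).
    apply: AC_ext (AC_A c (definable_eqn _ t1 (wkA b (m (inr tt))))) _ => va vb vc.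
    rewrite eval_wkA /t1 /=.
    suff -> : (fun i => eval (tadd va (allrho vb)) (wkA b (m (inl i)))) =
      (fun i => eval va (m (inl i))) by [].
    by apply: fext => i; rewrite eval_wkA.
  + pose x : ctx (lsort L) := cadd (fdom (g : fsym GL)) (one (fcod (g : fsym GL))).
    have hx : finctx x by apply: finctx_cadd; [exact: finctx_arity|exact: finctx_one].
    pose r (i : idx x) : @term GL b (x i) :=
      match i with inl i => m (inl i) | inr i => m (inr i) end.
    have := @AC_ppB a b c x (@Eqn GL x _ (@App GL x g (fun i => @Var GL x (inl i)))
      (@Var GL x (inr tt))) r hx erefl.
    by move=> h; apply: AC_ext h _.
  + pose t1 := @App LC (cadd (cmap (homeC E) b) c) g (fun i => wkC b (m (inl i))).
    apply: AC_ext (AC_C a (definable_eqn _ t1 (wkC b (m (inr tt))))) _ => va vb vc.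
    rewrite eval_wkC /t1 /=.
    suff -> : (fun i => eval (tadd (nuv vb) vc) (wkC b (m (inl i)))) =
      (fun i => eval vc (m (inl i))) by [].
    by apply: fext => i; rewrite eval_wkC.
  + pose x : ctx (lsort L) := one s.
    have := @AC_pp a b c x (@Eqn GL x s (@Var GL x tt) (zero_term x s)) (fun _ => m (inr tt))
      (fun _ => m (inl ord0)) (finctx_one s) erefl.
    move=> h; apply: AC_ext h _ => va vb vc.
    rewrite /gsat /=.
    by split=> [/eqP|<-]; [rewrite subr_eq0 => /eqP|rewrite subrr].
  + pose d := cadd (cmap (homeC E) b) c.
    pose rC j : term d (homeC E (b j)) := @Var LC d (inl j).
    apply: AC_ext (AC_C a (definable_eqn _ (trC rC (m (inl ord0))) (wkC b (m (inr tt))))) _.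
    by move=> va vb vc; rewrite eval_wkC eval_trC /= (hom_ev (nu_hom E)).
  + pose t1 : term (cadd a (allq b)) (quoA E g) :=
      @Var LA (cadd a (allq b)) (inr (existT _ g (fun i => m (inl i)))).
    apply: AC_ext (AC_A c (definable_eqn _ t1 (wkA b (m (inr tt))))) _ => va vb vc.
    by rewrite eval_wkA.
- move=> q a b c m; case: q m => q m.
  + have hq := definable_sat (strA E) (@Rel LA (cadd a (allq b)) q (fun i => wkA b (m i))).
    apply: AC_ext (AC_A c hq) _ => va vb vc /=.
    suff -> : (fun i => eval (tadd va (allrho vb)) (wkA b (m i))) = (fun i => eval va (m i)) by [].
    by apply: fext => i; rewrite eval_wkA.
  + pose x : ctx (lsort L) := rdom (q : rsym GL).
    pose r (i : idx x) : @term GL b (x i) := m i.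
    have := @AC_ppB a b c x (@Rel GL x q (fun i => @Var GL x i)) r (finctx_arity _) erefl.
    by move=> h; apply: AC_ext h _.
  + have hq := definable_sat (strC E) (@Rel LC (cadd (cmap (homeC E) b) c) q (fun i => wkC b (m i))).
    apply: AC_ext (AC_C a hq) _ => va vb vc /=.
    suff -> : (fun i => eval (tadd (nuv vb) vc) (wkC b (m i))) = (fun i => eval vc (m i)) by [].
    by apply: fext => i; rewrite eval_wkC.
Qed.

End Elimination.

(** * Parameters, imaginaries and saturation *)

Lemma cls_surj (T : Type) (R : T -> T -> Prop) (X : quotient R) : exists x, cls R x = X.
Proof. by case: X => X [x E]; exists x; apply: eq_exist. Qed.

Section DefinableOver.
Variables (L : lang) (N : structure L).
Implicit Types (D : set (elt N)) (c d y : ctx (lsort L)).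

Definition kctx T (k : T -> elt N) : ctx (lsort L) := Ctx (fun t => projT1 (k t)).
Definition ktup T (k : T -> elt N) : tup N (kctx k) := fun t => projT2 (k t).
Arguments ktup {T} k _.

Lemma ktupP D T (k : T -> elt N) : (forall t, D (k t)) ->
  forall t, D (existT _ (kctx k t) (ktup k t)).
Proof. by move=> h t; move: (h t); rewrite /ktup /=; case: (k t). Qed.

Definition inpar D e (he : D e) : idx (cpar D) := exist (fun x => x \in D) e (mem_set he).

Definition definable_over D c (P : tup N c -> Prop) : Prop :=
  exists f : formula_over D c, forall v, holds f v <-> P v.

Lemma definable_overE D c P : definable_over D P <->
  exists Q, definable (N := N) (c := cadd c (cpar D)) Q /\
    forall v, P v <-> Q (tadd v (tpar (D := D))).
Proof.
split=> [[f hf]|[Q [[f hf] hQ]]]; last by exists f => v; rewrite hQ -hf.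
by exists (sat f); split=> [|v]; [exact: definable_sat|rewrite -hf].
Qed.

Lemma definable_over_closed D : closed_class (@definable_over D).
Proof.
have DN := definable_closed N.
split.
- by move=> c P Q [f h] hPQ; exists f => v; rewrite h.
- by move=> c; exists (Top _).
- by move=> c P Q [f h] [g k]; exists (And f g) => v; rewrite -h -k.
- by move=> c P [f h]; exists (Not f) => v; rewrite -h.
- move=> c d r P /definable_overE[Q [hQ hP]]; apply/definable_overE.
  pose r' (i : idx (cadd c (cpar D))) : var (cadd d (cpar D)) (cadd c (cpar D) i) :=
    match i with
    | inl j => match r j in var _ s return var (cadd d (cpar D)) s with
               | V k => V (inl k : idx (cadd d (cpar D))) end
    | inr k => V (inr k : idx (cadd d (cpar D)))
    end.
  exists (fun v => Q (fun i => look v (r' i))); split=> [|v]; first exact: (K_ren DN).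
  rewrite hP; suff -> : (fun i => look (tadd v (tpar (D := D))) (r' i)) =
    tadd (fun i => look v (r i)) (tpar (D := D)) by [].
  by apply: fext => -[i|//] /=; case: _ / (r i).
- move=> c s P /definable_overE[Q [hQ hP]]; apply/definable_overE.
  pose e := cext (cadd c (cpar D)) s.
  pose r' (i : idx (cadd (cext c s) (cpar D))) : var e (cadd (cext c s) (cpar D) i) :=
    match i with
    | inl (Some j) => V (Some (inl j) : idx e)
    | inl None => V (None : idx e)
    | inr k => V (Some (inr k) : idx e)
    end.
  exists (fun v => exists x, Q (fun i => look (text v x) (r' i))).
  split=> [|v]; first exact: (K_ex DN) (K_ren DN r' hQ).
  have key x : (fun i => look (text (tadd v (tpar (D := D))) x) (r' i)) =
    tadd (text v x) (tpar (D := D)) by apply: fext => -[[]|].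
  by split=> -[x hx]; exists x; move: hx; rewrite hP key.
Qed.

Lemma definable_overW D c P : definable (N := N) (c := c) P -> definable_over D P.
Proof.
move=> hP; apply/definable_overE; exists (fun v => P (fun i => v (inl i))); split=> //.
exact: (K_ren (definable_closed N) (fun i => V (inl i : idx (cadd c (cpar D)))) hP).
Qed.

Lemma definable_over_param D c y (z : tup N y) P : definable_over D (c := cadd c y) P ->
  (forall i, D (existT _ (y i) (z i))) -> definable_over D (c := c) (fun v => P (tadd v z)).
Proof.
move=> /definable_overE[Q [hQ hP]] hz; apply/definable_overE.
pose d := cadd c (cpar D).
pose r (i : idx (cadd (cadd c y) (cpar D))) : var d (cadd (cadd c y) (cpar D) i) :=
  match i as i return var d (cadd (cadd c y) (cpar D) i) with
  | inl (inl j) => V (inl j : idx d)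
  | inl (inr j) => V (inr (inpar (hz j)) : idx d)
  | inr k => V (inr k : idx d)
  end.
exists (fun v => Q (fun i => look v (r i))); split=> [|v].
  exact: (K_ren (definable_closed N)).
rewrite hP; suff -> : (fun i => look (tadd v (tpar (D := D))) (r i)) =
  tadd (tadd v z) (tpar (D := D)) by [].
by apply: fext => -[[]|].
Qed.

Lemma definable_over_sub D D' c P : D `<=` D' -> definable_over D P ->
  definable_over D' (c := c) P.
Proof.
move=> hD /definable_overE[Q [hQ hP]].
have h := definable_over_param (definable_overW D' hQ) (z := tpar (D := D)).
apply: (K_ext (definable_over_closed D')) (h _) _ => [i|v]; last by rewrite hP.
by apply: hD; case: i => e he /=; move: (set_mem he); rewrite /tpar /=; case: e {he}.
Qed.

Lemma definable_over_sat D c (f : formula_over D c) : definable_over D (fun v => holds f v).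
Proof. by exists f. Qed.

Lemma definable_over_support D c (P : tup N c -> Prop) : definable_over D P ->
  exists (T : finType) (k : T -> elt N) (Q : tup N (cadd c (kctx k)) -> Prop),
  [/\ definable Q, forall t, D (k t) &
      forall v : tup N c, P v <-> Q (tadd v (ktup k))].
Proof.
move=> /definable_overE[Q [hQ hP]]; have [T [k [Q' [hQ' hQQ']]]] := definable_support hQ.
exists T, (fun t => val (k t)), Q'; split=> // [t|v]; last by rewrite hP hQQ'.
exact: set_mem (valP (k t)).
Qed.

Lemma dcl_sub D D' : D `<=` D' -> dcl D `<=` dcl D'.
Proof.
move=> h e [f hf]; have [g hg] := definable_over_sub h (definable_over_sat f).
by exists g => y; rewrite hg.
Qed.

End DefinableOver.
Arguments ktup {L N T} k _.

Section Imaginaries.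
Variables (L : lang) (N : structure L).
Local Notation ML := (expand (eq_lext N)).
Local Notation M := (meq N).

Definition rep (s : lsort ML) : ctx (lsort L) :=
  match s with inl s => one s | inr e => eq_ar e end.
Definition prj (s : lsort ML) : tup N (rep s) -> M s :=
  match s with inl s => fun x => x tt | inr e => fun x => cls (@eq_rel L N e) x end.

Lemma finctx_rep s : finctx (rep s).
Proof. by case: s => s; [exact: finctx_one|exact: finctx_arity]. Qed.

Lemma prj_surj s (y : M s) : exists x, prj x = y.
Proof. by case: s y => [s y|e y]; [exists (fun=> y)|exact: cls_surj]. Qed.

Lemma definable_prj_eq s d (m1 m2 : forall k, term d (rep s k)) :
  definable (N := N) (c := d)
    (fun v => prj (s := s) (fun k => eval v (m1 k)) = prj (fun k => eval v (m2 k))).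
Proof.
case: s m1 m2 => [s|e] m1 m2; first exact: definable_eqn.
have [f hf] := eq_def e.
pose r (i : idx (cadd (eq_ar e) (eq_ar e))) : term d (cadd (eq_ar e) (eq_ar e) i) :=
  match i with inl k => m1 k | inr k => m2 k end.
apply: (K_ext (definable_closed N)) (definable_subst r (definable_sat N f)) _ => v /=.
rewrite quotient_eq; last exact: eq_equiv.
rewrite -hf; suff -> : (fun i => eval v (r i)) =
  tadd (fun k => eval v (m1 k)) (fun k => eval v (m2 k)) by [].
by apply: fext => -[].
Qed.

(* Every formula of [M^eq] is one of [M] in representatives of its variables. *)
Lemma definable_prj (c : ctx (lsort ML)) (P : tup M c -> Prop) : definable P ->
  forall d (m : forall i k, term d (rep (c i) k)),
  definable (N := N) (c := d) (fun v => P (fun i => prj (fun k => eval v (m i k)))).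
Proof.
have DN := definable_closed N.
move=> [f hf].
pose K (c : ctx (lsort ML)) (P : tup M c -> Prop) :=
  forall d (m : forall i k, term d (rep (c i) k)),
  definable (N := N) (c := d) (fun v => P (fun i => prj (fun k => eval v (m i k)))).
suff : K c (sat f).
  by move=> h0 d r; apply: (K_ext DN) (h0 d r) _ => v; exact: hf.
apply: K_sat => {c P f hf}; split.
- by move=> b Q R hQ hQR d r; apply: (K_ext DN) (hQ d r) _ => v; exact: hQR.
- by move=> b d r; exact: (K_top DN).
- by move=> b Q R hQ hR d r; apply: (K_and DN).
- by move=> b Q hQ d r; apply: (K_not DN).
- move=> b b' r Q hQ d m.
  have h1 (i : idx b) : {m' : forall k, term d (rep (b i) k) | forall v : tup N d,
      prj (fun k => eval v (m' k)) =
      look ((fun j => prj (fun k => eval v (m j k))) : tup M b') (r i)}.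
    by case: _ / (r i) => j; exists (m j).
  apply: (K_ext DN) (hQ d (fun i => projT1 (h1 i))) _ => v.
  suff -> : (fun i => prj (fun k => eval v (projT1 (h1 i) k))) =
    (fun i => look ((fun j => prj (fun k => eval v (m j k))) : tup M b') (r i)) by [].
  by apply: fext => i; exact: (projT2 (h1 i)).
- move=> b s Q hQ d m; pose d' := cadd d (rep s).
  pose m' (i : idx (cext b s)) : forall k, term d' (rep (cext b s i) k) :=
    match i with
    | Some j => fun k => tsubst (fun l => @Var L d' (inl l)) (m j k)
    | None => fun k => @Var L d' (inr k)
    end.
  apply: (K_ext DN) (K_exists_fin DN (finctx_rep s) (hQ d' m')) _ => v.
  have key (z : tup N (rep s)) : (fun i => prj (fun k => eval (tadd v z) (m' i k))) =
      text (fun i => prj (fun k => eval v (m i k))) (prj z).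
    apply: fext => -[j|//] /=; apply: (f_equal (@prj _)); apply: fext => k.
    by rewrite eval_tsubst.
  split=> [[z]|[e]]; first by rewrite key; exists (prj z).
  by have [z <-] := prj_surj e; rewrite -key; exists z.
- by move=> s d m; exact: (definable_prj_eq (m (inl tt)) (m (inr tt))).
- move=> [g|e] d m.
    exact: (definable_eqn N (@App L d g (fun i => m (inl i) tt)) (m (inr tt) tt)).
  exact: (definable_prj_eq (s := inr e) (fun i => m (inl i) tt) (m (inr tt))).
- by move=> [q|[]] d m; exists (@Rel L d q (fun i => m i tt)).
Qed.

Lemma definable_inl c (P : tup N c -> Prop) : definable P ->
  definable (N := M) (c := cmap inl c) P.
Proof.
move=> hP; have := @definable_interp _ _ N M inl (fun s x => x) (fun s x y e => e)
  (fun s y => ex_intro _ y erefl) _ _ c P hP (cmap inl c) (fun i => @Var ML (cmap inl c) i).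
apply.
- move=> f; pose d : ctx (lsort ML) := cadd (cmap inl (fdom f)) (one (inl (fcod f))).
  exact: (definable_eqn M (@App ML d (inl f) (fun i => @Var ML d (inl i)))
    (@Var ML d (inr tt))).
- move=> q; pose d : ctx (lsort ML) := cmap inl (rdom q).
  by exists (@Rel ML d (inl q) (fun i => @Var ML d i)).
Qed.

Definition real_elt (e : elt N) : elt M := existT M (inl (projT1 e)) (projT2 e).

(** Each of the finitely many parameters of P is pinned down by a formula over real elements.
    Quantifying it existentially leaves only real parameters, and [definable_prj] then removes the
    imaginary sorts. *)
Lemma real_definable (D : set (elt M)) (R : set (elt N)) c (P : tup N c -> Prop) :
  D `<=` dcl (real_elt @` R) ->
  definable_over D (c := cmap inl c) P -> definable_over R P.
Proof.
move=> hD /definable_over_support[T [k [Q [hQ hk hP]]]].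
pose R' := real_elt @` R; have DR := definable_over_closed R'.
have [f hf] : exists f : forall t, formula_over R' (one (projT1 (k t))),
    forall t (y : M (projT1 (k t))), holds (f t) (fun _ => y) <-> y = projT2 (k t).
  have h t : exists f : formula_over R' (one (projT1 (k t))),
    forall y : M (projT1 (k t)), holds f (fun _ => y) <-> y = projT2 (k t) := hD _ (hk t).
  exact: dep_choice h.
pose Y : ctx (lsort ML) := kctx k.
have hY : finctx Y by exists T, id, id.
have : definable_over R' (c := cmap inl c) P.
  have hd : definable_over R' (c := cadd (cmap inl c) Y)
      (fun v => (forall t, holds (f t) (fun _ => v (inr t))) /\ Q v).
    apply: (K_and DR); last exact: definable_overW.
    apply: (K_finforall DR) => t.
    exact: (K_ren DR (fun _ : idx (one (Y t)) => V (inr t : idx (cadd (cmap inl c) Y)))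
      (definable_over_sat (f t))).
  apply: (K_ext DR) (K_exists_fin DR hY hd) _ => v; rewrite hP.
  split=> [[z [hz hq]]|hq].
    by have <- : z = ktup k by apply: fext => t; apply/hf; exact: hz.
  by exists (ktup k); split=> // t; apply/hf.
move=> /definable_overE[Q' [hQ' hPQ']]; apply/definable_overE.
pose d := cadd c (cpar R).
have h1 (e : set_type R') : {m : forall k, term d (rep (projT1 (val e)) k) |
    forall v, prj (fun k => eval (tadd v (tpar (D := R))) (m k)) = projT2 (val e)}.
  case: e => e he /=; have /cid2[e0 h0 E] := set_mem he.
  case: _ / E; exists (fun _ : unit => @Var L d (inr (inpar h0))) => v /=.
  by [].
pose m (i : idx (cadd (cmap inl c) (cpar R'))) :
    forall k, term d (rep (cadd (cmap inl c) (cpar R') i) k) :=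
  match i with
  | inl j => fun _ : unit => @Var L d (inl j)
  | inr e => projT1 (h1 e)
  end.
exists (fun v => Q' (fun i => prj (fun k => eval v (m i k)))); split=> [|v].
  exact: definable_prj.
rewrite hPQ'; suff -> : (fun i => prj (fun k => eval (tadd v (tpar (D := R))) (m i k))) =
  tadd (v : tup M (cmap inl c)) (tpar (D := R')) by [].
apply: fext => -[//|e] /=; exact: (projT2 (h1 e)).
Qed.

End Imaginaries.

Section Saturation.
Local Open Scope card_scope.
Variables (L : lang) (N : structure L).
Local Notation M := (meq N).

Lemma real_elt_inj : injective (@real_elt L N).
Proof.
move=> [s x] [s' x'] E.
have /= := congr1 (fun e : elt M => match e return option (elt N) with
  | existT (inl s) x => Some (existT N s x)
  | existT (inr _) _ => None end) E.
by case=> E'; move: E'.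
Qed.

Variable Delta : set (elt M).
Hypotheses (hDelta : Delta = dcl Delta) (hsat : saturated_succ N Delta).

Definition real_part : set (elt N) := [set e | Delta (real_elt e)].

(* [Delta] is infinite: it contains, for every [n], the only class of the trivial
   relation on [n]-tuples.  So a countable set can be added to its real part. *)
Lemma card_real_part (s0 : lsort L) (x0 : N s0) (K : set (elt N)) : countable K ->
  real_part `|` K #<= Delta.
Proof.
move=> /countable_injP[code hcode].
have triv_def n : exists f : fm (cadd (Arity (fun _ : 'I_n => s0)) (Arity (fun _ : 'I_n => s0))),
    forall x y : tup N (Arity (fun _ : 'I_n => s0)), sat f (tadd x y) <-> True.
  by exists (Top _).
pose triv n : eqsort N := @EqSort _ N (Arity (fun _ : 'I_n => s0)) (fun _ _ => True)
  (And3 (fun _ => I) (fun _ _ _ => I) (fun _ _ _ _ _ => I)) (triv_def n).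
pose im n : elt M := existT M (inr (triv n)) (cls (@eq_rel _ _ (triv n)) (fun _ => x0)).
have imD n : Delta (im n).
  rewrite hDelta; exists (Top _) => y /=; split=> // _.
  by have [x <-] := cls_surj y; apply/quotient_eq; first exact: (eq_equiv (triv n)).
have im_inj : injective im.
  move=> n m /(congr1 (fun e : elt M => match projT1 e with
    inr q => alen (eq_ar q) | _ => 0%N end)).
  by [].
(* Elements of the real part stay real and the others become classes of trivial relations, so the
   two kinds cannot collide. *)
pose g e := if pselect (real_part e) then real_elt e else im (code e).
have [f] : $|{injfun (real_part `|` K) >-> Delta}|.
  apply/injfunPex; exists g.
    by move=> e _; rewrite /g; case: pselect => h; [exact: h|exact: imD].
  move=> e e' he he'; rewrite /g; case: pselect => h; case: pselect => h'.
  - exact: real_elt_inj.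
  - by move/(congr1 (fun e : elt M => match projT1 e with inl _ => true | _ => false end)).
  - by move/(congr1 (fun e : elt M => match projT1 e with inl _ => true | _ => false end)).
  move=> /im_inj; apply: hcode; rewrite inE.
    by move: he; rewrite inE => -[].
  by move: he'; rewrite inE => -[].
exact: inj_card_le f.
Qed.

(** The extra set [K] lets recursive constructions use elements found earlier, which need not belong
    to [Delta]. *)
Lemma saturation (K : set (elt N)) (y : ctx (lsort L)) (p : set (tup N y -> Prop)) :
  countable K -> finctx y ->
  (forall P, p P -> definable_over (real_part `|` K) P) ->
  (forall n (P : 'I_n -> tup N y -> Prop), (forall i, p (P i)) -> exists v, forall i, P i v) ->
  exists v, forall P, p P -> P v.
Proof.
move=> hK [T [e [e' [_ he]]]] hp hfs.
(* [v0] supplies the element from which [card_real_part] builds its classes; a context without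
   variables has none, and is settled directly. *)
have [v0 _] := hfs 0%N (fun _ _ => True) (fun i : 'I_0 => match notF (ltn_ord i) with end).
case: (pselect (exists i : idx y, True)) => [[i0 _]|hno]; last first.
  exists v0 => P hP; have [v hv] := hfs 1%N (fun=> P) (fun=> hP).
  have -> : v0 = v by apply: fext => i; case: hno; exists i.
  exact: (hv ord0).
set D := real_part `|` K in hp.
have hD : D #<= Delta by exact: card_real_part (v0 i0) _ hK.
pose x : arity (lsort L) := Arity (fun k : 'I_#|T| => y (e (enum_val k))).
have E (i : idx y) : e (enum_val (enum_rank (e' i))) = i by rewrite enum_rankK he.
pose r (i : idx y) : var x (y i) := ecast i (var x (y i)) (E i) (V (enum_rank (e' i) : idx x)).
pose dec (v : tup N x) : tup N y := fun i => look v (r i).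
pose enc (v : tup N y) : tup N x := fun k => v (e (enum_val k)).
have encK v : dec (enc v) = v.
  by apply: fext => i; rewrite /dec /r look_ecast; exact: tup_ecast.
pose q : set (formula_over D x) :=
  [set f | exists2 P, p P & forall v, holds f v <-> P (dec v)].
have hq P : p P -> exists2 f, q f & forall v, holds f v <-> P (dec v).
  move=> hP; have [f hf] := K_ren (definable_over_closed D) r (hp P hP).
  by exists f => //; exists P.
have [|v hv] := hsat hD (p := q).
  move=> n f hf.
  have [P hP hfP] := dep_choice2 hf; have [v hv] := hfs n P hP.
  by exists (enc v) => i; apply/hfP; rewrite encK; exact: hv.
exists (dec v) => P hP; have [f qf hf] := hq P hP.
by apply/hf; exact: hv.
Qed.

End Saturation.

(** * Iterated powers of an ultrafilter and indiscernible sequences *)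

Section IteratedUltrafilter.
Variables (I X : Type) (U : set_system I) (e : I -> X).
Context {FU : UltraFilter U}.
Implicit Types (P Q : seq X -> Prop).

(* [P] holds at [(e i_1, ..., e i_n)] for [U]-almost all [i_1], ..., for
   [U]-almost all [i_n]. *)
Fixpoint ualmost n P : Prop :=
  match n with
  | 0 => P [::]
  | n.+1 => U [set i | ualmost n (fun l => P (e i :: l))]
  end.

Let US (A B : set I) : (forall i, A i -> B i) -> U A -> U B.
Proof. exact: filterS. Qed.
Let UI (A B : set I) : U A -> U B -> U [set i | A i /\ B i].
Proof. exact: filterI. Qed.
Let UT : U setT.
Proof. exact: filterT. Qed.
Let U0 : ~ U set0.
Proof. exact: filter_not_empty. Qed.

Lemma ualmost_mono n P Q : (forall l, size l = n -> P l -> Q l) -> ualmost n P -> ualmost n Q.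
Proof.
elim: n P Q => [|n IHn] P Q h; first exact: h.
by apply: US => i; apply: IHn => l hl; apply: h => /=; rewrite hl.
Qed.

Lemma ualmost_and n P Q : ualmost n P -> ualmost n Q -> ualmost n (fun l => P l /\ Q l).
Proof.
elim: n P Q => [//|n IHn] P Q hP hQ.
by apply: US (UI hP hQ) => i [h1 h2]; exact: IHn.
Qed.

Lemma ualmost_true n P : (forall l, size l = n -> P l) -> ualmost n P.
Proof.
elim: n P => [|n IHn] P h; first exact: h.
by move: UT; apply: US => i _; apply: IHn => l hl; apply: h; rewrite /= hl.
Qed.

Lemma ualmost_forall n m (P : 'I_m -> seq X -> Prop) :
  (forall j, ualmost n (P j)) -> ualmost n (fun l => forall j, P j l).
Proof.
elim: m P => [|m IHm] P h; first by apply: ualmost_true => l _ [].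
have := ualmost_and (h ord0) (IHm (fun j => P (lift ord0 j)) (fun j => h _)).
apply: ualmost_mono => l _ [h0 hS] j.
by case: (unliftP ord0 j) => [i ->|->].
Qed.

Lemma ualmost_not n P : ualmost n (fun l => ~ P l) <-> ~ ualmost n P.
Proof.
elim: n P => [//|n IHn] P /=; split=> [h1 h2|h].
  apply: U0; apply: US (UI h1 h2) => i [].
  by rewrite /= IHn.
have [//|] := in_ultra_setVsetC [set i | ualmost n (fun l => P (e i :: l))] FU.
by apply: US => i; rewrite /= IHn.
Qed.

Lemma ualmost_exists n P : ualmost n P -> exists2 l, size l = n & P l.
Proof.
move=> h; apply: contrapT => hno.
have /ualmost_not : ualmost n (fun l => ~ P l); last by [].
by apply: ualmost_true => l hl hP; apply: hno; exists l.
Qed.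

Lemma ualmost_mask (m : bitseq) P :
  ualmost (size m) (fun l => P (mask m l)) <-> ualmost (count id m) P.
Proof.
elim: m P => [//|[] m IHm] P /=.
  by split; apply: US => i /=; rewrite (IHm (fun l => P (e i :: l))).
rewrite -IHm; split=> [h|h]; last by move: UT; apply: US.
apply: contrapT => /= hn; apply: U0; move: h; apply: US => i /= hi.
exact: hn hi.
Qed.

(** The last quantifier, over almost all indices, is weakened to mere existence; this provides the
    next element of a realizing sequence. *)
Lemma ualmost_rcons n P : ualmost n.+1 P -> ualmost n (fun l => exists z, P (rcons l z)).
Proof.
elim: n P => [|n IHn] P h.
  by have [[|z []] // _ hz] := ualmost_exists h; exists z.
by move: h; apply: US => i hi; exact: (IHn (fun l => P (e i :: l)) hi).
Qed.

End IteratedUltrafilter.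

(** Since U contains the cofinite sets, each index can be taken beyond the previous one. *)
Lemma ualmost_increasing X (U : set_system nat) (FU : UltraFilter U) (e : nat -> X) n P :
  \oo `<=` U -> (forall l, size l = n -> sorted ltn l -> P [seq e i | i <- l]) ->
  ualmost U e n P.
Proof.
move=> hU; case: n => [|n] h; first exact: (h [::]).
have aux k m Q : (forall l, size l = k -> path ltn m l -> Q [seq e i | i <- l]) ->
    ualmost U e k Q.
  elim: k m Q => [|k IHk] m Q hQ; first exact: (hQ [::]).
  apply: (@filterS _ U _ [set i | (m < i)%N]) => [i mi|].
    by apply: (IHk i) => l hl hp; apply: (hQ (i :: l)); rewrite /= ?hl // mi.
  by apply: hU; exists m.+1.
apply: (@filterS _ U _ setT _ _ filterT) => i _; apply: (aux n i) => l hl hp.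
by apply: (h (i :: l)); rewrite /= ?hl.
Qed.

(** An increasing choice of indices becomes a mask on an initial segment, the form required by
    [ualmost_mask]. *)
Lemma mask_increasing n (k : 'I_n -> nat) N0 : {homo k : i j / (i < j)%N} ->
  (forall i, k i < N0)%N -> exists m : bitseq, [/\ size m = N0, count id m = n &
  forall (X : Type) (b : nat -> X), mask m (mkseq b N0) = [seq b (k i) | i <- enum 'I_n]].
Proof.
move=> hk hN; pose s := [seq k i | i <- enum 'I_n].
have ss : sorted ltn s.
  rewrite sorted_map.
  have : sorted (fun i j : 'I_n => (i < j)%N) (enum 'I_n).
    by have := iota_ltn_sorted 0 n; rewrite -val_enum_ord sorted_map.
  by apply: sub_sorted => i j; exact: hk.
have E : s = [seq x <- seq.iota 0 N0 | x \in s].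
  apply: (irr_sorted_eq ltn_trans ltnn ss).
    by apply: sorted_filter; [exact: ltn_trans|exact: iota_ltn_sorted].
  move=> x; rewrite mem_filter mem_iota /= add0n; case hx: (x \in s) => //=.
  by case/mapP: hx => i _ ->; rewrite hN.
have [m hm hs] : exists2 m, size m = size (seq.iota 0 N0) & s = mask m (seq.iota 0 N0).
  by apply/subseqP; rewrite E; exact: filter_subseq.
rewrite size_iota in hm; exists m; split=> //.
  rewrite -(size_mask (s := seq.iota 0 N0)) ?size_iota // -hs size_map.
  exact: size_enum_ord.
by move=> X b; rewrite /mkseq -map_mask -hs -map_comp.
Qed.

Section RealOver.
Variables (L : lang) (N : structure L) (D : set (elt (meq N))).
Local Notation ML := (expand (eq_lext N)).
Local Notation M := (meq N).

Definition real_over c (P : tup N c -> Prop) : Prop :=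
  definable_over (N := M) D (c := cmap inl c) P.

Definition var_inl d s (x : var d s) : var (cmap inl d : ctx (lsort ML)) (inl s) :=
  match x in var _ s return var (cmap inl d : ctx (lsort ML)) (inl s) with
  | V k => V (k : idx (cmap (@inl (lsort L) (eqsort N)) d))
  end.

Lemma look_var_inl d s (x : var d s) (v : tup N d) :
  look (v : tup M (cmap inl d)) (var_inl x) = look v x.
Proof. by case: x. Qed.

Lemma real_over_closed : closed_class real_over.
Proof.
have DM := definable_over_closed D; split.
- by move=> c P Q hP h; apply: (K_ext DM) hP h.
- by move=> c; exact: (K_top DM).
- by move=> c P Q; exact: (K_and DM).
- by move=> c P; exact: (K_not DM).
- move=> c d r P hP.
  pose r' (i : idx (cmap (@inl (lsort L) (eqsort N)) c)) :
      var (cmap inl d : ctx (lsort ML)) (cmap inl c i) :=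
    var_inl (r i).
  apply: (K_ext DM) (K_ren DM r' hP) _ => v.
  suff -> : (fun i => look v (r' i)) = (fun i => look (v : tup N d) (r i)) by [].
  by apply: fext => i; exact: look_var_inl.
- move=> c s P hP.
  pose d : ctx (lsort ML) := cext (cmap inl c) (inl s).
  pose r' (i : idx (cmap (@inl (lsort L) (eqsort N)) (cext c s))) : var d (cmap inl (cext c s) i) :=
    match i with Some j => V (Some j : idx d) | None => V (None : idx d) end.
  apply: (K_ext DM) (K_ex DM (K_ren DM r' hP)) _ => v.
  suff key x : (fun i => look (text v x) (r' i)) = text (v : tup N c) x.
    by split=> -[x hx]; exists x; move: hx; rewrite key.
  by apply: fext => -[].
Qed.

Lemma real_overW c (P : tup N c -> Prop) : definable P -> real_over P.
Proof. by move=> h; apply: definable_overW; exact: definable_inl. Qed.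

End RealOver.

Section IndiscernibleSequences.
Variables (L : lang) (N : structure L).
Local Notation M := (meq N).
Variables (Gamma Delta : set (elt M)).
Hypotheses (hDelta : Delta = dcl Delta) (hsat : saturated_succ N Delta).
Hypothesis hsub : Gamma `<=` Delta.
Hypothesis hreal : Delta `<=` dcl (@real_elt L N @` real_part Delta).

(** The elements [z] already found are kept as variables, so that the conditions of [p] are over
    [Delta] and independent of [z]. *)
Lemma saturation_param (y F : ctx (lsort L)) (z : tup N F) (p : set (tup N (cadd y F) -> Prop)) :
  finctx y -> finctx F -> (forall Q, p Q -> real_over Delta Q) ->
  (forall n (Q : 'I_n -> tup N (cadd y F) -> Prop), (forall i, p (Q i)) ->
    exists v, forall i, Q i (tadd v z)) ->
  exists v, forall Q, p Q -> Q (tadd v z).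
Proof.
move=> hy [T [e [e' [_ he]]]] hp hfs.
pose K : set (elt N) := [set x | exists i, x = existT N (F i) (z i)].
have hK : countable K.
  have -> : K = (fun t => existT N (F (e t)) (z (e t))) @` [set: T].
    apply/seteqP; split=> [x [i ->]|_ [t _ <-]]; last by exists (e t).
    by exists (e' i); rewrite // he.
  by apply: sub_countable (card_image_le _ _) _.
have [|n P hP|v hv] := @saturation _ N Delta hDelta hsat K y
    [set P | exists2 Q, p Q & P = (fun v => Q (tadd v z))] hK hy.
- move=> _ [Q hQ ->].
  have h1 := real_definable hreal (hp Q hQ).
  have h2 := definable_over_sub (@subsetUl _ (real_part Delta) K) h1.
  apply: (definable_over_param h2) => i; right; by exists i.
- have [Q hQ hPQ] := dep_choice2 hP; have [v hv] := hfs n Q hQ.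
  by exists v => i; rewrite hPQ; exact: hv.
by exists v => Q hQ; apply: (hv (fun v => Q (tadd v z))); exists Q.
Qed.

Variables (y : ctx (lsort L)) (hy : finctx y).
Local Notation X := (tup N y).
Let DG := real_over_closed Gamma.

Definition slice n (z : tup N (cpow n y)) (i : 'I_n) : X := fun j => z (i, j).
Definition lst n (z : tup N (cpow n y)) : seq X := [seq slice z i | i <- enum 'I_n].
Definition left_part n (w : tup N (cadd y (cpow n y))) : X := fun j => w (inl j).
Definition right_part n (w : tup N (cadd y (cpow n y))) : tup N (cpow n y) := fun j => w (inr j).

Definition definable_seq n (P : seq X -> Prop) : Prop :=
  real_over Gamma (c := cpow n y) (fun z => P (lst z)).

Lemma lst_mkseq n (b : nat -> X) : lst (fun i : idx (cpow n y) => b i.1 i.2) = mkseq b n.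
Proof. by rewrite /lst /mkseq -val_enum_ord -map_comp. Qed.

Lemma definable_seq_rcons n P : definable_seq n.+1 P ->
  real_over Gamma (c := cadd y (cpow n y))
    (fun w => P (rcons (lst (right_part w)) (left_part w))).
Proof.
move=> hP; pose d := cadd y (cpow n y).
pose r (i : idx (cpow n.+1 y)) : var d (cpow n.+1 y i) :=
  match (insub (val i.1) : option 'I_n) with
  | Some k => V (inr (k, i.2) : idx d)
  | None => V (inl i.2 : idx d)
  end.
apply: (K_ext DG) (K_ren DG r hP) _ => w.
suff -> : lst (fun i => look w (r i)) = rcons (lst (right_part w)) (left_part w).
  by [].
rewrite /lst enum_ordSr map_rcons -map_comp; congr rcons.
  apply: eq_map => i; apply: fext => j; rewrite /slice /right_part /r /=.
  by rewrite (valK i).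
by apply: fext => j; rewrite /slice /left_part /r /= insubF // ltnn.
Qed.

Section Sequence.
Variables (I : Type) (U : set_system I) (FU : UltraFilter U) (e : I -> X) (b0 : X).
(** [b0] realizes the average type over [Gamma], so the sequence can start with a prescribed
    element. *)
Hypothesis hb0 : forall P : X -> Prop, real_over Gamma P -> U [set i | P (e i)] -> P b0.

Let realizes (l : seq X) := forall P, definable_seq (size l) P ->
  ualmost U e (size l) P -> P l.

(** For finitely many P_i in the average type, the existence of z with all P_i(l, z) is a formula
    over [Gamma] that holds almost everywhere, hence at l. The next element therefore comes from
    saturation. *)
Lemma realizes_rcons l : realizes l -> exists z, realizes (rcons l z).
Proof.
move=> hl; pose k := size l.
pose zl : tup N (cpow k y) := fun i => nth b0 l i.1 i.2.
have lstl : lst zl = l.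
  rewrite /zl (lst_mkseq k (nth b0 l)); exact: mkseq_nth.
have [|Q [P [hP1 hP2] ->]|n Q hQ|z hz] := @saturation_param y (cpow k y) zl
  [set Q | exists2 P, definable_seq k.+1 P /\ ualmost U e k.+1 P &
    Q = fun w => P (rcons (lst (right_part w)) (left_part w))] hy.
- exact: finctx_cpow.
- exact: definable_over_sub hsub (definable_seq_rcons hP1).
- have [P hP hPQ] := dep_choice2 hQ.
  pose R (l : seq X) := exists z, forall i, P i (rcons l z).
  have hR : definable_seq k R.
    have h : real_over Gamma (c := cadd y (cpow k y)) (fun w => forall i,
        P i (rcons (lst (right_part w)) (left_part w))).
      by apply: (K_forall DG) => i; exact: definable_seq_rcons (hP i).1.
    pose r (i : idx (cadd y (cpow k y))) : var (cadd (cpow k y) y) (cadd y (cpow k y) i) :=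
      match i with
      | inl j => V (inr j : idx (cadd (cpow k y) y))
      | inr j => V (inl j : idx (cadd (cpow k y) y))
      end.
    by apply: (K_ext DG) (K_exists_fin DG hy (K_ren DG r h)) _ => v.
  have : R l.
    apply: hl => //; apply: (@ualmost_rcons _ _ U e FU k (fun l => forall i, P i l)).
    by apply: ualmost_forall => i; exact: (hP i).2.
  case=> z hz; exists z => i; rewrite hPQ /=.
  have := hz i; congr (P i (rcons _ _)); exact: esym lstl.
exists z => P; rewrite size_rcons => h1 h2.
by have := hz _ (ex_intro2 _ _ P (conj h1 h2) erefl); rewrite /= lstl.
Qed.

(** The truth of a formula at increasing indices is decided by its average over n coordinates,
    whatever the indices. *)
Theorem indiscernible_sequence : exists b : nat -> X, [/\ b 0%N = b0,
  @indiscernible _ M Gamma (cmap inl y) b &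
  forall n P, definable_seq n P -> ualmost U e n P -> P (mkseq b n)].
Proof.
have r0 : realizes [:: b0].
  move=> P hP hU.
  pose c1 (x : X) : tup N (cpow 1 y) := fun i => x i.2.
  have hP1 : real_over Gamma (fun x => P [:: x]).
    apply: (K_ext DG) (K_ren DG (fun i : idx (cpow 1 y) => V i.2) hP) _ => x.
    by rewrite /lst enum_ordSl /= (size0nil (s := enum 'I_0)) ?size_enum_ord.
  exact: (hb0 hP1).
pose st := {l : seq X | realizes l}.
pose next (s : st) : st :=
  let h := cid (realizes_rcons (projT2 (existT _ (sval s) (svalP s)))) in
  exist _ (rcons (sval s) (projT1 h)) (projT2 h).
pose s0 : st := exist _ _ r0.
pose f k := sval (iter k next s0).
have fS k : exists z, f k.+1 = rcons (f k) z by rewrite /f /=; eexists.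
have size_f k : size (f k) = k.+1.
  by elim: k => [//|k IHk]; have [z ->] := fS k; rewrite size_rcons IHk.
pose b k := nth b0 (f k) k.
have nth_f k j : (j <= k)%N -> nth b0 (f k) j = b j.
  elim: k => [|k IHk]; first by rewrite leqn0 => /eqP->.
  rewrite leq_eqVlt => /orP[/eqP->//|]; rewrite ltnS => hj.
  by have [z ->] := fS k; rewrite nth_rcons size_f ltnS hj IHk.
have fE k : f k = mkseq b k.+1.
  apply: (@eq_from_nth _ b0) => [|j]; rewrite size_f ?size_mkseq // ltnS => hj.
  by rewrite nth_mkseq // nth_f.
have hb n P : definable_seq n P -> ualmost U e n P -> P (mkseq b n).
  case: n => [_ //|n] hP hU; rewrite -fE; have := svalP (iter n next s0).
  by apply; rewrite -/(f n) size_f.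
exists b; split=> //.
move=> n k k' hk hk' g.
pose P (l : seq X) := @holds _ M Gamma (cpow n (cmap inl y)) g
  (fun i : 'I_n * idx y => nth b0 l i.1 i.2).
suff key (k0 : 'I_n -> nat) : {homo k0 : i j / (i < j)%N} ->
    @holds _ M Gamma (cpow n (cmap inl y)) g (fun i => b (k0 i.1) i.2) <-> ualmost U e n P.
  by rewrite (key k hk) (key k' hk').
move=> {k k' hk hk'} hk0.
(* The length of an initial segment that contains all the chosen indices. *)
pose N0 := (\max_(i < n) k0 i).+1.
have hN i : (k0 i < N0)%N by rewrite ltnS; exact: leq_bigmax.
have [m [sm cm hm]] := mask_increasing hk0 hN.
pose P' (l : seq X) := P (mask m l).
have hP' : definable_seq N0 P'.
  pose r (i : idx (cpow n y)) : var (cpow N0 y) (cpow n y i) :=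
    V ((Ordinal (hN i.1), i.2) : idx (cpow N0 y)).
  have hg : real_over Gamma (c := cpow n y)
     (fun v => @holds _ M Gamma (cpow n (cmap inl y)) g v) by exact: definable_over_sat.
  apply: (K_ext DG) (K_ren DG r hg) _ => v.
  rewrite /P' /P; set w := (X in holds g X <-> _); set w' := (X in _ <-> holds g X).
  suff -> : w = w' by [].
  apply: fext => -[i j]; rewrite /w /w' /=.
  have -> : lst v = mkseq (nth b0 (lst v)) N0.
    by rewrite -{1}(mkseq_nth b0 (lst v)) /lst size_map size_enum_ord.
  rewrite hm (nth_map i) ?size_enum_ord // nth_ord_enum.
  have /= E := nth_ord_enum (Ordinal (hN i)) (Ordinal (hN i)).
  by rewrite /lst (nth_map (Ordinal (hN i))) ?size_enum_ord // E.
have -> : @holds _ M Gamma (cpow n (cmap inl y)) g (fun i => b (k0 i.1) i.2) <->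
    P' (mkseq b N0).
  rewrite /P' /P hm; set w := (X in holds g X <-> _); set w' := (X in _ <-> holds g X).
  suff -> : w = w' by [].
  by apply: fext => -[i j]; rewrite /w /w' /= (nth_map i) ?size_enum_ord // nth_ord_enum.
rewrite -cm -(ualmost_mask e (FU := FU)) sm -/P'.
split=> [h|]; last exact: hb.
(* The average type is complete, so the converse follows from the negation. *)
apply: contrapT => /ualmost_not/(hb _ _ (K_not DG hP')); exact.
Qed.

End Sequence.
End IndiscernibleSequences.

(** * Dividing and forking in terms of real tuples *)

Lemma indiscernible_tp (L : lang) (N : structure L) (G : set (elt N)) (y : ctx (lsort L))
    (b : nat -> tup N y) : indiscernible G b -> forall k, tp G (b k) = tp G (b 0%N).
Proof.
move=> hb k; have key (f : formula_over G y) : holds f (b k) <-> holds f (b 0%N).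
  have [g hg] := K_ren (definable_over_closed G)
    (fun i : idx y => V ((ord0, i) : idx (cpow 1 y))) (definable_over_sat f).
  have h1 (k0 : nat) : {homo (fun _ : 'I_1 => k0) : i j / (i < j)%N}.
    by move=> i j; rewrite !ord1.
  by have := hb 1%N (fun=> k) (fun=> 0%N) (h1 k) (h1 0%N) g; rewrite !hg.
by apply/seteqP; split=> f /= /key.
Qed.

Lemma definable_arity (L : lang) (N : structure L) (x y : ctx (lsort L))
    (Q : tup N (cadd x y) -> Prop) : finctx y -> definable Q ->
  exists n (e : 'I_n -> idx y) (f : fm (cadd x (Arity (fun i => y (e i))))),
  forall (v : tup N x) (z : tup N y),
    sat f (tadd v ((fun i => z (e i)) : tup N (Arity (fun i => y (e i))))) <-> Q (tadd v z).
Proof.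
move=> [T [e [e' [_ he]]]] hQ; pose e0 (k : 'I_#|T|) := e (enum_val k).
pose a : arity (lsort L) := Arity (fun i => y (e0 i)).
have E (i : idx y) : e0 (enum_rank (e' i)) = i by rewrite /e0 enum_rankK he.
pose r (i : idx (cadd x y)) : var (cadd x a) (cadd x y i) :=
  match i with
  | inl j => V (inl j : idx (cadd x a))
  | inr j => ecast k (var (cadd x a) (y k)) (E j) (V (inr (enum_rank (e' j)) : idx (cadd x a)))
  end.
have [f hf] := K_ren (definable_closed N) r hQ.
exists #|T|, e0, f => v z; rewrite hf.
suff -> : (fun i => look (tadd v ((fun i => z (e0 i)) : tup N a)) (r i)) = tadd v z by [].
by apply: fext => -[//|i]; rewrite /r /= look_ecast; exact: tup_ecast.
Qed.

Lemma definable_consistent (L : lang) (N : structure L) (x y : ctx (lsort L)) n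
    (Q : tup N (cadd x y) -> Prop) : finctx x -> definable Q ->
  definable (c := cpow n y) (fun z => exists v : tup N x, forall k : 'I_n, Q (tadd v (slice z k))).
Proof.
move=> hx hQ; have DN := definable_closed N.
have h : definable (N := N) (c := cadd (cpow n y) x) (fun w => forall k : 'I_n,
    Q (tadd (fun i => w (inr i)) (slice (fun i => w (inl i)) k))).
  apply: (K_forall DN) => k.
  pose r (i : idx (cadd x y)) : var (cadd (cpow n y) x) (cadd x y i) :=
    match i with
    | inl j => V (inr j : idx (cadd (cpow n y) x))
    | inr j => V (inl (k, j) : idx (cadd (cpow n y) x))
    end.
  apply: (K_ext DN) (K_ren DN r hQ) _ => v.
  suff -> : (fun i => look v (r i)) =
    tadd (fun i => v (inr i)) (slice (fun i => v (inl i)) k) by [].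
  by apply: fext => -[].
exact: (K_exists_fin DN hx h).
Qed.

Section SemanticForking.
Variables (L : lang) (N : structure L).
Local Notation ML := (expand (eq_lext N)).
Local Notation M := (meq N).
Variables (Gamma Delta : set (elt M)).
Variables (x : ctx (lsort L)) (hx : finctx x).

(** Dividing for predicates with real parameters; that every [b k] is a conjugate of [d] follows
    from [indiscernible_tp]. *)
Definition sdivides (y : ctx (lsort L)) (Q : tup N (cadd x y) -> Prop) (d : tup N y) : Prop :=
  exists b : nat -> tup N y, [/\ b 0%N = d, @indiscernible _ M Gamma (cmap inl y) b &
    exists n, ~ exists v, forall k, (k < n)%N -> Q (tadd v (b k))].

(** [K] bounds how the predicate is defined: forking is proved from predicates over [Gamma], while a
    forking type yields parameter-free ones, to which elimination applies. *)
Record divform (K : forall c : ctx (lsort L), (tup N c -> Prop) -> Prop) := DivForm {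
  dv_y : ctx (lsort L);
  dv_fin : finctx dv_y;
  dv_Q : tup N (cadd x dv_y) -> Prop;
  dv_def : K _ dv_Q;
  dv_d : tup N dv_y;
  dv_div : sdivides dv_Q dv_d }.

Arguments dv_d {K} _ _.

Definition dv_holds K (g : divform K) (v : tup N x) : Prop := dv_Q (tadd v (dv_d g)).

Definition sforks (K : forall c : ctx (lsort L), (tup N c -> Prop) -> Prop) (v : tup N x) : Prop :=
  exists (P : tup N x -> Prop) n (g : 'I_n -> divform K),
    [/\ real_over Delta P, P v & forall w, P w -> exists i, dv_holds (g i) w].

(** The parameters in [Gamma] are appended to [d] as constant coordinates, which preserves
    indiscernibility over [Gamma]. *)
Lemma divform_divides (g : divform (real_over Gamma)) : exists f : pformula M (cmap inl x),
  divides Gamma f /\ forall v, psat f v <-> dv_holds g v.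
Proof.
case: g => y hy Q hQ d [b [hb0 hb [n hn]]]; rewrite /dv_holds /=.
have [T [k [Q' [hQ' hk hE]]]] := definable_over_support hQ.
pose Y : ctx (lsort ML) := cadd (cmap inl y) (kctx k).
have hY : finctx Y.
  by apply: finctx_cadd; [exact: finctx_cmap|exists T, id, id].
pose r (i : idx (cadd (cmap inl (cadd x y)) (kctx k))) :
    var (cadd (cmap inl x) Y) (cadd (cmap inl (cadd x y)) (kctx k) i) :=
  match i with
  | inl (inl j) => V (inl j : idx (cadd (cmap inl x) Y))
  | inl (inr j) => V (inr (inl j) : idx (cadd (cmap inl x) Y))
  | inr t => V (inr (inr t) : idx (cadd (cmap inl x) Y))
  end.
have [m [e [f hf]]] := definable_arity hY (K_ren (definable_closed M) r hQ').
have rE (v : tup N x) (z : tup N y) :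
    (fun i => look (tadd (v : tup M (cmap inl x)) (tadd (z : tup M (cmap inl y)) (ktup k) : tup M Y))
       (r i)) = tadd (tadd v z : tup M (cmap inl (cadd x y))) (ktup k).
  by apply: fext => -[[]|].
pose a : arity (lsort ML) := Arity (fun i => Y (e i)).
pose par (z : tup N y) : tup M a := fun i => (tadd (z : tup M (cmap inl y)) (ktup k) : tup M Y) (e i).
have hpar (v : tup N x) (z : tup N y) : sat f (tadd (v : tup M (cmap inl x)) (par z)) <-> Q (tadd v z).
  by rewrite hf rE hE.
have hind : indiscernible Gamma (fun i => par (b i)).
  move=> p h l hh hl g.
  pose Z : ctx (lsort ML) := cadd (cpow p (cmap inl y)) (kctx k).
  pose rY (i : 'I_p) (q : idx Y) : var Z (Y q) :=
    match q with
    | inl j => V (inl (i, j) : idx Z)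
    | inr t => V (inr t : idx Z)
    end.
  have hg := K_ren (definable_over_closed Gamma) (fun i : idx (cpow p a) => rY i.1 (e i.2))
    (definable_over_sat g).
  have [g' hg'] := definable_over_param hg (ktupP hk).
  have key (c : 'I_p -> nat) :
      (fun i : idx (cpow p a) => look (tadd ((fun i => b (c i.1) i.2) : tup M (cpow p (cmap inl y)))
        (ktup k)) (rY i.1 (e i.2))) = (fun i => par (b (c i.1)) i.2).
    by apply: fext => -[i j]; rewrite /par /=; case: (e j).
  by rewrite -!key -!hg'; exact: hb.
exists (PFormula f (par d)); split; last by move=> v; rewrite /psat hpar.
exists (fun i => par (b i)); split=> //=.
- by rewrite hb0.
- by move=> i; rewrite (indiscernible_tp hind) hb0.
exists n; case=> v hv; apply: hn; exists v => i hi; apply/hpar; exact: hv.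
Qed.

Lemma forks_intro v : sforks (real_over Gamma) v ->
  type_forks Gamma (tp Delta (v : tup M (cmap inl x))).
Proof.
move=> [P [n [g [hP hPv hg]]]].
have [T [k [Q [hQ hk hE]]]] := definable_over_support hP.
have hT : finctx (kctx k) by exists T, id, id.
have [m [e [f hf]]] := definable_arity hT hQ.
exists (PFormula f (fun i => ktup k (e i))); split.
  have [F hF] := hP; exists 1%N, (fun=> F); split=> [_|w /(_ ord0)].
    by rewrite /tp /= hF.
  by rewrite /psat /= hf hF hE.
have [h hh] := dep_choice (fun i => divform_divides (g i)).
exists n, h; split=> [i|w]; first exact: (hh i).1.
rewrite /psat hf -hE => /hg[i hi]; exists i.
by apply/(hh i).2.
Qed.

Hypotheses (hDelta : Delta = dcl Delta) (hsat : saturated_succ N Delta).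
Hypothesis hsub : Gamma `<=` Delta.
Hypothesis hreal : Delta `<=` dcl (@real_elt L N @` real_part Delta).

Section Lifting.
Variable g : pformula M (cmap inl x).
Let a := pf_ar g.
Let y := csig (fun i : idx a => rep (a i)).
Let pi (z : tup N y) : tup M a := fun i => prj (fun k => z (existT _ i k)).

Let hy : finctx y.
Proof. by apply: (@finctx_csig _ 'I_(alen a)) => i; exact: finctx_rep. Qed.

Let pi_surj X : exists z, pi z = X.
Proof.
have [z hz] := dep_choice (fun i => prj_surj (X i)).
by exists (fun p => z (projT1 p) (projT2 p)); apply: fext => i; exact: hz.
Qed.

Let Q (w : tup N (cadd x y)) : Prop :=
  sat (pf_fm g) (tadd ((fun i => w (inl i)) : tup M (cmap inl x)) (pi (fun p => w (inr p)))).

Let hQ : definable Q.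
Proof.
pose m (i : idx (cadd (cmap inl x) a)) :
    forall k, term (cadd x y) (rep (cadd (cmap inl x) a i) k) :=
  match i with
  | inl j => fun _ : unit => @Var L (cadd x y) (inl j)
  | inr j => fun k => @Var L (cadd x y) (inr (existT _ j k))
  end.
apply: (K_ext (definable_closed N)) (definable_prj (definable_sat M (pf_fm g)) m) _ => v.
rewrite /Q; suff -> : (fun i => prj (fun k => eval v (m i k))) =
  tadd ((fun i => v (inl i)) : tup M (cmap inl x)) (pi (fun p => v (inr p))) by [].
by apply: fext => -[].
Qed.

Let pi_eq_def : definable (N := N) (c := cadd y y)
  (fun w => pi (fun p => w (inl p)) = pi (fun p => w (inr p))).
Proof.
have h (i : 'I_(alen a)) := definable_prj_eq (s := a i)
  (fun k => @Var L (cadd y y) (inl (existT _ i k)))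
  (fun k => @Var L (cadd y y) (inr (existT _ i k))).
apply: (K_ext (definable_closed N)) (K_forall (definable_closed N) h) _ => v /=.
by split=> [H|H i]; [apply: fext|have := congr1 (fun z => z i) H].
Qed.

Let pi_graph : definable (N := M) (c := cadd a (cmap inl y))
  (fun w => pi (fun p => w (inr p)) = (fun i => w (inl i))).
Proof.
have h (i : 'I_(alen a)) : definable (N := M) (c := cadd a (cmap inl y))
    (fun w => prj (fun k => w (inr (existT _ i k)) : N (rep (a i) k)) = w (inl i)).
  pose d := cadd a (cmap inl y : ctx (lsort ML)).
  have aux s (t : forall k, term d (inl (rep s k) : lsort ML)) (t' : term d s) :
      definable (N := M) (c := d) (fun w => prj (fun k => eval w (t k) : N (rep s k)) = eval w t').
    case: s t t' => [s|e] t t'; first exact: definable_eqn.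
    exact: (definable_eqn M (@App ML d (inr e) t) t').
  exact: (aux _ (fun k => @Var ML d (inr (existT _ i k))) (@Var ML d (inl i))).
apply: (K_ext (definable_closed M)) (K_forall (definable_closed M) h) _ => v /=.
by split=> [H|H i]; [apply: fext|have := congr1 (fun z => z i) H].
Qed.

(** Each term of the dividing sequence is lifted to representatives having the type of [d] over
    [Gamma]. A new indiscernible sequence is then extracted from the lifts; it stays inconsistent
    because consistency depends only on the projections [pi]. *)
Lemma divides_lift : divides Gamma g -> exists h : divform (@definable L N),
  forall v, dv_holds h v <-> psat g v.
Proof.
move=> [b [hb0 hbtp hb [n hn]]].
have DG := definable_over_closed Gamma.
have [d hd] := pi_surj (pf_par g).
have lift k : exists z, pi z = b k /\
    forall P : tup N y -> Prop, real_over Gamma P -> P d -> P z.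
  have [r hr] := pi_surj (b k).
  have [|m R hR|z hz] := @saturation_param _ N Delta hDelta hsat hreal y y r
    [set R | exists2 P : tup N y -> Prop, real_over Gamma P /\ P d &
      R = fun w => P (fun i => w (inl i)) /\ pi (fun p => w (inl p)) = pi (fun p => w (inr p))] hy hy.
  - move=> _ [P [hP _] ->]; apply: (K_and (real_over_closed Delta)); last exact: real_overW _ pi_eq_def.
    have hP' := definable_over_sub hsub hP.
    exact: (K_ren (real_over_closed Delta) (fun i : idx y => V (inl i : idx (cadd y y))) hP').
  - have [P hP hPR] := dep_choice2 hR.
    (* [W] is a formula over [Gamma] that holds at [pf_par g], with witness [d], and so holds at its
       conjugate [b k]. *)
    pose W (X : tup M a) := exists z : tup M (cmap inl y), (forall i, P i z) /\ pi z = X.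
    have [f hf] : definable_over Gamma (c := a) W.
      have h1 : definable_over Gamma (c := cadd a (cmap inl y))
          (fun w => (forall i, P i (fun j => w (inr j))) /\
            pi (fun p => w (inr p)) = (fun i => w (inl i))).
        apply: (K_and DG); last exact: definable_overW _ pi_graph.
        apply: (K_forall DG) => i.
        exact: (K_ren DG (fun j : idx (cmap inl y) => V (inr j : idx (cadd a (cmap inl y)))) (hP i).1).
      exact: (K_exists_fin DG (finctx_cmap _ hy) h1).
    have : W (b k).
      apply/hf; have : tp Gamma (pf_par g) f.
        by apply/hf; exists d; split=> // i; exact: (hP i).2.
      by rewrite -(hbtp k).
    case=> z [hz1 hz2]; exists z => i; rewrite hPR /=.
    by split; [exact: hz1|rewrite hz2 -hr].
  exists z; split=> [|P hP hPd].
    have [_ ->] := hz _ (ex_intro2 _ _ (fun=> True)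
      (conj (K_top (real_over_closed Gamma) y) I) erefl).
    exact: hr.
  by have [] := hz _ (ex_intro2 _ _ P (conj hP hPd) erefl).
have [e he] := dep_choice lift.
have pe k : pi (e k) = b k := (he k).1.
(* The lifts need not be indiscernible. The sequence averaged along an ultrafilter containing the
   cofinite sets is, and inherits what holds on all increasing tuples of lifts. *)
have [U [FU hU]] := ultraFilterLemma (F := eventually) _.
have [|c [hc0 hc hcU]] := @indiscernible_sequence _ N Gamma Delta hDelta hsat hsub hreal y hy nat U FU e d.
  move=> P hP hUP; apply: contrapT => hPd.
  apply: (@filter_not_empty _ U _); apply: filterS hUP => k hk.
  by apply: ((he k).2 _ (K_not (real_over_closed Gamma) hP) hPd).
have hdiv : sdivides Q d.
  exists c; split=> //; exists n.
  pose W (z : tup N (cpow n y)) := exists v : tup N x, forall k : 'I_n, Q (tadd v (slice z k)).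
  have hW : definable W by exact: definable_consistent.
  pose W' (z : tup M (cpow n a)) := exists v : tup M (cmap inl x),
    forall k : 'I_n, sat (pf_fm g) (tadd v (slice z k)).
  have hW' : definable W' := definable_consistent n (finctx_cmap _ hx) (definable_sat M (pf_fm g)).
  pose seqW (l : seq (tup N y)) := ~ W (fun i => nth d l i.1 i.2).
  have : seqW (mkseq c n).
    apply: hcU.
      apply: (K_ext (real_over_closed Gamma)) (K_not (real_over_closed Gamma) (real_overW Gamma hW)) _.
      move=> z; rewrite /seqW; suff -> : (fun i : idx (cpow n y) => nth d (lst z) i.1 i.2) = z by [].
      apply: fext => -[i j] /=; rewrite /lst (nth_map i) ?size_enum_ord // nth_ord_enum.
      by [].
    apply: ualmost_increasing => // l hl sl [v hv]; apply: hn.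
    pose k (i : 'I_n) := nth 0%N l i.
    have hk : {homo k : i j / (i < j)%N}.
      move=> i j hij; apply: (sorted_ltn_nth ltn_trans) => //; by rewrite inE hl.
    have [f hf] := definable_overW Gamma hW'.
    (* By indiscernibility of [b], any n terms of increasing index are as inconsistent as the first
       n. *)
    have := hb n k val hk (fun i j h => h) f.
    rewrite !hf => E.
    have [w hw] : W' (fun i => b i.1 i.2).
      apply/E; exists v => i; have := hv i; rewrite /Q.
      set z1 := (X in pi X); set z2 := (X in _ -> sat _ (tadd _ X)).
      suff -> : pi z1 = z2 by [].
      rewrite /z2 -[RHS]/(b (k i)) -pe /z1 /slice; congr pi; apply: fext => p.
      by rewrite /= (nth_map 0%N) ?hl.
    by exists w => i hi; exact: (hw (Ordinal hi)).
  move=> hs [v hv]; apply: hs; exists v => k.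
  have := hv k (ltn_ord k); congr (Q (tadd v _)).
  by apply: fext => j; rewrite /slice /= nth_mkseq.
exists (@DivForm (@definable L N) y hy Q hQ d hdiv) => v.
by rewrite /dv_holds /= /Q /psat -hd.
Qed.

End Lifting.

Lemma forks_elim v : type_forks Gamma (tp Delta (v : tup M (cmap inl x))) ->
  sforks (@definable L N) v.
Proof.
move=> [f [[m [h [hh hf]]] [n [g [hg hfg]]]]].
have [D hD] := dep_choice (fun i => divides_lift (hg i)).
exists (fun w : tup N x => forall i, holds (h i) w), n, D; split.
- apply: (K_forall (real_over_closed Delta)) => i; exact: definable_over_sat.
- exact: hh.
- by move=> w /hf/hfg[i hi]; exists i; apply/hD.
Qed.

End SemanticForking.
Arguments dv_d {L N Gamma x K} _ _.

(** * Elimination in the variables x and y, with A- and C-parts read in M *)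

Section TranslationToM.
Local Open Scope ring_scope.
Variables (L : lang) (Phi : set (ppformula L)) (E : expanded_ses Phi).
Local Notation GL := (group_lang L).
Local Notation LA := (langA E).
Local Notation LC := (langC E).
Local Notation LM := (langM E).
Local Notation N := (strM E).
Local Notation SAE := (@SA L Phi E).
Local Notation SBE := (@SB L Phi E).
Local Notation SCE := (@SC L Phi E).
Local Notation nu := (@nu L E).
Implicit Types (d : ctx (lsort LM)).

Fixpoint trB d (b : ctx (lsort L)) (r : forall i : idx b, term d (SBE (b i))) s
    (t : @term GL b s) : term d (SBE s) :=
  match t with
  | Var i => r i
  | App f ts => @App LM d (FB E f) (fun i => trB r (ts i))
  end.

Lemma eval_trB d b r s t (v : tup N d) :
  eval v (@trB d b r s t) = ev (A := sB E) (fun i => eval v (r i)) t.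
Proof.
rewrite /ev; elim: t => [//|f ts IH].
by apply: (f_equal (@fint _ (astr (sB E)) f)); apply: fext.
Qed.

Definition sub_termB d s (t1 t2 : term d (SBE s)) : term d (SBE s) :=
  @App LM d (FB E (inl (Gadd s))) (fun l : 'I_2 =>
    if l == ord0 then t1 else @App LM d (FB E (inl (Gopp s))) (fun _ : 'I_1 => t2)).

Lemma eval_sub_termB d s (t1 t2 : term d (SBE s)) (v : tup N d) :
  eval v (sub_termB t1 t2) = (eval v t1 : grp (sB E) s) - eval v t2.
Proof. by []. Qed.

Lemma definable_SA a (P : tup (strA E) a -> Prop) : definable P ->
  forall d (r : forall i : idx a, term d (SAE (a i))),
  definable (N := N) (c := d) (fun v => P (fun i => eval v (r i))).
Proof.
move=> hP; apply: (@definable_interp _ _ (strA E) N SAE (fun s x => x)) hP.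
- by move=> s x y.
- by move=> s y; exists y.
- move=> f; pose d : ctx (lsort LM) := cadd (cmap SAE (fdom f)) (one (SAE (fcod f))).
  exact: (definable_eqn N (@App LM d (FA f) (fun i => @Var LM d (inl i))) (@Var LM d (inr tt))).
- move=> q; pose d : ctx (lsort LM) := cmap SAE (rdom q).
  by exists (@Rel LM d (RA q) (fun i => @Var LM d i)).
Qed.

Lemma definable_SB b (P : tup (grp (sB E)) b -> Prop) : definable (N := astr (sB E)) P ->
  forall d (r : forall i : idx b, term d (SBE (b i))),
  definable (N := N) (c := d) (fun v => P (fun i => eval v (r i))).
Proof.
move=> hP; apply: (@definable_interp _ _ (astr (sB E)) N SBE (fun s x => x)) hP.
- by move=> s x y.
- by move=> s y; exists y.
- move=> f; pose d : ctx (lsort LM) := cadd (cmap SBE (fdom f)) (one (SBE (fcod f))).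
  exact: (definable_eqn N (@App LM d (FB E f) (fun i => @Var LM d (inl i))) (@Var LM d (inr tt))).
- move=> q; pose d : ctx (lsort LM) := cmap SBE (rdom q).
  by exists (@Rel LM d (RB E q) (fun i => @Var LM d i)).
Qed.

Lemma definable_SC c (P : tup (strC E) c -> Prop) : definable P ->
  forall d (r : forall i : idx c, term d (SCE (c i))),
  definable (N := N) (c := d) (fun v => P (fun i => eval v (r i))).
Proof.
move=> hP; apply: (@definable_interp _ _ (strC E) N SCE (fun s x => x)) hP.
- by move=> s x y.
- by move=> s y; exists y.
- move=> f; pose d : ctx (lsort LM) := cadd (cmap SCE (fdom f)) (one (SCE (fcod f))).
  exact: (definable_eqn N (@App LM d (FC f) (fun i => @Var LM d (inl i))) (@Var LM d (inr tt))).
- move=> q; pose d : ctx (lsort LM) := cmap SCE (rdom q).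
  by exists (@Rel LM d (RC q) (fun i => @Var LM d i)).
Qed.

Lemma definable_ppC (f : ppformula L) d (r : forall k : idx (pp_ar f), term d (SBE (pp_ar f k))) :
  definable (N := N) (c := d)
    (fun v => @ppsat _ (sC E) f (tmap nu (fun k => eval v (r k) : grp (sB E) _))).
Proof.
pose rC (k : idx (pp_ar f)) : term d (SCE (homeC E (pp_ar f k))) :=
  @App LM d (Fnu E (pp_ar f k)) (fun _ => r k).
have h : definable (N := strC E) (c := cmap (homeC E) (pp_ar f)) (@ppsat _ (sC E) f).
  pose x := cmap (homeC E) (pp_ar f).
  have h0 : @definable GL (astr (sC E)) (pp_ar f) (@ppsat _ (sC E) f) by exists (pp_fm f).
  exact: (definable_homeC h0 (fun i => @Var LC x i)).
exact: (definable_SC h rC).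
Qed.

Lemma definable_Cset b c (P : tup (grp (sB E)) b -> tup (strC E) c -> Prop) : Cset P ->
  forall d (rB : forall i : idx b, term d (SBE (b i))) (rC : forall i : idx c, term d (SCE (c i))),
  definable (N := N) (c := d) (fun v => P (fun i => eval v (rB i)) (fun i => eval v (rC i))).
Proof.
move=> [Q [hQ hP]] d rB rC; pose x := cadd (cmap (homeC E) b) c.
pose r (i : idx x) : term d (SCE (x i)) :=
  match i with
  | inl j => @App LM d (Fnu E (b j)) (fun _ => rB j)
  | inr j => rC j
  end.
apply: (K_ext (definable_closed N)) (definable_SC hQ r) _ => v; rewrite hP.
suff -> : (fun i => eval v (r i)) =
  tadd (nuv (E := E) (fun i => eval v (rB i))) (fun i => eval v (rC i)) by [].
by apply: fext => -[].
Qed.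

Section Parts.
Variable y : ctx (lsort LM).

(** The kind of sort of a variable of [y] is known only up to equality, so an index carries a proof
    of it; [termA] casts the variable accordingly. *)
Definition ctxA : ctx (lsort LA) :=
  Ctx (fun p : {i : idx y & {s | y i = SAE s}} => sval (projT2 p)).
Definition ctxB : ctx (lsort L) :=
  Ctx (fun p : {i : idx y & {s | y i = SBE s}} => sval (projT2 p)).
Definition ctxC : ctx (lsort LC) :=
  Ctx (fun p : {i : idx y & {s | y i = SCE s}} => sval (projT2 p)).

Definition termA (p : idx ctxA) : term y (SAE (ctxA p)) :=
  ecast s (term y s) (proj2_sig (projT2 p)) (@Var LM y (projT1 p)).
Definition termB (p : idx ctxB) : term y (SBE (ctxB p)) :=
  ecast s (term y s) (proj2_sig (projT2 p)) (@Var LM y (projT1 p)).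
Definition termC (p : idx ctxC) : term y (SCE (ctxC p)) :=
  ecast s (term y s) (proj2_sig (projT2 p)) (@Var LM y (projT1 p)).

Definition valA (z : tup N y) : tup (strA E) ctxA := fun p => eval z (termA p).
Definition valB (z : tup N y) : tup (grp (sB E)) ctxB := fun p => eval z (termB p).
Definition valC (z : tup N y) : tup (strC E) ctxC := fun p => eval z (termC p).

Lemma sterm_parts : exists m : forall i : idx y, sterm ctxA ctxB ctxC (y i),
  forall z i, lookup (valA z) (valB z) (valC z) (m i) = z i.
Proof.
have h i : exists x : sterm ctxA ctxB ctxC (y i),
    forall z, lookup (valA z) (valB z) (valC z) x = z i.
  have aux s (e : y i = s) : exists x : sterm ctxA ctxB ctxC s,
      forall z, lookup (valA z) (valB z) (valC z) x = ecast s (N s) e (z i).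
    have cast s' (e' : y i = s') z :
        eval z (ecast s (term y s) e' (@Var LM y i)) = ecast s (N s) e' (z i).
      by case: _ / e'.
    case: s e => s e.
    - exists (@Var LA ctxA (existT _ i (exist _ s e))) => z; exact: cast.
    - exists (@Var GL ctxB (existT _ i (exist _ s e))) => z; exact: cast.
    - exists (@Var LC ctxC (existT _ i (exist _ s e))) => z; exact: cast.
  exact: (aux _ erefl).
by have [m hm] := dep_choice h; exists m.
Qed.

End Parts.

Section SplitTerms.
Variables (b y : ctx (lsort L)) (f : ppformula L) (t : bterms f (cadd b y)).

Definition bterms_left : bterms f b := fun k =>
  @tsubst GL (cadd b y) b (fun i => match i return @term GL b (cadd b y i) with
    | inl j => @Var GL b j | inr j => zero_term b (y j) end) _ (t k).
(** The sign is chosen so that t(v, z) becomes a difference, as in the arguments of rho in an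
    A-formula. *)
Definition bterms_right : bterms f y := fun k =>
  sub_term (zero_term y (pp_ar f k))
  (@tsubst GL (cadd b y) y (fun i => match i return @term GL y (cadd b y i) with
    | inl j => zero_term y (b j) | inr j => @Var GL y j end) _ (t k)).

Lemma evb_cadd (A : abelian L) (v : tup (grp A) b) (z : tup (grp A) y) :
  evb t (tadd v z : tup (grp A) (cadd b y)) = tminus (evb bterms_left v) (evb bterms_right z).
Proof.
apply: fext => k; rewrite /evb /tminus /bterms_left /bterms_right ev_sub_term.
rewrite -[X in _ - (X - _)]/(0 : grp A _) sub0r opprK !ev_tsubst -ev_add.
by apply: ev_ext => -[j|j]; rewrite /tplus /= ?addr0 // add0r.
Qed.

End SplitTerms.

Hypothesis hPhi : fundamental_system (sB E) Phi.
Variables (a : arity (lsort LA)) (b : arity (lsort L)) (c : arity (lsort LC)).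
Local Notation x := (varM a b c).
Local Notation V := (tup N x).

Definition mkV (va : tup (strA E) a) (vb : tup (grp (sB E)) b) (vc : tup (strC E) c) : V :=
  fun i => match i with
  | inl (inl j) => va j
  | inl (inr j) => vb j
  | inr j => vc j
  end.

Lemma finctx_varM : finctx x.
Proof.
by apply: finctx_cadd; [apply: finctx_cadd|]; exact: finctx_arity.
Qed.

Definition varA d (i : idx a) : term (cadd x d) (SAE (a i)) :=
  @Var LM (cadd x d) (inl (inl (inl i))).
Definition varB d (i : idx b) : term (cadd x d) (SBE (b i)) :=
  @Var LM (cadd x d) (inl (inl (inr i))).
Definition varC d (i : idx c) : term (cadd x d) (SCE (c i)) :=
  @Var LM (cadd x d) (inl (inr i)).
Definition wkr d s (t : term d s) : term (cadd x d) s :=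
  tsubst (fun i => @Var LM (cadd x d) (inr i)) t.

Lemma eval_wkr d s (t : term d s) (v : V) (z : tup N d) : eval (tadd v z) (wkr t) = eval z t.
Proof. by rewrite /wkr eval_tsubst; apply: eval_ext. Qed.

(* The arguments of [rho] are written as [t(x_B) - beta(y)], as in an A-formula. *)
Record ACform (y : ctx (lsort LM)) := ACForm {
  ac_T : finType;
  ac_f : ac_T -> set_type Phi;
  ac_t : forall t, bterms (val (ac_f t)) b;
  ac_beta : forall t, bterms (val (ac_f t)) (ctxB y);
  ac_A : tup (strA E) (cadd (cadd a (ctxA y)) (Ctx (fun t => quoA E (ac_f t)))) -> Prop;
  ac_A_def : definable ac_A;
  ac_C : tup (strC E) (cadd (cmap (homeC E) (cadd b (ctxB y))) (cadd c (ctxC y))) -> Prop;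
  ac_C_def : definable ac_C }.

Arguments ac_t {y} _ _ _.
Arguments ac_beta {y} _ _ _.
Arguments ac_f {y} _ _.
Arguments ac_A {y} _ _.
Arguments ac_C {y} _ _.

Definition acC_holds y (F : ACform y) (v : V) (z : tup N y) : Prop :=
  ac_C F (tadd (nuv (tadd (tupB v) (valB z) : tup (grp (sB E)) (cadd b (ctxB y))))
    (tadd (tupC v) (valC z))).

Definition ac_rho y (F : ACform y) (v : V) (z : tup N y) :
    tup (strA E) (Ctx (fun t => quoA E (ac_f F t))) :=
  fun t => rho (E := E) (tminus (evb (ac_t F t) (tupB v)) (evb (ac_beta F t) (valB z))).

Arguments ac_rho {y} _ _ _ _.

Definition acA_holds y (F : ACform y) (v : V) (z : tup N y) : Prop :=
  ac_A F (tadd (tadd (tupA v) (valA z)) (ac_rho F v z)).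

(** [AC_sat] treats x and y alike. Then [definable_support] leaves finitely many arguments of rho,
    and [evb_cadd] brings each to the form t(x_B) - beta(y). *)
Theorem quantifier_elimination y (Q : tup N (cadd x y) -> Prop) : definable Q ->
  exists (I : finType) (F : I -> ACform y), forall v z,
    Q (tadd v z) <-> exists i, acA_holds (F i) v z /\ acC_holds (F i) v z.
Proof.
move=> [q hq]; have [my hmy] := sterm_parts y.
pose a' := cadd a (ctxA y); pose b' := cadd b (ctxB y); pose c' := cadd c (ctxC y).
pose m (i : idx (cadd x y)) : sterm a' b' c' (cadd x y i) :=
  match i with
  | inl (inl (inl j)) => @Var LA a' (inl j)
  | inl (inl (inr j)) => @Var GL b' (inl j)
  | inl (inr j) => @Var LC c' (inl j)
  | inr j => ssubst (fun k => @Var LA a' (inr k)) (fun k => @Var GL b' (inr k))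
      (fun k => @Var LC c' (inr k)) (my j)
  end.
have [I [PA [PC [hA hC hI]]]] := AC_sat hPhi q m.
have hF i : exists F : ACform y, forall v z,
   (PA i (tadd (tupA v) (valA z)) (tadd (tupB v) (valB z)) <-> acA_holds F v z) /\
   (PC i (tadd (tupB v) (valB z)) (tadd (tupC v) (valC z)) <-> acC_holds F v z).
  have [QA [hQA hQA']] := hA i; have [QC [hQC hQC']] := hC i.
  have [T [k [QT [hQT hQAT]]]] := definable_support hQA.
  exists (@ACForm y T (fun t => projT1 (k t)) (fun t => bterms_left (projT2 (k t)))
    (fun t => bterms_right (projT2 (k t))) QT hQT QC hQC) => v z.
  split; last by rewrite hQC'.
  rewrite hQA' hQAT /acA_holds /=.
  suff -> : (fun t => allrho (tadd (tupB v) (valB z)) (k t)) =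
    ac_rho (@ACForm y T (fun t => projT1 (k t)) (fun t => bterms_left (projT2 (k t)))
    (fun t => bterms_right (projT2 (k t))) QT hQT QC hQC) v z by [].
  by apply: fext => t; rewrite /allrho /ac_rho /= evb_cadd.
have [F hFi] := dep_choice hF; exists I, F => v z; rewrite -hq.
have E1 : (fun i => lookup (tadd (tupA v) (valA z)) (tadd (tupB v) (valB z))
    (tadd (tupC v) (valC z)) (m i)) = tadd v z.
  by apply: fext => -[[[i|i]|i]|i] //; rewrite -[RHS](hmy z i); exact: lookup_ssubst.
have := hI (tadd (tupA v) (valA z)) (tadd (tupB v) (valB z)) (tadd (tupC v) (valC z)).
rewrite E1 => ->.
by split=> -[i [h1 h2]]; exists i; case: (hFi i v z) => e1 e2;
  split; [apply/e1|apply/e2|apply/e1|apply/e2].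
Qed.

(** Being formulas of M themselves, the two parts of a formula can each be tested for dividing. *)
Lemma definable_acC y (F : ACform y) :
  definable (N := N) (c := cadd x y) (fun w => acC_holds F (fun i => w (inl i)) (fun i => w (inr i))).
Proof.
have h : Cset (E := E) (b := cadd b (ctxB y)) (c := cadd c (ctxC y))
    (fun vb vc => ac_C F (tadd (nuv vb) vc)).
  exists (@ac_C y F); split=> //; exact: ac_C_def.
pose rB (i : idx (cadd b (ctxB y))) : term (cadd x y) (SBE (cadd b (ctxB y) i)) :=
  match i with inl j => varB y j | inr j => wkr (termB j) end.
pose rC (i : idx (cadd c (ctxC y))) : term (cadd x y) (SCE (cadd c (ctxC y) i)) :=
  match i with inl j => varC y j | inr j => wkr (termC j) end.
apply: (K_ext (definable_closed N)) (definable_Cset h rB rC) _ => w.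
have wE : w = tadd (fun i => w (inl i)) (fun i => w (inr i)) by apply: fext => -[].
have EB : (fun i => eval w (rB i)) = tadd (tupB (fun i => w (inl i))) (valB (fun i => w (inr i))).
  by apply: fext => -[//|i] /=; rewrite {1}wE eval_wkr.
have EC : (fun i => eval w (rC i)) = tadd (tupC (fun i => w (inl i))) (valC (fun i => w (inr i))).
  by apply: fext => -[//|i] /=; rewrite {1}wE eval_wkr.
by rewrite EB EC.
Qed.

Lemma definable_acA y (F : ACform y) :
  definable (N := N) (c := cadd x y) (fun w => acA_holds F (fun i => w (inl i)) (fun i => w (inr i))).
Proof.
pose X := cadd (cadd a (ctxA y)) (Ctx (fun t => quoA E (ac_f F t))).
pose r (i : idx X) : term (cadd x y) (SAE (X i)) :=
  match i with
  | inl (inl j) => varA y j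
  | inl (inr j) => wkr (termA j)
  | inr t => @App LM (cadd x y) (Frho E (ac_f F t)) (fun k =>
      sub_termB (trB (fun i => varB y i) (ac_t F t k)) (trB (fun i => wkr (termB i)) (ac_beta F t k)))
  end.
apply: (K_ext (definable_closed N)) (definable_SA (ac_A_def F) r) _ => w.
have wE : w = tadd (fun i => w (inl i)) (fun i => w (inr i)) by apply: fext => -[].
suff -> : (fun i => eval w (r i)) = tadd (tadd (tupA (fun i => w (inl i)))
    (valA (fun i => w (inr i)))) (ac_rho F (fun i => w (inl i)) (fun i => w (inr i))) by [].
apply: fext => -[[//|i]|t] /=; first by rewrite {1}wE eval_wkr.
apply: (f_equal (@rho _ E (val (ac_f F t)))); apply: fext => k.
rewrite /tminus /=; congr (_ + - _); rewrite eval_trB; first by [].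
by apply: ev_ext => i; rewrite {1}wE eval_wkr.
Qed.

End TranslationToM.

Arguments ac_f {L Phi E a b c y} _ _.
Arguments ac_t {L Phi E a b c y} _ _ _.
Arguments ac_beta {L Phi E a b c y} _ _ _.
Arguments ac_A {L Phi E a b c y} _ _.
Arguments ac_C {L Phi E a b c y} _ _.
Arguments ac_rho {L Phi E a b c y} _ _ _ _.

(** * Cosets in C as imaginaries, and the formulas placing x_B in them *)

Section Compatibility.
Local Open Scope ring_scope.
Variables (L : lang) (Phi : set (ppformula L)) (E : expanded_ses Phi).
Variables (Gamma Delta : set (elt (Meq E))).
Hypotheses (hsub : Gamma `<=` Delta) (hDelta : Delta = dcl Delta).
Hypothesis hsat : saturated_succ (strM E) Delta.
Variables (a : arity (lsort (langA E))) (b : arity (lsort L)) (c : arity (lsort (langC E))).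
Variable u : tup (strM E) (varM a b c).
Hypothesis H1 : forall f : ppformula L, Phi f ->
  forall X : quotient (coset_rel (sC E) f), acl Gamma (elt_coset X) -> Gamma (elt_coset X).
Hypothesis H2 : Delta = dcl (partA Delta `|` partB Delta `|` partC Delta).
Local Notation LM := (langM E).
Local Notation N := (strM E).
Local Notation ME := (Meq E).
Local Notation x := (varM a b c).
Local Notation XV := (tup N x).
Local Notation SBE := (@SB L Phi E).
Local Notation nu := (@nu L E).
Implicit Types (d : ctx (lsort LM)) (f : ppformula L).
Let DN := definable_closed N.
Let DG := real_over_closed Gamma.

Lemma real_generated : Delta `<=` dcl (@real_elt _ N @` real_part Delta).
Proof.
rewrite {1}H2; apply: dcl_sub => e [[|]|] [hD [s [z hz]]].
- by exists (existT N (SA s) z); rewrite // /real_part /= /real_elt /= -[existT _ _ _]/(eltA z) -hz.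
- by exists (existT N (SBE s) z); rewrite // /real_part /= /real_elt /= -[existT _ _ _]/(eltB (E := E) z) -hz.
- by exists (existT N (SC s) z); rewrite // /real_part /= /real_elt /= -[existT _ _ _]/(eltC z) -hz.
Qed.

Definition evM d (f : ppformula L) (tz : forall k : idx (pp_ar f), term d (SBE (pp_ar f k)))
    (z : tup N d) : tup (grp (sB E)) (pp_ar f) := fun k => eval z (tz k).

Lemma coset_def d (f : ppformula L) (tz : forall k : idx (pp_ar f), term d (SBE (pp_ar f k))) :
  definable (N := ME) (c := cadd (cmap inl d) (one (inr (coset_sort E f))))
    (fun w => cls (coset_rel (sC E) f) (tmap nu (evM tz (fun i => w (inl i) : N (d i)))) = w (inr tt)).
Proof.
(* Terms of [LM] are not terms of the language of M^eq; their values are named by the quantified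
   variables [Z]. *)
pose Z := cmap SBE (pp_ar f); have hZ : finctx Z by exact: finctx_cmap (finctx_arity _).
pose ML := expand (eq_lext N).
pose y : ctx (lsort ML) := cadd (cmap inl d) (one (inr (coset_sort E f))).
pose yz : ctx (lsort ML) := cadd y (cmap inl Z).
have DM := definable_closed ME.
pose t1 : term yz (inr (coset_sort E f)) := @App ML yz (inr (coset_sort E f))
  (fun k => @App ML yz (inl (Fnu E (pp_ar f k))) (fun _ : 'I_1 => @Var ML yz (inr k))).
pose t2 : term yz (inr (coset_sort E f)) := @Var ML yz (inl (inr tt)).
have h1 (k : 'I_(alen (pp_ar f))) : definable (N := ME) (c := yz)
    (fun w => eval ((fun i => w (inl (inl i))) : tup N d) (tz k) = w (inr k)).
  have h := definable_eqn N (tsubst (fun i => @Var LM (cadd d Z) (inl i)) (tz k))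
    (@Var LM (cadd d Z) (inr k)).
  pose r (i : idx (cmap (@inl (lsort LM) (eqsort N)) (cadd d Z))) :
      var yz (cmap (@inl (lsort LM) (eqsort N)) (cadd d Z) i) :=
    match i with inl j => V (inl (inl j) : idx yz) | inr j => V (inr j : idx yz) end.
  apply: (K_ext DM) (K_ren DM r (definable_inl h)) _ => w.
  have -> : (fun i => look w (r i)) = @tadd _ N d Z (fun i => w (inl (inl i))) (fun i => w (inr i)).
    by apply: fext => -[].
  by rewrite eval_tsubst.
have h2 := K_and DM (K_forall DM h1) (definable_eqn ME t1 t2).
apply: (K_ext DM) (K_exists_fin DM (finctx_cmap _ hZ) h2) _ => w.
have key (z : tup N Z) : eval (tadd w (z : tup ME (cmap inl Z)) : tup ME yz) t1 =
    cls (coset_rel (sC E) f) (tmap nu (z : tup (grp (sB E)) (pp_ar f))) by [].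
split=> [[z [h3]]|h3].
  by rewrite key; have -> : z = evM tz (fun i => w (inl i) : N (d i)) by apply: fext => k; exact: esym (h3 k).
by exists (evM tz (fun i => w (inl i) : N (d i))).
Qed.

Lemma coset_over d (f : ppformula L) (tz : forall k : idx (pp_ar f), term d (SBE (pp_ar f k)))
    (X : quotient (coset_rel (sC E) f)) : Gamma (elt_coset X) ->
  real_over Gamma (fun z : tup N d => cls _ (tmap nu (evM tz z)) = X).
Proof.
move=> hX.
exact: (definable_over_param (z := (fun _ : unit => X) : tup ME (one (inr (coset_sort E f))))
  (definable_overW Gamma (coset_def tz)) (fun _ => hX)).
Qed.

Definition txB (f : ppformula L) (t : pp_terms f b) (k : idx (pp_ar f)) : term x (SBE (pp_ar f k)) :=
  @trB L Phi E x b (fun i => @Var LM x (inl (inr i))) _ (t k).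

Lemma evM_txB f (t : pp_terms f b) (v : XV) : evM (txB t) v = evb t (tupB v).
Proof. by apply: fext => k; rewrite /evM /txB eval_trB. Qed.

Lemma p0_plusE (f : ppformula L) (t : pp_terms f b) (v : XV) :
  ppsat (tmap nu (evals t (tminus (tupB v) (tupB u)))) <->
  coset_of_terms t v = coset_of_terms t u.
Proof.
rewrite /coset_of_terms cls_eq -(hom_tminus (nu_hom E)).
by rewrite -[evals _ _]/(evb _ _) evb_sub.
Qed.

Lemma p0_over P : p0 Gamma u P -> real_over Gamma P.
Proof.
case=> [[f [t [h ->]]]|[f [t [X [_ h ->]]]]].
  apply: (K_ext DG) (coset_over (txB t) h) _ => v.
  by rewrite evM_txB p0_plusE.
by apply: (K_not DG); apply: (K_ext DG) (coset_over (txB t) h) _ => v; rewrite evM_txB.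
Qed.

Lemma p0_nu (v w : XV) : tmap nu (tupB w) = tmap nu (tupB v) ->
  realizes_p0 Gamma u v -> realizes_p0 Gamma u w.
Proof.
move=> hvw hv P hP.
have cosetE f (t : pp_terms f b) : coset_of_terms t w = coset_of_terms t v.
  by rewrite /coset_of_terms -![evals _ _]/(evb _ _) !(hom_evb (nu_hom E)) hvw.
case: (hP) => [[f [t [h hPE]]]|[f [t [X [_ h hPE]]]]]; have := hv P hP; rewrite hPE.
  by rewrite !p0_plusE cosetE.
by rewrite cosetE.
Qed.

Definition in_coset d (f : ppformula L) (t : pp_terms f b)
    (tz : forall k : idx (pp_ar f), term d (SBE (pp_ar f k))) (w : tup N (cadd x d)) : Prop :=
  @ppsat _ (sC E) f (tmap nu (tminus (evb t (tupB (fun i => w (inl i)))) (evM tz (fun i => w (inr i))))).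

Lemma in_coset_def d f t tz : definable (N := N) (@in_coset d f t tz).
Proof.
pose Z := cmap SBE (pp_ar f).
pose r (k : idx (pp_ar f)) : term (cadd x d) (SBE (pp_ar f k)) :=
  sub_termB (trB (fun i => @varB _ _ E a b c d i) (t k)) (wkr a b c (tz k)).
apply: (K_ext DN) (definable_ppC r) _ => w.
suff -> : (fun k => eval w (r k) : grp (sB E) _) =
  tminus (evb t (tupB (fun i => w (inl i)))) (evM tz (fun i => w (inr i))) by [].
apply: fext => k; rewrite eval_sub_termB /tminus /evM eval_trB; congr (_ + - _).
by rewrite /wkr eval_tsubst.
Qed.

Lemma in_cosetE d f (t : pp_terms f b) tz v (z : tup N d) :
  in_coset t tz (tadd v z) <-> coset_of_terms t v = cls _ (tmap nu (evM tz z)).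
Proof.
by rewrite /in_coset /coset_of_terms cls_eq (hom_tminus (nu_hom E)).
Qed.

(* A coset outside [Gamma] is not algebraic over [Gamma], so it moves along an
   indiscernible sequence of pairwise different conjugates. *)
Lemma in_coset_divides d (f : set_type Phi) (t : pp_terms (val f) b) tz (v : XV) (z : tup N d) :
  finctx d -> realizes_p0 Gamma u v -> ~ E0plus Gamma u t -> in_coset t tz (tadd v z) ->
  sdivides Gamma (in_coset t tz) z.
Proof.
move=> hd hv ht hvz.
pose cl (y : tup N d) : quotient (coset_rel (sC E) (val f)) := cls _ (tmap nu (evM tz y)).
have hnG : ~ Gamma (elt_coset (cl z)).
  move=> hG; have /hv : p0 Gamma u (fun v => coset_of_terms t v <> cl z).
    by right; exists f, t, (cl z).
  by apply; apply/in_cosetE.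
have hnacl : ~ acl Gamma (elt_coset (cl z)).
  by move=> hacl; apply: hnG; exact: (H1 (set_mem (valP f)) hacl).
(* Finitely many cosets would form a finite set definable over [Gamma] and containing that of z,
   making this coset algebraic. *)
have hinf (P : tup N d -> Prop) : real_over Gamma P -> P z -> ~ finite_set (cl @` [set y | P y]).
  move=> hP hPz hfin; apply: hnacl.
  have DM := definable_over_closed Gamma.
  pose o : ctx (lsort (expand (eq_lext N))) := one (inr (coset_sort E (val f))).
  have [g hg] : definable_over Gamma (N := ME) (c := o)
      (fun w => exists y : tup N d, P y /\ cl y = w tt).
    have h1 : definable_over Gamma (N := ME) (c := cadd o (cmap inl d))
        (fun w => P (fun i => w (inr i)) /\ cl (fun i => w (inr i)) = w (inl tt)).
      apply: (K_and DM).
        exact: (K_ren DM (fun i : idx (cmap inl d) => V (inr i : idx (cadd o (cmap inl d)))) hP).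
      pose r (i : idx (cadd (cmap (@inl (lsort LM) (eqsort N)) d) o)) :
          var (cadd o (cmap inl d)) (cadd (cmap inl d) o i) :=
        match i with
        | inl j => V (inr j : idx (cadd o (cmap inl d)))
        | inr j => V (inl j : idx (cadd o (cmap inl d)))
        end.
      by apply: (K_ext DM) (K_ren DM r (definable_overW Gamma (coset_def tz))) _ => w.
    exact: (K_exists_fin DM (finctx_cmap _ hd) h1).
  exists g; split.
    apply: sub_finite_set hfin => w /= /hg[y [hy <-]].
    by exists y.
  by apply/hg; exists z.
(* A base made of the formulas over [Gamma] true at z, with finitely many cosets removed; [hinf]
   shows it to be proper. The formulas make z realize the average type, and the removed cosets make
   successive terms differ. *)
pose D : set ((tup N d -> Prop) * set (quotient (coset_rel (sC E) (val f)))) :=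
  [set p | [/\ real_over Gamma p.1, p.1 z & finite_set p.2]].
pose B (p : (tup N d -> Prop) * set (quotient (coset_rel (sC E) (val f)))) : set (tup N d) :=
  [set y | p.1 y /\ ~ p.2 (cl y)].
have FF : Filter (filter_from D B).
  apply: filter_from_filter.
    exists ((fun=> True), set0); split=> //; exact: (K_top DG).
  move=> [P S] [Q T] [/= hP1 hP2 hP3] [/= hQ1 hQ2 hQ3].
  exists ((fun y => P y /\ Q y), S `|` T).
    by split=> //=; [exact: (K_and DG)|rewrite finite_setU].
  by move=> y [/= [h1 h2] /not_orP[h3 h4]]; split; split.
have FP : ProperFilter (filter_from D B).
  apply: filter_from_proper => -[P S] [/= hP1 hP2 hP3].
  apply: contrapT => /set0P/negP/negPn/eqP h0; apply: (hinf P hP1 hP2).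
  apply: sub_finite_set hP3 => _ [y hy <-]; apply: contrapT => hS.
  have : B (P, S) y by split.
  by rewrite h0.
have [U [FU hU]] := ultraFilterLemma FP.
have [|s [hs0 hs hsU]] := @indiscernible_sequence _ N Gamma Delta hDelta hsat hsub real_generated d hd
    _ U FU id z.
  move=> P hP hUP; apply: contrapT => hPz.
  apply: (@filter_not_empty _ U _).
  have hU' : U (B ((fun y => ~ P y), set0)).
    by apply: hU; exists ((fun y => ~ P y), set0) => //; split=> //; exact: (K_not DG).
  by apply: filterS (filterI hUP hU') => y [? []].
(* Two terms suffice for inconsistency, since distinct cosets are disjoint. *)
exists s; split=> //; exists 2%N => -[v' hv'].
have /in_cosetE e0 := hv' 0%N isT; have /in_cosetE e1 := hv' 1%N isT.
pose P (l : seq (tup N d)) := cl (nth z l 0) <> cl (nth z l 1).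
suff : P (mkseq s 2) by apply; rewrite /cl /= -e0 -e1.
apply: hsU.
  pose r i k : term (cpow 2 d) (SBE (pp_ar (val f) k)) :=
    tsubst (fun j => @Var LM (cpow 2 d) (i, j)) (tz k).
  have h1 : definable (N := N) (c := cpow 2 d)
      (fun w => ~ @ppsat _ (sC E) (val f) (tmap nu (tminus (evM (r ord0) w) (evM (r ord_max) w)))).
    apply: (K_not DN).
    pose q (k : idx (pp_ar (val f))) : term (cpow 2 d) (SBE (pp_ar (val f) k)) :=
      sub_termB (r ord0 k) (r ord_max k).
    exact: (K_ext DN (definable_ppC q)).
  apply: (K_ext DG) (real_overW Gamma h1) _ => w.
  have rE i : evM (r i) w = evM tz (slice w i).
    by apply: fext => k; rewrite /evM /r eval_tsubst.
  rewrite !rE /P /cl (hom_tminus (nu_hom E)) -cls_eq.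
  have -> : nth z (lst w) 0 = slice w ord0.
    by rewrite /lst (nth_map ord0) ?size_enum_ord // (nth_ord_enum ord0 (ord0 : 'I_2)).
  have -> // : nth z (lst w) 1 = slice w ord_max.
  by rewrite /lst (nth_map ord0) ?size_enum_ord // (nth_ord_enum ord0 (ord_max : 'I_2)).
apply: (@filterS _ U _ setT); last exact: filterT.
move=> y0 _ /=.
have hU' : U (B ((fun=> True), [set cl y0])).
  by apply: hU; exists ((fun=> True), [set cl y0]) => //; split=> //=; exact: (K_top DG d).
by apply: filterS hU' => y1 [_ h]; rewrite /P /= => hc; apply: h.
Qed.

End Compatibility.

Arguments af_par {L Phi E a b D} _ _.
Arguments af_phi {L Phi E a b D} _ _.
Arguments af_t {L Phi E a b D} _ _ _.
Arguments af_beta {L Phi E a b D} _ _ _.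
Arguments cf_par {L Phi E b c D} _ _.
Arguments rho_args {L Phi E a b c D} _ _ _.

(** * A-formulas, C-formulas and elimination over Delta *)

Section DeltaFormulas.
Local Open Scope ring_scope.
Variables (L : lang) (Phi : set (ppformula L)) (E : expanded_ses Phi).
Variable Delta : set (elt (Meq E)).
Hypothesis hDelta : Delta = dcl Delta.
Variables (a : arity (lsort (langA E))) (b : arity (lsort L)) (c : arity (lsort (langC E))).
Local Notation LA := (langA E).
Local Notation LC := (langC E).
Local Notation LM := (langM E).
Local Notation N := (strM E).
Local Notation ME := (Meq E).
Local Notation x := (varM a b c).
Local Notation XV := (tup N x).
Local Notation SAE := (@SA L Phi E).
Local Notation SBE := (@SB L Phi E).
Local Notation SCE := (@SC L Phi E).
Local Notation nu := (@nu L E).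
Implicit Types (d y : ctx (lsort LM)).
Let DD := real_over_closed Delta.

Lemma real_over_param (D : set (elt ME)) d y (P : tup N (cadd d y) -> Prop) (z : tup N y) :
  real_over D P -> (forall i, D (@real_elt _ N (existT N (y i) (z i)))) ->
  real_over D (fun v => P (tadd v z)).
Proof.
move=> hP hz; have DM := definable_over_closed D.
pose e := cadd (cmap (@inl (lsort LM) (eqsort N)) d) (cmap inl y).
pose r (i : idx (cmap (@inl (lsort LM) (eqsort N)) (cadd d y))) :
    var e (cmap (@inl (lsort LM) (eqsort N)) (cadd d y) i) :=
  match i with inl j => V (inl j : idx e) | inr j => V (inr j : idx e) end.
have h := definable_over_param (z := z : tup ME (cmap inl y)) (K_ren DM r hP) hz.
apply: (K_ext DM) h _ => v.
have -> // : (fun i => look (tadd v (z : tup ME (cmap inl y)) : tup ME e) (r i)) =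
  @tadd _ N d y v z by apply: fext => -[].
Qed.

Lemma real_term y (z : tup N y) s (t : term y s) :
  (forall i, Delta (@real_elt _ N (existT N (y i) (z i)))) -> Delta (@real_elt _ N (existT N s (eval z t))).
Proof.
move=> hz; rewrite hDelta.
have h := definable_eqn N (@Var LM (cadd (one s) y) (inl tt))
  (tsubst (fun i => @Var LM (cadd (one s) y) (inr i)) t).
have [f hf] := real_over_param (real_overW Delta h) hz.
exists f => w; rewrite hf /= eval_tsubst; by [].
Qed.

Lemma Aformula_over (F : Aformula a b Delta) : real_over Delta (fun v : XV => holdsA F v).
Proof.
pose Y := csig (fun i : 'I_(af_n F) => cmap SBE (pp_ar (val (af_phi F i)))).
pose y := cadd (cmap SAE (af_ar F)) Y.
pose X := cadd (cadd (af_ar F) a) (quo_ar E (af_phi F)).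
pose r (i : idx X) : term (cadd x y) (SAE (X i)) :=
  match i with
  | inl (inl j) => @Var LM (cadd x y) (inr (inl j))
  | inl (inr j) => @varA _ _ E a b c y j
  | inr t => @App LM (cadd x y) (Frho E (af_phi F t)) (fun k =>
      sub_termB (trB (fun i => @varB _ _ E a b c y i) (af_t F t k))
        (@Var LM (cadd x y) (inr (inr (existT _ t k)))))
  end.
have h := definable_SA (definable_sat (strA E) (af_fm F)) r.
pose z : tup N y := tadd (af_par F : tup N (cmap SAE (af_ar F)))
  ((fun p => af_beta F (projT1 p) (projT2 p)) : tup N Y).
apply: (K_ext DD) (real_over_param (z := z) (real_overW Delta h) _) _ => [[j|[i k]]|v].
- exact: af_parP.
- exact: af_betaP.
rewrite /holdsA.
have -> // : (fun i => eval (tadd v z) (r i)) =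
  tadd (tadd (af_par F) (tupA v)) (rho_args F v).
apply: fext => -[[//|//]|t] /=; apply: (f_equal (@rho _ E (val (af_phi F t)))).
apply: fext => k; rewrite /tminus /=; congr (_ + - _).
by rewrite eval_trB.
Qed.

Lemma Cformula_over (F : Cformula b c Delta) : real_over Delta (fun v : XV => holdsC F v).
Proof.
pose y := cmap SCE (cf_ar F).
pose X := cadd (cadd (cmap (homeC E) b) c) (cf_ar F).
pose r (i : idx X) : term (cadd x y) (SCE (X i)) :=
  match i with
  | inl (inl j) => @App LM (cadd x y) (Fnu E (b j)) (fun _ : 'I_1 => @varB _ _ E a b c y j)
  | inl (inr j) => @varC _ _ E a b c y j
  | inr j => @Var LM (cadd x y) (inr j)
  end.
have h := definable_SC (definable_sat (strC E) (cf_fm F)) r.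
pose z : tup N y := cf_par F.
apply: (K_ext DD) (real_over_param (z := z) (real_overW Delta h) _) _ => [j|v].
  exact: cf_parP.
rewrite /holdsC.
have -> // : (fun i => eval (tadd v z) (r i)) =
  tadd (tadd (nu_tupB v) (tupC v)) (cf_par F).
by apply: fext => -[[]|].
Qed.

(** The context [y] may be infinite, whereas an A-formula has finitely many parameters: a finite
    support is extracted from the A-sorted ones, and each beta is the value of terms, which stays in
    [Delta]. *)
Lemma acA_Aformula y (F : ACform a b c y) (z : tup N y) :
  (forall i, Delta (@real_elt _ N (existT N (y i) (z i)))) ->
  exists G : Aformula a b Delta, forall v : XV, holdsA G v <-> acA_holds F v z.
Proof.
move=> hz; have DA := definable_closed (strA E).
pose T := ac_T F; pose Qc : ctx (lsort LA) := Ctx (fun t : T => quoA E (ac_f F t)).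
pose X := cadd (cadd a Qc) (ctxA y).
(* The parameters are moved last, where [definable_support] can trim them. *)
pose r0 (i : idx (cadd (cadd a (ctxA y)) Qc)) : var X (cadd (cadd a (ctxA y)) Qc i) :=
  match i with
  | inl (inl j) => V (inl (inl j) : idx X)
  | inl (inr j) => V (inr j : idx X)
  | inr j => V (inl (inr j) : idx X)
  end.
have [T2 [k2 [Q2 [hQ2 hE2]]]] := definable_support (K_ren DA r0 (ac_A_def F)).
pose ar : arity (lsort LA) := Arity (fun i : 'I_#|T2| => ctxA y (k2 (enum_val i))).
pose ph (i : 'I_#|T|) := ac_f F (enum_val i).
pose Z := cadd (cadd ar a) (quo_ar E ph).
pose r (i : idx (cadd (cadd a Qc) (csub k2))) : var Z (cadd (cadd a Qc) (csub k2) i) :=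
  match i with
  | inl (inl j) => V (inl (inr j) : idx Z)
  | inl (inr t) => ecast t (var Z (Qc t)) (enum_rankK t) (V (inr (enum_rank t) : idx Z))
  | inr t => ecast t (var Z (csub k2 t)) (enum_rankK t) (V (inl (inl (enum_rank t)) : idx Z))
  end.
have [fm0 hfm] := K_ren DA r hQ2.
have hbeta (i : 'I_#|T|) k : Delta (@eltB _ _ E _ (evb (ac_beta F (enum_val i)) (valB z) k)).
  rewrite /evb -[ev _ _](eval_trB (E := E) (@termB _ _ _ y)).
  exact: (real_term _ hz).
have hpar (i : 'I_#|T2|) : Delta (eltA (valA z (k2 (enum_val i)))) by exact: (real_term _ hz).
exists (@AFormula L Phi E a b Delta ar (fun i => valA z (k2 (enum_val i))) hpar #|T| ph
  (fun i => ac_t F (enum_val i))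
  (fun i => evb (ac_beta F (enum_val i)) (valB z)) hbeta fm0) => v.
rewrite /holdsA /= hfm /acA_holds.
set w := (X in ac_A _ X).
have -> : w = (fun i => look (tadd (tadd (tupA v) (ac_rho F v z : tup (strA E) Qc)) (valA z)) (r0 i)).
  by apply: fext => -[[]|].
rewrite hE2; set w1 := (X in Q2 X <-> _); set w2 := (X in _ <-> Q2 X).
have -> // : w1 = w2.
have rA (W : tup (strA E) Z) t : look W (r (inl (inr t))) =
    ecast t (strA E (Qc t)) (enum_rankK t) (W (inr (enum_rank t))).
  exact: (@look_ecast _ (strA E) Z Qc W _ _ (enum_rankK t)).
have rB (W : tup (strA E) Z) t : look W (r (inr t)) =
    ecast t (strA E (csub k2 t)) (enum_rankK t) (W (inl (inl (enum_rank t)))).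
  exact: (@look_ecast _ (strA E) Z (csub k2) W _ _ (enum_rankK t)).
apply: fext => -[[//|t]|t]; rewrite /w1 /w2 ?rA ?rB.
  exact: (tup_ecast (ac_rho F v z : tup (strA E) Qc) (enum_rankK t)).
exact: (tup_ecast ((fun t => valA z (k2 t)) : tup (strA E) (csub k2)) (enum_rankK t)).
Qed.

Lemma acC_Cformula y (F : ACform a b c y) (z : tup N y) :
  (forall i, Delta (@real_elt _ N (existT N (y i) (z i)))) ->
  exists G : Cformula b c Delta, forall v : XV, holdsC G v <-> acC_holds F v z.
Proof.
move=> hz; have DC := definable_closed (strC E).
pose Y := cadd (cmap (homeC E) (ctxB y)) (ctxC y).
pose X0 := cadd (cmap (homeC E) b) c; pose X := cadd X0 Y.
pose W := cadd (cmap (homeC E) (cadd b (ctxB y))) (cadd c (ctxC y)).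
pose r0 (i : idx W) : var X (W i) :=
  match i with
  | inl (inl j) => V (inl (inl j) : idx X)
  | inl (inr j) => V (inr (inl j) : idx X)
  | inr (inl j) => V (inl (inr j) : idx X)
  | inr (inr j) => V (inr (inr j) : idx X)
  end.
have [T [k [Q [hQ hE]]]] := definable_support (K_ren DC r0 (ac_C_def F)).
pose ar : arity (lsort LC) := Arity (fun i : 'I_#|T| => Y (k (enum_val i))).
pose Z := cadd X0 ar.
pose r (i : idx (cadd X0 (csub k))) : var Z (cadd X0 (csub k) i) :=
  match i with
  | inl j => V (inl j : idx Z)
  | inr t => ecast t (var Z (csub k t)) (enum_rankK t) (V (inr (enum_rank t) : idx Z))
  end.
have [fm0 hfm] := K_ren DC r hQ.
pose pz : tup (strC E) Y := tadd (nuv (valB z)) (valC z).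
have hpz q : Delta (eltC (pz q)).
  case: q => p; last exact: (real_term _ hz).
  exact: (real_term (@App LM y (Fnu E (ctxB y p)) (fun _ : 'I_1 => termB p)) hz).
exists (@CFormula L Phi E b c Delta ar (fun i => pz (k (enum_val i))) (fun i => hpz _) fm0) => v.
rewrite /holdsC /= hfm /acC_holds.
set w := (X in ac_C _ X).
have -> : w = (fun i => look (tadd (tadd (nu_tupB v) (tupC v) : tup (strC E) X0) pz) (r0 i)).
  by apply: fext => -[[]|[]].
rewrite hE; set w1 := (X in Q X <-> _); set w2 := (X in _ <-> Q X).
have -> // : w1 = w2.
have rE (w0 : tup (strC E) Z) t : look w0 (r (inr t)) =
    ecast t (strC E (csub k t)) (enum_rankK t) (w0 (inr (enum_rank t))).
  exact: (@look_ecast _ (strC E) Z (csub k) w0 _ _ (enum_rankK t)).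
apply: fext => -[//|t]; rewrite /w1 /w2 rE.
exact: (tup_ecast ((fun t => pz (k t)) : tup (strC E) (csub k)) (enum_rankK t)).
Qed.

Hypothesis hPhi : fundamental_system (sB E) Phi.
Hypothesis H2 : Delta = dcl (partA Delta `|` partB Delta `|` partC Delta).

(** All real elements of [Delta] are taken at once as the tuple of parameters, and cut down to
    finitely many only afterwards. *)
Theorem Delta_elimination (P : XV -> Prop) : real_over Delta P ->
  exists (I : finType) (F : I -> Aformula a b Delta) (G : I -> Cformula b c Delta),
  forall v, P v <-> exists i, holdsA (F i) v /\ holdsC (G i) v.
Proof.
move=> hP.
have [Q [hQ hPQ]] := (definable_overE _ _).1 (real_definable (real_generated H2) hP).
have [I [F hF]] := quantifier_elimination hPhi hQ.
pose z := tpar (D := real_part Delta).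
have hz i : Delta (@real_elt _ N (existT N (cpar (real_part Delta) i) (z i))).
  by case: i => e he; have := set_mem he; rewrite /real_part /= /z /tpar /=; case: e {he}.
have [FA hA] := dep_choice (fun i => acA_Aformula (F i) hz).
have [FC hC] := dep_choice (fun i => acC_Cformula (F i) hz).
exists I, FA, FC => v; rewrite hPQ hF.
by split=> -[i [h1 h2]]; exists i; split; first [exact/hA|exact/hC].
Qed.

End DeltaFormulas.

(** * Avoiding dividing formulas, and gluing nonforking realizations *)

Section ExtendAvoiding.
Variables (L : lang) (N : structure L).
Variables (Gamma Delta : set (elt (meq N))).
Hypotheses (hDelta : Delta = dcl Delta) (hsat : saturated_succ N Delta).
Hypothesis hsub : Gamma `<=` Delta.
Hypothesis hreal : Delta `<=` dcl (@real_elt L N @` real_part Delta).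
Variables (x : ctx (lsort L)) (hx : finctx x).
Let DG := real_over_closed Gamma.
Let DD := real_over_closed Delta.

(** A filler: conditions that come from tp(v/Delta) contribute no disjunct to the covering by
    dividing formulas. *)
Lemma divform_false : exists g : divform Gamma x (real_over Gamma), forall v, ~ dv_holds g v.
Proof.
pose y : ctx (lsort L) := Ctx (fun i : void => match i with end).
have hy : finctx y by exists void, id, id.
pose d : tup N y := fun i => match i with end.
have hd : sdivides Gamma (x := x) (fun _ : tup N (cadd x y) => False) d.
  by exists (fun=> d); split=> //; exists 1%N => -[v /(_ 0%N isT)].
by exists (DivForm hy (K_prop DG _ False) hd) => v.
Qed.

(* Otherwise, by compactness, [tp(v/Delta)] would imply a finite disjunction of
   formulas dividing over [Gamma]. *)
Lemma extend_avoiding v m (y : 'I_m -> ctx (lsort L)) (d : forall j, tup N (y j)) :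
  (forall j, finctx (y j)) -> ~ @sforks L N Gamma Delta x (real_over Gamma) v ->
  exists v1, (forall P, real_over Delta P -> P v -> P v1) /\
    forall j Q, real_over Gamma Q -> sdivides Gamma Q (d j) -> ~ Q (tadd v1 (d j)).
Proof.
(* The tuples [d j] may lie outside [Delta]; gathered into one finite tuple, they serve as
   additional parameters. *)
move=> hy hv; pose F := csig y; pose z : tup N F := fun p => d (projT1 p) (projT2 p).
have hF : finctx F by apply: finctx_csig.
pose part1 (w : tup N (cadd x F)) : tup N x := fun i => w (inl i).
pose part2 j (w : tup N (cadd x F)) : tup N (y j) := fun k => w (inr (existT _ j k)).
pose kind1 R := exists2 P, real_over Delta P /\ P v & R = fun w => P (part1 w).
pose kind2 R := exists j (Q : tup N (cadd x (y j)) -> Prop),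
  [/\ real_over Gamma Q, sdivides Gamma Q (d j) & R = fun w => ~ Q (tadd (part1 w) (part2 j w))].
have [|n R hR|v1 hv1] := @saturation_param _ N Delta hDelta hsat hreal x F z
    [set R | kind1 R \/ kind2 R] hx hF.
- move=> R [[P [hP _] ->]|[j [Q [hQ _ ->]]]].
    exact: (K_ren DD (fun i : idx x => V (inl i : idx (cadd x F))) hP).
  apply: (K_not DD).
  pose r (i : idx (cadd x (y j))) : var (cadd x F) (cadd x (y j) i) :=
    match i with
    | inl k => V (inl k : idx (cadd x F))
    | inr k => V (inr (existT _ j k) : idx (cadd x F))
    end.
  have hQ' := definable_over_sub hsub hQ.
  apply: (K_ext DD) (K_ren DD r hQ') _ => w.
  have -> // : (fun i => look w (r i)) = tadd (part1 w) (part2 j w) by apply: fext => -[].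
- apply: contrapT => hno; apply: hv.
  have [g0 hg0] := divform_false.
  have h i : exists P (g : divform Gamma x (real_over Gamma)), [/\ real_over Delta P, P v &
      forall w, P w -> ~ dv_holds g w -> R i (tadd w z)].
    case: (hR i) => [[P [hP hPv] ->]|[j [Q [hQ hQd ->]]]]; first by exists P, g0.
    by exists (fun=> True), (DivForm (hy j) hQ hQd); split=> //; exact: (K_top DD).
  have [P h1] := dep_choice h; have [g h2] := dep_choice h1.
  exists (fun w => forall i, P i w), n, g; split.
  + by apply: (K_forall DD) => i; case: (h2 i).
  + by move=> i; case: (h2 i).
  move=> w hw; apply: contrapT => /forallNP hg; apply: hno; exists w => i.
  by case: (h2 i) => _ _; apply; [exact: hw|exact: hg].
exists v1; split=> [P hP hPv|j Q hQ hQd].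
  by apply: (hv1 (fun w => P (part1 w))); left; exists P.
by apply: (hv1 (fun w => ~ Q (tadd (part1 w) (part2 j w)))); right; exists j, Q.
Qed.

End ExtendAvoiding.

Section Combination.
Local Open Scope ring_scope.
Variables (L : lang) (Phi : set (ppformula L)) (E : expanded_ses Phi).
Hypothesis hPhi : fundamental_system (sB E) Phi.
Variables (Gamma Delta : set (elt (Meq E))).
Hypotheses (hsub : Gamma `<=` Delta) (hDelta : Delta = dcl Delta).
Hypothesis hsat : saturated_succ (strM E) Delta.
Variables (a : arity (lsort (langA E))) (b : arity (lsort L)) (c : arity (lsort (langC E))).
Variable u : tup (strM E) (varM a b c).
Hypothesis H1 : forall f : ppformula L, Phi f ->
  forall X : quotient (coset_rel (sC E) f), acl Gamma (elt_coset X) -> Gamma (elt_coset X).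
Hypothesis H2 : Delta = dcl (partA Delta `|` partB Delta `|` partC Delta).
Local Notation GL := (group_lang L).
Local Notation LM := (langM E).
Local Notation N := (strM E).
Local Notation x := (varM a b c).
Local Notation XV := (tup N x).
Local Notation SAE := (@SA L Phi E).
Local Notation SBE := (@SB L Phi E).
Local Notation nu := (@nu L E).
Local Notation io := (@iota L E).
Implicit Types (d y : ctx (lsort LM)) (f : ppformula L).
Let DG := real_over_closed Gamma.
Let DD := real_over_closed Delta.

(** The shift by iota(al) is invisible to nu, so the C-data of v' survive, while [al] is free to
    bring v'_B close to v_B modulo the subgroups phi(B). *)
Definition shifted (v v' : XV) (al : tup (grp (sA E)) b) : XV :=
  mkV (tupA v) (tminus (tupB v') (tmap io al)) (tupC v').

Lemma nu_shifted v v' al : tmap nu (tupB (shifted v v' al)) = tmap nu (tupB v').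
Proof. exact: (nu_tmap_iota (tupB v') al). Qed.

Definition shift_ok (v v' : XV) f (t : bterms f b) (al : tup (grp (sA E)) b) : Prop :=
  ppsat (evb t (tminus (tminus (tupB v') (tmap io al)) (tupB v))).

(** The finitely many congruences form one p.p.-formula, satisfied in C by nu(v'_B - v_B); [nu_pp]
    then produces the correction in A. *)
Lemma combine_fin (v v' : XV) (T : finType) (f : T -> ppformula L) (t : forall i, bterms (f i) b) :
  (forall i, ppsat (tmap nu (tminus (evb (@t i) (tupB v')) (evb (@t i) (tupB v))))) ->
  exists al, forall i, shift_ok v v' (@t i) al.
Proof.
move=> h.
have [g [hg hg']] := @bigand_pp L b T [set: T]%SET (fun i => @fsubst GL _ (pp_fm (f i)) b (@t i))
  (fun i => eq_trans (is_pp_fsubst _ _) (pp_pp (f i))).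
have : gsat g (tmap nu (tminus (tupB v') (tupB v))).
  apply/hg' => i _; apply/gsat_fsubst; apply: ppsat_ext (h i) => k.
  by rewrite -evb_sub (hom_evb (nu_hom E)).
move=> /(nu_pp_ctx _ (finctx_arity b) hg)[al /hg' hal].
exists al => i; have /gsat_fsubst := hal i (finset.in_setT i); apply: ppsat_ext => k.
rewrite /evb; apply: ev_ext => j; rewrite /tminus; exact: addrAC.
Qed.

Definition same_side (v w : XV) : Prop :=
  forall (f : set_type Phi) (t : pp_terms (val f) b), E0plus Gamma u t ->
    ppsat (tminus (evb t (tupB w)) (evb t (tupB v))).

Lemma p0_agree v v' : realizes_p0 Gamma u v -> realizes_p0 Gamma u v' ->
  forall (f : set_type Phi) (t : pp_terms (val f) b), E0plus Gamma u t ->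
  ppsat (tmap nu (tminus (evb t (tupB v')) (evb t (tupB v)))).
Proof.
move=> hv hv' f t ht.
have plus w : realizes_p0 Gamma u w -> ppsat (tmap nu (evb t (tminus (tupB w) (tupB u)))).
  move=> hw; apply: (hw (fun v => ppsat (tmap nu (evals t (tminus (tupB v) (tupB u)))))).
  by left; exists f, t.
apply: ppsat_ext (ppsatB (plus _ hv') (plus _ hv)) => k.
rewrite !(hom_evb (nu_hom E)) !(hom_tminus (nu_hom E)) !evb_sub !(hom_evb (nu_hom E)).
by rewrite /tminus opprB addrA subrK.
Qed.

Lemma combine v v' : realizes_p0 Gamma u v -> realizes_p0 Gamma u v' ->
  exists w, [/\ tupA w = tupA v, tupC w = tupC v', tmap nu (tupB w) = tmap nu (tupB v') &
    same_side v w].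
Proof.
move=> hv hv'.
pose y : ctx (lsort LM) := Ctx (fun i : idx b => SAE (homeA E (b i))).
have hy : finctx y by exact: finctx_arity b.
(* v and v' are parameters outside [Delta]; the unknown tuple is [al], in the A-sorts of [y]. *)
pose F := cadd x x; have hF : finctx F by apply: finctx_cadd; exact: finctx_varM.
pose z : tup N F := tadd v v'.
pose tv' i := @Var LM (cadd y F) (inr (inr (inl (inr i)))) : term (cadd y F) (SBE (b i)).
pose tv i := @Var LM (cadd y F) (inr (inl (inl (inr i)))) : term (cadd y F) (SBE (b i)).
pose tal i := @App LM (cadd y F) (Fiota E (b i)) (fun _ : 'I_1 => @Var LM (cadd y F) (inl i))
  : term (cadd y F) (SBE (b i)).
pose r i := sub_termB (sub_termB (tv' i) (tal i)) (tv i).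
have rE i (w : tup N (cadd y F)) : eval w (r i) = (w (inr (inr (inl (inr i)))) - io (w (inl i)))
    - w (inr (inl (inl (inr i)))) :> grp (sB E) (b i) by [].
pose R f (t : bterms f b) (w : tup N (cadd y F)) := ppsat (evb t (fun i => eval w (r i))).
have [|n Q hQ|al hal] := @saturation_param _ N Delta hDelta hsat (real_generated H2) y F z
    [set Q | exists (f : set_type Phi) (t : pp_terms (val f) b), E0plus Gamma u t /\ Q = @R (val f) t]
    hy hF.
- move=> _ [f [t [_ ->]]]; apply: real_overW.
  have h : @definable GL (astr (sB E)) b (fun z => ppsat (evb t z)).
    by exists (@fsubst GL _ (pp_fm (val f)) b t) => w; exact: (@gsat_fsubst L (sB E)).
  exact: (definable_SB h r).
- have [f h1] := dep_choice hQ; have [t h2] := dep_choice h1.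
  have [|al hal] := @combine_fin v v' 'I_n (fun i => val (f i)) t.
    by move=> i; apply: p0_agree; case: (h2 i).
  exists al => i; case: (h2 i) => _ ->; apply: ppsat_ext (hal i) => k.
  by rewrite /evb; apply: ev_ext => j; rewrite rE.
exists (shifted v v' al); split=> //; first exact: nu_shifted.
move=> f t ht.
have := hal _ (ex_intro _ f (ex_intro _ t (conj ht erefl))).
rewrite /R -evb_sub; apply: ppsat_ext => k.
by rewrite /evb; apply: ev_ext => j; rewrite rE.
Qed.

(** Where P holds, [rho_congr] applies. Elsewhere both sides take the default value; for w this is
    seen on v', which has the same image under nu. *)
Lemma rho_transfer f (t : bterms f b) be (P : Prop) (v v' w : XV) :
  tmap nu (tupB w) = tmap nu (tupB v') ->
  (P -> ppsat (tminus (evb t (tupB w)) (evb t (tupB v)))) ->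
  (~ P -> ~ ppsat (tmap nu (tminus (evb t (tupB v)) be)) /\
          ~ ppsat (tmap nu (tminus (evb t (tupB v')) be))) ->
  rho (E := E) (tminus (evb t (tupB w)) be) = rho (E := E) (tminus (evb t (tupB v)) be).
Proof.
move=> hn h1 h2; case: (pselect P) => hP.
  apply: rho_congr; apply: ppsat_ext (h1 hP) => k.
  by rewrite /tminus opprB addrA subrK.
have [n1 n2] := h2 hP; rewrite !rho_out //.
by rewrite (hom_tminus (nu_hom E)) (hom_evb (nu_hom E)) hn -(hom_evb (nu_hom E)) -(hom_tminus (nu_hom E)).
Qed.

Definition avoids_cosets (v : XV) : Prop :=
  forall (f : set_type Phi) (t : pp_terms (val f) b) (be : tup (grp (sB E)) (pp_ar (val f))),
  ~ E0plus Gamma u t -> (forall k, Delta (@eltB _ _ E _ (be k))) ->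
  ~ ppsat (tmap nu (tminus (evb t (tupB v)) be)).

Lemma nonforking_avoids v : nonforking_realization Gamma Delta u v -> avoids_cosets v.
Proof.
move=> [hv hf] f t be ht hbe hp; apply: hf.
pose d : ctx (lsort LM) := cmap SBE (pp_ar (val f)); have hd : finctx d by exact: finctx_cmap (finctx_arity _).
pose tz (k : idx (pp_ar (val f))) : @term LM d (SBE (pp_ar (val f) k)) := @Var LM d k.
have hin : in_coset t tz (tadd v (be : tup N d)) by [].
have hdiv := in_coset_divides hsub hDelta hsat H1 H2 hd hv ht hin.
have hQ := real_overW Gamma (in_coset_def a c t tz).
apply: (forks_intro (x := x)).
exists (fun v => in_coset t tz (tadd v (be : tup N d))), 1%N,
  (fun=> DivForm hd hQ hdiv); split=> //.
  by apply: (real_over_param (real_overW Delta (in_coset_def a c t tz))).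
by move=> w hw; exists ord0.
Qed.

Lemma tpA_combine (v v' w : XV) : tupA w = tupA v -> tmap nu (tupB w) = tmap nu (tupB v') ->
  same_side v w -> avoids_cosets v -> avoids_cosets v' -> tpA Delta w = tpA Delta v.
Proof.
move=> hA hn hs hv hv'; apply/seteqP.
have key (F : Aformula a b Delta) : rho_args F w = rho_args F v.
  apply: fext => i; apply: (rho_transfer (v' := v') (P := E0plus Gamma u (af_t F i))) => //.
    exact: hs.
  move=> hP; split; [apply: hv|apply: hv'] => // k;
    exact: (@af_betaP _ _ _ _ _ _ F i k).
by split=> F; rewrite /tpA /= /holdsA key hA.
Qed.

Lemma tpC_combine (v' w : XV) : tupC w = tupC v' -> tmap nu (tupB w) = tmap nu (tupB v') ->
  tpC Delta w = tpC Delta v'.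
Proof.
by move=> hC hn; apply/seteqP; split=> F; rewrite /tpC /= /holdsC /nu_tupB hC hn.
Qed.

Lemma real_over_eq (v v1 : XV) : (forall P, real_over Delta P -> P v -> P v1) ->
  forall P, real_over Delta P -> P v <-> P v1.
Proof.
move=> h P hP; split; first exact: h.
by move=> h1; apply: contrapT => h2; exact: (h _ (K_not DD hP) h2).
Qed.

Lemma real_over_tpA (v v1 : XV) : (forall P, real_over Delta P -> P v -> P v1) ->
  tpA Delta v1 = tpA Delta v.
Proof.
move=> h; apply/seteqP; split=> F; have := real_over_eq h (Aformula_over c F);
  by rewrite /tpA /= => ->.
Qed.

Lemma real_over_tpC (v v1 : XV) : (forall P, real_over Delta P -> P v -> P v1) ->
  tpC Delta v1 = tpC Delta v.
Proof.
move=> h; apply/seteqP; split=> F; have := real_over_eq h (Cformula_over a F);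
  by rewrite /tpC /= => ->.
Qed.

Lemma acA_transfer y (F : ACform a b c y) (z : tup N y) (P : ac_T F -> Prop) (v v' w : XV) :
  tupA w = tupA v -> tmap nu (tupB w) = tmap nu (tupB v') ->
  (forall t, P t -> ppsat (tminus (evb (ac_t F t) (tupB w)) (evb (ac_t F t) (tupB v)))) ->
  (forall t, ~ P t ->
    ~ ppsat (tmap nu (tminus (evb (ac_t F t) (tupB v)) (evb (ac_beta F t) (valB z)))) /\
    ~ ppsat (tmap nu (tminus (evb (ac_t F t) (tupB v')) (evb (ac_beta F t) (valB z))))) ->
  acA_holds F w z <-> acA_holds F v z.
Proof.
move=> hA hn h1 h2; rewrite /acA_holds hA.
have -> // : ac_rho F w z = ac_rho F v z.
by apply: fext => t; apply: (rho_transfer (v' := v') hn (h1 t) (h2 t)).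
Qed.

Lemma acC_transfer y (F : ACform a b c y) (z : tup N y) (v w : XV) :
  tupC w = tupC v -> tmap nu (tupB w) = tmap nu (tupB v) ->
  acC_holds F w z <-> acC_holds F v z.
Proof.
move=> hC hn; rewrite /acC_holds hC.
have nuE (v0 : XV) : nuv (E := E) (tadd (tupB v0) (valB z) : tup (grp (sB E)) (cadd b (ctxB y))) =
    @tadd _ (grp (sC E)) b (ctxB y) (tmap nu (tupB v0)) (tmap nu (valB z)).
  by apply: fext => -[].
by rewrite !nuE hn.
Qed.

Lemma not_sforks v : nonforking_realization Gamma Delta u v ->
  ~ @sforks _ N Gamma Delta x (real_over Gamma) v.
Proof. by move=> [_ hf] hs; apply: hf; apply: (forks_intro (x := x)). Qed.

Lemma p0_real_over (v v1 : XV) : (forall P, real_over Delta P -> P v -> P v1) ->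
  realizes_p0 Gamma u v -> realizes_p0 Gamma u v1.
Proof.
move=> h hv P hP; apply: h; last exact: hv.
exact: definable_over_sub hsub (p0_over hP).
Qed.

Lemma avoids_real_over (v v1 : XV) : (forall P, real_over Delta P -> P v -> P v1) ->
  avoids_cosets v -> avoids_cosets v1.
Proof.
move=> h hv f t be ht hbe.
pose d : ctx (lsort LM) := cmap SBE (pp_ar (val f)).
pose tz (k : idx (pp_ar (val f))) : @term LM d (SBE (pp_ar (val f) k)) := @Var LM d k.
have hQ : real_over Delta (fun v : XV => in_coset t tz (tadd v (be : tup N d))).
  by apply: (real_over_param (real_overW Delta (in_coset_def a c t tz))).
exact: (h _ (K_not DD hQ) (hv f t be ht hbe)).
Qed.

Theorem nonforking_combine v v' :
  nonforking_realization Gamma Delta u v -> nonforking_realization Gamma Delta u v' ->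
  exists w, [/\ nonforking_realization Gamma Delta u w,
    tpA Delta w = tpA Delta v & tpC Delta w = tpC Delta v'].
Proof.
move=> nv nv'.
have av := nonforking_avoids nv.
have av' := nonforking_avoids nv'.
have [w [wA wC wB ws]] := combine nv.1 nv'.1.
have tA := tpA_combine wA wB ws av av'; have tC := tpC_combine wC wB.
exists w; split=> //; split; first exact: p0_nu wB nv'.1.
move=> /(forks_elim (finctx_varM a b c) hDelta hsat hsub (real_generated H2))[P [n [g [hP hPw hg]]]].
(* The new realization keeps the type over [Delta] and satisfies no formula over [Gamma] that
   divides at the parameters of some [g j]. *)
have ext v0 : nonforking_realization Gamma Delta u v0 -> exists v1 : XV,
   [/\ forall P, real_over Delta P -> P v0 -> P v1, realizes_p0 Gamma u v1,
     avoids_cosets v1 &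
     forall j Q, real_over Gamma Q -> sdivides Gamma Q (dv_d (g j)) -> ~ Q (tadd v1 (dv_d (g j)))].
  move=> nv0; have [v1 [e1 d1]] := extend_avoiding hDelta hsat hsub (real_generated H2)
    (finctx_varM a b c) (fun j => dv_d (g j)) (fun j => dv_fin (g j)) (not_sforks nv0).
  exists v1; split=> //; first exact: p0_real_over e1 nv0.1.
  exact: avoids_real_over e1 (nonforking_avoids nv0).
have [v1 [e1 p1 av1 d1]] := ext v nv; have [v1' [e1' p1' av1' d1']] := ext v' nv'.
have [w1 [w1A w1C w1B w1s]] := combine p1 p1'.
(* [w1] has the A- and C-types of [w], so it satisfies [P] by elimination over [Delta], and with it
   one of the [g j]. *)
have tA1 : tpA Delta w1 = tpA Delta w.
  by rewrite (tpA_combine w1A w1B w1s av1 av1') (real_over_tpA e1) tA.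
have tC1 : tpC Delta w1 = tpC Delta w.
  by rewrite (tpC_combine w1C w1B) (real_over_tpC e1') tC.
have hPw1 : P w1.
  have [I [F [G hFG]]] := Delta_elimination hDelta hPhi H2 hP.
  have [i [hF hG]] := (hFG w).1 hPw.
  apply/hFG; exists i; split.
    by have : tpA Delta w (F i) := hF; rewrite -tA1.
  by have : tpC Delta w (G i) := hG; rewrite -tC1.
have [j hj] := hg _ hPw1.
have [s [hs0 hs [m hm]]] := dv_div (g j).
have [I [FF hFF]] := quantifier_elimination hPhi (dv_def (g j)).
have [i [hA hC]] := (hFF _ _).1 hj.
set y := dv_y (g j) in s hs0 hs hm FF hFF hA hC.
set F := FF i in hA hC.
pose E0 t := E0plus Gamma u (ac_t F t).
pose tz t (k : idx (pp_ar (val (ac_f F t)))) : term y (SBE (pp_ar (val (ac_f F t)) k)) :=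
  @trB L Phi E y (ctxB y) (@termB _ _ _ y) _ (ac_beta F t k).
have tzE t (z : tup N y) : evM (tz t) z = evb (ac_beta F t) (valB z).
  by apply: fext => k; rewrite /evM /tz eval_trB.
pose theta (v0 : XV) := forall t, E0 t ->
  coset_of_terms (ac_t F t) v0 = coset_of_terms (ac_t F t) u.
(* [chi] expresses over [Gamma] what gluing requires of the finitely many terms of [F]: the
   congruences of p_0, and avoidance of the cosets given by the parameters. *)
pose chi (W : tup N (cadd x y)) := theta (fun i => W (inl i)) /\
  forall t, ~ E0 t -> ~ in_coset (ac_t F t) (tz t) W.
have theta_p0 v0 : realizes_p0 Gamma u v0 -> theta v0.
  move=> hv0 t ht; apply/p0_plusE.
  apply: (hv0 (fun v => ppsat (tmap nu (evals (ac_t F t) (tminus (tupB v) (tupB u)))))).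
  by left; exists (ac_f F t), (ac_t F t).
have chi_def : real_over Gamma chi.
  apply: (K_and DG).
    have h : real_over Gamma theta.
      apply: (K_finforall DG) => t; case: (pselect (E0 t)) => ht.
        have h := coset_over (txB a c (ac_t F t)) ht.
        apply: (K_ext DG) h _ => v0.
        by rewrite evM_txB; split=> [h _|/(_ ht)].
      by apply: (K_ext DG) (K_top DG x) _ => v0; split.
    exact: (K_ren DG (fun i : idx x => V (inl i : idx (cadd x y))) h).
  apply: (K_finforall DG) => t; apply: (K_imp DG) (K_prop DG _ _) (K_not DG _).
  exact: real_overW (in_coset_def a c (ac_t F t) (tz t)).
have chi_out v0 (z : tup N y) t : chi (tadd v0 z) -> ~ E0 t ->
    ~ ppsat (tmap nu (tminus (evb (ac_t F t) (tupB v0)) (evb (ac_beta F t) (valB z)))).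
  by move=> [_ h] /h; rewrite /in_coset tzE.
have chi_ext v0 : realizes_p0 Gamma u v0 ->
    (forall Q, real_over Gamma Q -> sdivides Gamma Q (dv_d (g j)) -> ~ Q (tadd v0 (dv_d (g j)))) ->
    chi (tadd v0 (dv_d (g j))).
  move=> hv0 hd0; split; first exact: theta_p0.
  move=> t ht hin; apply: (hd0 _ (real_overW Gamma (in_coset_def a c (ac_t F t) (tz t))) _ hin).
  exact: (in_coset_divides hsub hDelta hsat H1 H2 (dv_fin (g j)) hv0 ht hin).
have chi1 := chi_ext _ p1 (d1 j); have chi1' := chi_ext _ p1' (d1' j).
(* Since [S] holds at [v0] and does not divide, it is consistent along the sequence. *)
have spread v0 (S : tup N (cadd x y) -> Prop) : real_over Gamma S ->
    (forall Q, real_over Gamma Q -> sdivides Gamma Q (dv_d (g j)) -> ~ Q (tadd v0 (dv_d (g j)))) ->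
    S (tadd v0 (dv_d (g j))) -> exists vs, forall k, (k < m)%N -> S (tadd vs (s k)).
  move=> hS hd0 hSv; apply: contrapT => hno; apply: (hd0 S hS _ hSv).
  by exists s; split=> //; exists m.
(* [chi] accompanies the A-part, and below the C-part, so that the solutions found along the
   sequence can be glued in turn. *)
have [vs hvs] : exists vs, forall k, (k < m)%N -> chi (tadd vs (s k)) /\ acA_holds F vs (s k).
  apply: (spread v1 (fun W => chi W /\ acA_holds F (fun i => W (inl i)) (fun i => W (inr i)))).
  - by apply: (K_and DG chi_def); apply: real_overW; exact: definable_acA.
  - exact: d1.
  split=> //; apply/(acA_transfer (P := E0) (v' := v1') w1A w1B) => // t ht.
    exact: w1s.
  by split; [exact: chi_out chi1 ht|exact: chi_out chi1' ht].
have [vs' hvs'] : exists vs, forall k, (k < m)%N -> chi (tadd vs (s k)) /\ acC_holds F vs (s k).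
  apply: (spread v1' (fun W => chi W /\ acC_holds F (fun i => W (inl i)) (fun i => W (inr i)))).
  - by apply: (K_and DG chi_def); apply: real_overW; exact: definable_acC.
  - exact: d1'.
  by split=> //; apply/(acC_transfer _ _ w1C w1B).
(* The congruences [theta] for [vs] and [vs'] are read at the first term of the sequence, which
   requires m > 0. *)
case: (posnP m) => [m0|m0]; first by apply: hm; exists vs => k; rewrite m0.
pose T0 := {t : ac_T F | `[< E0 t >]}.
(* One [al] serves all k < m, because the congruences compare [vs] with [vs'] without involving the
   [s k]. *)
have [|al hal] := @combine_fin vs vs' T0 (fun t => val (ac_f F (val t)))
    (fun t => ac_t F (val t)).
  move=> [t /= ht]; rewrite (hom_tminus (nu_hom E)); apply/cls_eq.
  have [[h1 _] _] := hvs 0%N m0; have [[h2 _] _] := hvs' 0%N m0.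
  have := h1 t (asboolW ht); have := h2 t (asboolW ht).
  rewrite /coset_of_terms => q2 q1; exact: etrans q2 (esym q1).
apply: hm; exists (shifted vs vs' al) => k hk.
have [c1 hA1] := hvs k hk; have [c2 hC1] := hvs' k hk.
apply/hFF; exists i; split; last by apply/(acC_transfer F (s k) _ (nu_shifted vs vs' al)).
apply/(acA_transfer (P := E0) (v := vs) (v' := vs') _ (nu_shifted vs vs' al)) => // t ht.
  have := hal (exist _ t (asboolT ht)); rewrite /shift_ok /= evb_sub.
  by apply: ppsat_ext => k0.
by split; [exact: chi_out c1 ht|exact: chi_out c2 ht].
Qed.

End Combination.

(** * Topology of the spaces of types, and the homeomorphism *)

Lemma continuous_subbase (X Y : topologicalType) (B : set (set Y)) (f : X -> Y) :
  (forall U : set Y, open U -> exists2 D, D `<=` finI_from B id & \bigcup_(A in D) A = U) ->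
  (forall A, B A -> open (f @^-1` A)) -> continuous f.
Proof.
move=> hB hf; apply/continuousP => U /hB[D hD <-].
rewrite preimage_bigcup; apply: bigcup_open => A /hD[F hF <-].
rewrite preimage_bigcap openE => x hx; apply: filter_bigI => C CF.
by apply: open_nbhs_nbhs; split; [apply: hf; exact: set_mem (hF _ CF)|exact: hx].
Qed.

Section Spaces.
Variables (L : lang) (Phi : set (ppformula L)) (E : expanded_ses Phi).
Variables (a : arity (lsort (langA E))) (b : arity (lsort (langB L))) (c : arity (lsort (langC E))).
Variables (G D : set (elt (Meq E))) (u : tup (strM E) (varM a b c)).

Lemma open_Sf (f : formula_over D (varMeq a b c)) : open [set p : Sf G D u | sval p f].
Proof.
exists [set [set p : Sf G D u | sval p f]]; last by rewrite bigcup_set1.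
by move=> _ ->; apply: finI_from1; exists f.
Qed.

Lemma open_Af (f : Aformula a b D) : open [set p : Af G D u | sval p f].
Proof.
exists [set [set p : Af G D u | sval p f]]; last by rewrite bigcup_set1.
by move=> _ ->; apply: finI_from1; exists f.
Qed.

Lemma open_Cf (f : Cformula b c D) : open [set p : Cf G D u | sval p f].
Proof.
exists [set [set p : Cf G D u | sval p f]]; last by rewrite bigcup_set1.
by move=> _ ->; apply: finI_from1; exists f.
Qed.

Lemma continuous_Sf (X : topologicalType) (h : X -> Sf G D u) :
  (forall f, open (h @^-1` [set p | sval p f])) -> continuous h.
Proof.
move=> hh; apply: (@continuous_subbase _ _ (@basicSf _ _ _ _ _ _ G D u)) => [U [F hF hU]|_ [f ->]].
  by exists F.
exact: hh.
Qed.

Lemma continuous_Af (X : topologicalType) (h : X -> Af G D u) :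
  (forall f, open (h @^-1` [set p | sval p f])) -> continuous h.
Proof.
move=> hh; apply: (@continuous_subbase _ _ (@basicAf _ _ _ _ _ _ G D u)) => [U [F hF hU]|_ [f ->]].
  by exists F.
exact: hh.
Qed.

Lemma continuous_Cf (X : topologicalType) (h : X -> Cf G D u) :
  (forall f, open (h @^-1` [set p | sval p f])) -> continuous h.
Proof.
move=> hh; apply: (@continuous_subbase _ _ (@basicCf _ _ _ _ _ _ G D u)) => [U [F hF hU]|_ [f ->]].
  by exists F.
exact: hh.
Qed.

End Spaces.

Section Realization.
Variables (L : lang) (Phi : set (ppformula L)) (E : expanded_ses Phi).
Variables (Gamma Delta : set (elt (Meq E))).
Hypotheses (hsub : Gamma `<=` Delta) (hDelta : Delta = dcl Delta).
Hypothesis hsat : saturated_succ (strM E) Delta.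
Variables (a : arity (lsort (langA E))) (b : arity (lsort (langB L))) (c : arity (lsort (langC E))).
Variable u : tup (strM E) (varM a b c).
Hypothesis H2 : Delta = dcl (partA Delta `|` partB Delta `|` partC Delta).
Local Notation N := (strM E).
Local Notation XV := (tup N (varM a b c)).

Lemma complete_type_realized (p : set (formula_over Delta (varMeq a b c))) :
  complete_type p -> exists v : XV, p = tpM Delta v.
Proof.
move=> [hfs hp].
pose q : set (XV -> Prop) := [set P | exists2 f, p f & P = fun v => @holds _ (Meq E) Delta _ f v].
have [||n P hP|v hv] := @saturation _ N Delta hDelta hsat set0 (varM a b c) q (countable0 _).
- exact: finctx_varM.
- move=> _ [f _ ->]; apply: (@definable_over_sub _ _ (real_part Delta)); first exact: subsetUl.
  by apply: (real_definable (real_generated H2)); exists f.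
- have [f hf hPf] := dep_choice2 hP; have [v hv] := hfs n f hf.
  by exists v => i; rewrite hPf; exact: hv.
exists v; apply/seteqP; split=> f hf.
  by apply: (hv (fun v => @holds _ (Meq E) Delta _ f v)); exists f.
have [//|hnf] := hp f; exfalso.
by have := hv (fun v => @holds _ (Meq E) Delta _ (Not f) v); apply; [exists (Not f)|exact: hf].
Qed.

Lemma tpM_Sf (v : XV) : nonforking_realization Gamma Delta u v ->
  [/\ complete_type (tpM Delta v), extends_p0 Gamma u (tpM Delta v) &
      ~ type_forks Gamma (tpM Delta v)].
Proof.
move=> [hv hf]; split=> //.
  split; first by move=> n f hfi; exists v.
  by move=> f; case: (pselect (tpM Delta v f)); [left|right].
move=> P hP; have [f hfP] := definable_over_sub hsub (p0_over hP).
exists 1%N, (fun=> f); split=> [_|w /(_ ord0)/hfP //].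
by apply/hfP; exact: hv.
Qed.

Lemma Sf_realized (p : Sf Gamma Delta u) :
  exists2 v, nonforking_realization Gamma Delta u v & sval p = tpM Delta v.
Proof.
case: p => p [hp he hf] /=; have [v hv] := complete_type_realized hp.
exists v => //; split; last by rewrite -hv.
by move=> P /he[n [f [hfp]]]; apply; move=> i; have := hfp i; rewrite hv.
Qed.

Lemma tpM_real_over (v w : XV) : tpM Delta v = tpM Delta w ->
  forall P, real_over Delta P -> P v -> P w.
Proof.
move=> h P [f hf] /hf hv; apply/hf.
by have : tpM Delta w f by rewrite -h.
Qed.

Hypothesis hPhi : fundamental_system (sB E) Phi.

Lemma tpM_eq (v w : XV) : tpA Delta v = tpA Delta w -> tpC Delta v = tpC Delta w ->
  tpM Delta v = tpM Delta w.
Proof.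
move=> hA hC; apply/seteqP.
suff key (v' w' : XV) : tpA Delta v' = tpA Delta w' -> tpC Delta v' = tpC Delta w' ->
    tpM Delta v' `<=` tpM Delta w'.
  by split; apply: key.
move=> {v w hA hC} hA hC f hf.
have [I [F [H hFH]]] := Delta_elimination hDelta hPhi H2
  (ex_intro _ f (fun v : XV => conj id id) : real_over Delta (fun v : XV => @holds _ (Meq E) Delta _ f v)).
apply/hFH; have [i [h1 h2]] := (hFH v').1 hf; exists i; split.
  by have : tpA Delta v' (F i) := h1; rewrite hA.
by have : tpC Delta v' (H i) := h2; rewrite hC.
Qed.

End Realization.

Theorem corollary5p4p5 (L : lang) (Phi : set (ppformula L)) (M : expanded_ses Phi)
    (hPhi : fundamental_system (sB M) Phi)
    (Gamma Delta : set (elt (Meq M)))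
    (hsub : Gamma `<=` Delta)
    (hGamma : Gamma = dcl Gamma) (hDelta : Delta = dcl Delta)
    (hsat : saturated_succ (strM M) Delta)
    (hhom : strongly_homogeneous_succ (strM M) Delta)
    (a : arity (lsort (langA M))) (b : arity (lsort (langB L))) (c : arity (lsort (langC M)))
    (u : tup (strM M) (varM a b c))
    (H1 : forall f : ppformula L, Phi f ->
          forall X : quotient (coset_rel (sC M) f),
            acl Gamma (elt_coset X) -> Gamma (elt_coset X))
    (H2 : Delta = dcl (partA Delta `|` partB Delta `|` partC Delta)) :
  exists h : Sf Gamma Delta u -> (Af Gamma Delta u * Cf Gamma Delta u)%type,
    homeomorphism h /\
    forall (v : tup (strM M) (varM a b c)) (p : Sf Gamma Delta u),
      sval p = tpM Delta v ->
      sval (h p).1 = tpA Delta v /\ sval (h p).2 = tpC Delta v.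
Proof.
(* [h] is computed from chosen realizations; [hE] shows that the result depends only on the type. *)
have [real realP realE] := dep_choice2 (fun p : Sf Gamma Delta u => Sf_realized hDelta hsat H2 p).
pose h (p : Sf Gamma Delta u) : Af Gamma Delta u * Cf Gamma Delta u :=
  (exist _ (tpA Delta (real p)) (ex_intro2 _ _ (real p) (realP p) erefl),
   exist _ (tpC Delta (real p)) (ex_intro2 _ _ (real p) (realP p) erefl)).
have hE v (p : Sf Gamma Delta u) : sval p = tpM Delta v ->
    sval (h p).1 = tpA Delta v /\ sval (h p).2 = tpC Delta v.
  rewrite realE => /esym/tpM_real_over hv /=.
  by split; [exact: real_over_tpA hv|exact: real_over_tpC hv].
have comb (q : Af Gamma Delta u * Cf Gamma Delta u) : exists2 w,
    nonforking_realization Gamma Delta u w & tpA Delta w = sval q.1 /\ tpC Delta w = sval q.2.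
  case: q => [[q1 [v nv hv]] [q2 [v' nv' hv']]]; rewrite /= hv hv'.
  have [w [nw wA wC]] := nonforking_combine hPhi hsub hDelta hsat H1 H2 nv nv'.
  by exists w.
have [w wP wE] := dep_choice2 comb.
pose g q : Sf Gamma Delta u := exist _ (tpM Delta (w q)) (tpM_Sf hsub (wP q)).
have sval_inj T (P : T -> Prop) (x y : {z | P z}) : sval x = sval y -> x = y.
  by case: x y => x hx [y hy] /= e; exact: eq_exist.
exists h; split; last exact: hE.
split.
  have [c1 c2] : continuous (fun p => (h p).1) /\ continuous (fun p => (h p).2).
    split; [apply: continuous_Af => F|apply: continuous_Cf => F].
      have [f hf] := Aformula_over c F.
      rewrite (_ : _ @^-1` _ = [set p | sval p f]); first exact: open_Sf.
      by apply/seteqP; split=> p /=; rewrite realE => /hf.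
    have [f hf] := Cformula_over a F.
    rewrite (_ : _ @^-1` _ = [set p | sval p f]); first exact: open_Sf.
    by apply/seteqP; split=> p /=; rewrite realE => /hf.
  by move=> p; exact: cvg_pair (c1 p) (c2 p).
exists g; split.
- apply: continuous_Sf => f.
  have hf : real_over Delta (fun v : tup (strM M) (varM a b c) => @holds _ (Meq M) Delta _ f v).
    by exists f.
  have [I [F [G hFG]]] := Delta_elimination hDelta hPhi H2 hf.
  (* Elimination over [Delta] makes the preimage of a basic open set a finite union of products of
     basic open sets, so continuity of the inverse follows directly. *)
  rewrite (_ : _ @^-1` _ = \bigcup_i (fst @^-1` [set q : Af Gamma Delta u | sval q (F i)] `&`
    snd @^-1` [set q : Cf Gamma Delta u | sval q (G i)])).
    apply: bigcup_open => i _; apply: openI.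
      have cf : continuous (@fst (Af Gamma Delta u) (Cf Gamma Delta u)).
        by move=> q; exact: cvg_fst.
      by move/continuousP: cf; apply; exact: open_Af.
    have cs : continuous (@snd (Af Gamma Delta u) (Cf Gamma Delta u)).
      by move=> q; exact: cvg_snd.
    by move/continuousP: cs; apply; exact: open_Cf.
  apply/seteqP; split=> q.
    move=> /hFG[i [hA hC]]; exists i => //; have [e1 e2] := wE q.
    by split; rewrite /= -?e1 -?e2.
  move=> [i _ [/= hA hC]]; apply/hFG; exists i; have [e1 e2] := wE q.
  by rewrite -e1 in hA; rewrite -e2 in hC.
- move=> p; apply: sval_inj; rewrite /= realE.
  by apply: (tpM_eq hDelta H2 hPhi); have [] := wE (h p).
move=> q; have [h1 h2] := hE (w q) (g q) erefl; have [e1 e2] := wE q.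
rewrite [LHS]surjective_pairing [RHS]surjective_pairing.
by congr pair; apply: sval_inj; rewrite ?h1 ?h2.
Qed.
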